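(* (1) Let $k$ be a field with $\operatorname{char} k\ne 2$, and let $G\subset GL_4(k)$ be a finite group belonging to the conjugacy class $(4,33,3)$ or $(4,33,6)$, i.e. $G$ is conjugate in $GL_4(k)$ to $\langle \lambda_1,\lambda_2,\sigma\rangle$ or to $\langle\lambda_1,\lambda_2,\sigma,\tau\rangle$, where these matrices are the ones given in the context. Then both fixed fields $k(x_1,x_2,x_3,x_4)^G$ and $k(x_1/x_4,x_2/x_4,x_3/x_4)^G$ are rational over $k$. (2) Let $k$ be a field with $\operatorname{char} k\ne 2,3$, and let $G\subset GL_4(k)$ be a finite group belonging to the conjugacy class $(4,33,7)$ or $(4,33,11)$, i.e. $G$ is conjugate in $GL_4(k)$ to $\langle \lambda_1,\lambda_2,\sigma,\lambda_3\rangle$ or to $\langle\lambda_1,\lambda_2,\sigma,\lambda_3,\lambda_4\rangle$, where these matrices are the ones given in the context. Then both fixed fields $k(x_1,x_2,x_3,x_4)^G$ and $k(x_1/x_4,x_2/x_4,x_3/x_4)^G$ are rational over $k$.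
   Context: Here $k(x_1,x_2,x_3,x_4)$ is the rational function field in four variables over $k$. A subgroup $G\subset GL_4(k)$ acts on it by $k$-automorphisms: for $g=(a_{ij})_{1\le i,j\le 4}\in G$ and $1\le j\le 4$, $g\cdot x_j=\sum_{1\le i\le 4}a_{ij}x_i$ (the coefficients are those of the $j$-th column). This action preserves the subfield $k(x_1/x_4,x_2/x_4,x_3/x_4)$. For a field $L$ with $G$-action, $L^G=\{f\in L: g\cdot f=f \text{ for all } g\in G\}$. A field extension of $k$ is called rational over $k$ if it is purely transcendental over $k$, i.e. generated over $k$ by finitely many algebraically independent elements. The following matrices have entries in $\mathbb{Z}[1/2]$ and are regarded as elements of $GL_4(k)$ for any field $k$ with $\operatorname{char}k\neq 2$: \[ \lambda_1=\begin{pmatrix}0&-1&0&0\\1&0&0&0\\0&0&0&1\\0&0&-1&0\end{pmatrix},\quad \lambda_2=\begin{pmatrix}0&0&-1&0\\0&0&0&-1\\1&0&0&0\\0&1&0&0\end{pmatrix},\quad \sigma=\frac12\begin{pmatrix}-1&1&1&1\\-1&-1&-1&1\\-1&1&-1&-1\\-1&-1&1&-1\end{pmatrix}, \] \[ \tau=\begin{pmatrix}0&0&-1&0\\0&-1&0&0\\-1&0&0&0\\0&0&0&1\end{pmatrix},\quad \lambda_3=\frac12\begin{pmatrix}-1&1&1&-1\\-1&-1&-1&-1\\-1&1&-1&1\\1&1&-1&-1\end{pmatrix},\quad \lambda_4=\begin{pmatrix}1&0&0&0\\0&0&0&1\\0&0&-1&0\\0&1&0&0\end{pmatrix}. \] The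 group $(4,33,3)$ is $\langle\lambda_1,\lambda_2,\sigma\rangle$; the group $(4,33,6)$ is $\langle\lambda_1,\lambda_2,\sigma,\tau\rangle$; the group $(4,33,7)$ is $\langle\lambda_1,\lambda_2,\sigma,\lambda_3\rangle$; the group $(4,33,11)$ is $\langle\lambda_1,\lambda_2,\sigma,\lambda_3,\lambda_4\rangle$. *)

(* Defs.v *)
From HB Require Import structures.
From mathcomp Require Import all_boot all_order all_algebra.
From mathcomp Require Import mpoly.

Set Implicit Arguments.
Unset Strict Implicit.
Unset Printing Implicit Defensive.

Import GRing.Theory.
Local Open Scope ring_scope.
Local Open Scope quotient_scope.

(* Subgroups of GL_n(k) for an arbitrary, possibly infinite, field k are
   represented by Prop-valued predicates on square matrices. *)
Section MatrixGroups.
Variables (k : fieldType) (n : nat).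
Implicit Types (G H : 'M[k]_n -> Prop) (A B P : 'M[k]_n).

Record is_GL_subgroup G : Prop := IsGLSubgroup {
  GL_subgroup_unit : forall A, G A -> A \in unitmx;
  GL_subgroup1 : G 1%:M;
  GL_subgroupM : forall A B, G A -> G B -> G (A *m B);
  GL_subgroupV : forall A, G A -> G (invmx A)
}.

Definition finite_mxset G : Prop :=
  exists s : seq 'M[k]_n, forall A, G A -> A \in s.

Inductive mxgenerated (s : seq 'M[k]_n) : 'M[k]_n -> Prop :=
| mxgen_mem A : A \in s -> mxgenerated s A
| mxgen1 : mxgenerated s 1%:M
| mxgenM A B : mxgenerated s A -> mxgenerated s B -> mxgenerated s (A *m B)
| mxgenV A : mxgenerated s A -> mxgenerated s (invmx A).

Definition GL_conjugate G H : Prop :=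
  exists2 P, P \in unitmx & forall A, G A <-> H (P *m A *m invmx P).

End MatrixGroups.

(* Intermediate fields of a field extension iota : k -> K, as predicates
   on K. *)
Section Extensions.
Variables (k K : fieldType) (iota : {rmorphism k -> K}).

Inductive adjoin (S : K -> Prop) : K -> Prop :=
| adjoin_base c : adjoin S (iota c)
| adjoin_mem z : S z -> adjoin S z
| adjoinD u v : adjoin S u -> adjoin S v -> adjoin S (u + v)
| adjoinN u : adjoin S u -> adjoin S (- u)
| adjoinM u v : adjoin S u -> adjoin S v -> adjoin S (u * v)
| adjoinV u : adjoin S u -> adjoin S u^-1.

Definition alg_independent m (y : 'I_m -> K) : Prop :=
  forall p : {mpoly k[m]}, mmap iota y p = 0 -> p = 0.

Definition rational_over (E : K -> Prop) : Prop :=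
  exists m : nat, exists2 y : 'I_m -> K,
    alg_independent y &
    forall f, E f <-> adjoin (fun z => exists i, z = y i) f.

End Extensions.

Section RationalFunctions.
Variables (k : fieldType) (n : nat).

Definition ratfun : fieldType := {fraction {mpoly k[n]}}.

Definition ratfunC : {rmorphism k -> ratfun} :=
  @tofrac {mpoly k[n]} \o @mpolyC n k.

Definition ratvar (i : 'I_n) : ratfun := tofrac 'X_i.

Definition mpoly_act (A : 'M[k]_n) (p : {mpoly k[n]}) : {mpoly k[n]} :=
  p \mPo [tuple \sum_(i < n) A i j *: 'X_i | j < n].

(* For A invertible, mpoly_act A is an automorphism of the polynomial ring, so
   the value below does not depend on the chosen representative of f. *)
Definition ratfun_act (A : 'M[k]_n) (f : ratfun) : ratfun :=
  let r : {ratio {mpoly k[n]}} := repr f in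
  tofrac (mpoly_act A \n_r) / tofrac (mpoly_act A \d_r).

(* The field L^G for an intermediate field L of k(x_1, ..., x_n) / k. *)
Definition fixed_field (G : 'M[k]_n -> Prop) (L : ratfun -> Prop) :
    ratfun -> Prop :=
  fun f => L f /\ forall A, G A -> ratfun_act A f = f.

End RationalFunctions.

Definition whole_field (k : fieldType) n : ratfun k n -> Prop := fun=> True.

(* The subfield k(x_1/x_(n+1), ..., x_n/x_(n+1)) of k(x_1, ..., x_(n+1)). *)
Definition degree0_field (k : fieldType) n : ratfun k n.+1 -> Prop :=
  adjoin (ratfunC k n.+1)
    (fun z => exists i : 'I_n,
       z = ratvar k (lift ord_max i) / ratvar k ord_max).

Section Matrices.
Variable k : fieldType.

Definition mx4_of_rows (s : seq (seq k)) : 'M[k]_4 :=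
  \matrix_(i < 4, j < 4) (nth [::] s i)`_j.

Definition lambda1 : 'M[k]_4 := mx4_of_rows
  [:: [:: 0; -1;  0; 0];
      [:: 1;  0;  0; 0];
      [:: 0;  0;  0; 1];
      [:: 0;  0; -1; 0] ].

Definition lambda2 : 'M[k]_4 := mx4_of_rows
  [:: [:: 0; 0; -1;  0];
      [:: 0; 0;  0; -1];
      [:: 1; 0;  0;  0];
      [:: 0; 1;  0;  0] ].

Definition sigma : 'M[k]_4 := 2^-1 *: mx4_of_rows
  [:: [:: -1;  1;  1;  1];
      [:: -1; -1; -1;  1];
      [:: -1;  1; -1; -1];
      [:: -1; -1;  1; -1] ].

Definition tau : 'M[k]_4 := mx4_of_rows
  [:: [::  0;  0; -1; 0];
      [::  0; -1;  0; 0];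
      [:: -1;  0;  0; 0];
      [::  0;  0;  0; 1] ].

Definition lambda3 : 'M[k]_4 := 2^-1 *: mx4_of_rows
  [:: [:: -1;  1;  1; -1];
      [:: -1; -1; -1; -1];
      [:: -1;  1; -1;  1];
      [::  1;  1; -1; -1] ].

Definition lambda4 : 'M[k]_4 := mx4_of_rows
  [:: [:: 1; 0;  0; 0];
      [:: 0; 0;  0; 1];
      [:: 0; 0; -1; 0];
      [:: 0; 1;  0; 0] ].

Definition group_4_33_3 : 'M[k]_4 -> Prop :=
  mxgenerated [:: lambda1; lambda2; sigma].

Definition group_4_33_6 : 'M[k]_4 -> Prop :=
  mxgenerated [:: lambda1; lambda2; sigma; tau].

Definition group_4_33_7 : 'M[k]_4 -> Prop :=
  mxgenerated [:: lambda1; lambda2; sigma; lambda3].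

Definition group_4_33_11 : 'M[k]_4 -> Prop :=
  mxgenerated [:: lambda1; lambda2; sigma; lambda3; lambda4].

End Matrices.

Arguments group_4_33_3 k _ : clear implicits.
Arguments group_4_33_6 k _ : clear implicits.
Arguments group_4_33_7 k _ : clear implicits.
Arguments group_4_33_11 k _ : clear implicits.
Arguments whole_field k n _ : clear implicits.
Arguments degree0_field k n _ : clear implicits.

(* Main.v *)
Require Import Defs.
From HB Require Import structures.
From mathcomp Require Import all_boot all_order all_algebra.
From mathcomp Require Import mpoly.
From mathcomp Require Import ring.
From Stdlib Require Import ClassicalEpsilon.

Set Implicit Arguments.
Unset Strict Implicit.
Unset Printing Implicit Defensive.

Import GRing.Theory.
Local Open Scope ring_scope.

(** Let x_1, ..., x_4 be read as the coordinates of a quaternion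
    q = x_2 + x_1 i + x_3 j + x_4 k. The matrices lambda1, lambda2 and sigma are
    left multiplications and generate the binary tetrahedral group, lambda3 is a
    right multiplication of order three, and lambda4 a two-sided one; tau is
    conjugate to lambda4 under right multiplication by j, so that the four groups
    are generated by lambda1, lambda2, sigma, with or without lambda3 and lambda4.

    The functions of degree zero are those on the group SO_3, by q -> p with
    p(x) = q x q^-1. On the rows of the rotation matrix, lambda1 and lambda2
    act by signs and sigma by a signed cyclic permutation. Rows up to sign are
    three orthogonal lines; in the affine chart around the line of (1, 1, 1)
    these are the vertices of a triangle in the plane k(sqrt(-3)) whose inner
    products are constant, and sigma rotates the vertices. In terms of the
    centroid of the triangle and of the Lagrange resolvent of the u_i (the
    inverse squares of the coordinates of the image of (1, 1, 1), up to a common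
    factor) four invariants satisfy
      alpha^2 + 3 beta^2 + 6 zeta^2 + 2 pi^2 = 18
    (quadric_equation) and they generate all invariants of degree zero when
    char k <> 2, 3 (A4_invariants). This quadric has the rational point
    (0, 2, 1, 0), from which it is projected. The matrix lambda3 multiplies
    alpha + beta sqrt(-3) by a cube root of unity; dividing its cube by its norm
    gives the same quadric again (invariants_33_7). The matrix lambda4 changes
    the signs of alpha and pi, and the quotient by this reflection is rational
    because the equation can be projected first and is then even in the two
    coordinates (invariants_33_6, invariants_33_11). In characteristic three
    the vector (1, 1, 1) is isotropic; there the three generators are the
    constant difference of the w_i, their root m and a moment
    (A4_invariants_char3, invariants_33_6_char3).

    That a function fixed by the group lies in the field E of the proposed
    generators is shown by climbing from E in steps of degree two and three:
    an element of an extension of degree d generated by an element with d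
    distinct conjugates lies in the base as soon as it is fixed
    (quadratic_ext_fixed, cubic_ext_fixed). All invariants are obtained from
    those of degree zero by adjoining the norm of q, since -1 belongs to the
    group (even_functions). Algebraic independence needs no computation: every
    variable is a root of the polynomial whose roots are its conjugates under
    the finite group, so it is algebraic over the fixed field, and by the
    exchange lemma four generators of that field must be independent
    (spanning_family_free, rational_from_generators). *)

(** * Subfields and their extensions of degree two and three *)

Section Subfields.
Variable K : fieldType.
Implicit Types (F : K -> Prop) (u v z : K).

Record subfield F : Prop := Subfield {
  subfield1 : F 1;
  subfieldB : forall u v, F u -> F v -> F (u - v);
  subfieldM : forall u v, F u -> F v -> F (u * v);
  subfieldV : forall u, F u -> F u^-1
}.

Section Closure.
Variables (F : K -> Prop) (fF : subfield F).

Lemma subfield0 : F 0.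
Proof. by rewrite -(subrr 1); apply: subfieldB => //; apply: subfield1. Qed.

Lemma subfieldN u : F u -> F (- u).
Proof. by move=> Fu; rewrite -sub0r; apply: subfieldB => //; apply: subfield0. Qed.

Lemma subfieldD u v : F u -> F v -> F (u + v).
Proof. by move=> Fu Fv; rewrite -(opprK v); apply: subfieldB => //; apply: subfieldN. Qed.

Lemma subfield_natmul u n : F u -> F (u *+ n).
Proof.
move=> Fu; elim: n => [|n IHn]; first exact: subfield0.
by rewrite mulrS; apply: subfieldD.
Qed.

Lemma subfieldX u n : F u -> F (u ^+ n).
Proof.
move=> Fu; elim: n => [|n IHn]; first exact: subfield1.
by rewrite exprS; apply: subfieldM.
Qed.

Lemma subfield_sum (I : Type) (r : seq I) (P : pred I) (E : I -> K) :
  (forall i, F (E i)) -> F (\sum_(i <- r | P i) E i).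
Proof.
move=> FE; elim/big_ind: _ => //; first exact: subfield0.
by move=> u v; apply: subfieldD.
Qed.

End Closure.
End Subfields.

Ltac in_subfield := repeat first
  [ assumption | apply: subfield1 | apply: subfield0
  | apply: subfieldD | apply: subfieldN | apply: subfieldM
  | apply: subfieldV | apply: subfield_natmul | apply: subfieldX ].

Section Adjunction.
Variables (k K : fieldType) (iota : {rmorphism k -> K}).
Implicit Types (S F : K -> Prop) (z : K).

Lemma adjoin_subfield S : subfield (adjoin iota S).
Proof.
split=> [|u v Su Sv|u v|u]; first by rewrite -(rmorph1 iota); apply: adjoin_base.
- by apply: adjoinD => //; apply: adjoinN.
- exact: adjoinM.
- exact: adjoinV.
Qed.

Lemma adjoin_least S F : subfield F -> (forall c, F (iota c)) ->
  (forall z, S z -> F z) -> forall z, adjoin iota S z -> F z.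
Proof. by move=> fF Fk SF z; elim=> *; auto; in_subfield. Qed.

Lemma adjoin_mono S S' : (forall z, S z -> S' z) ->
  forall z, adjoin iota S z -> adjoin iota S' z.
Proof.
move=> SS'; apply: adjoin_least; first exact: adjoin_subfield.
  exact: adjoin_base.
by move=> z /SS'; apply: adjoin_mem.
Qed.

Lemma adjoin_fixed (g : {rmorphism K -> K}) S :
  (forall c, g (iota c) = iota c) -> (forall z, S z -> g z = z) ->
  forall z, adjoin iota S z -> g z = z.
Proof.
move=> gk gS; apply: adjoin_least => //.
by split=> [|u v gu gv|u v gu gv|u gu]; rewrite ?rmorph1 ?rmorphB ?rmorphM ?fmorphV ?gu ?gv.
Qed.

End Adjunction.

Section QuadraticStep.
Variables (K : fieldType) (F : K -> Prop) (fF : subfield F) (a : K).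

Definition quadratic_ext : K -> Prop :=
  fun z => exists b c, [/\ F b, F c & z = b + c * a].

Lemma quadratic_ext_base z : F z -> quadratic_ext z.
Proof. by move=> Fz; exists z, 0; split=> //; [apply: subfield0 | ring]. Qed.

Lemma quadratic_ext_gen : quadratic_ext a.
Proof. by exists 0, 1; split; [apply: subfield0|apply: subfield1|ring]. Qed.

Lemma quadratic_ext_subfield : F (a ^+ 2) -> subfield quadratic_ext.
Proof.
move=> Fa2; split.
- by apply: quadratic_ext_base; apply: subfield1.
- move=> _ _ [b [c [Fb Fc ->]]] [b' [c' [Fb' Fc' ->]]].
  by exists (b - b'), (c - c'); split; [in_subfield|in_subfield|ring].
- move=> _ _ [b [c [Fb Fc ->]]] [b' [c' [Fb' Fc' ->]]].
  by exists (b * b' + c * c' * a ^+ 2), (b * c' + c * b'); split;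
    [in_subfield|in_subfield|ring].
move=> _ [b [c [Fb Fc ->]]].
have [bc0|bc_neq0] := eqVneq (b - c * a) 0.
  (* here b = c a, so that a lies in F unless c = 0 *)
  have [c0|c_neq0] := eqVneq c 0.
    rewrite c0 mul0r addr0; apply: quadratic_ext_base; in_subfield.
  have -> : a = b / c by rewrite -(subrK (c * a) b) bc0; field.
  by apply: quadratic_ext_base; in_subfield.
have [->|z_neq0] := eqVneq (b + c * a) 0.
  by rewrite invr0; apply: quadratic_ext_base; apply: subfield0.
have d_neq0 : b ^+ 2 - c ^+ 2 * a ^+ 2 != 0.
  by rewrite -exprMn subr_sqr mulf_neq0.
exists (b / (b ^+ 2 - c ^+ 2 * a ^+ 2)), (- c / (b ^+ 2 - c ^+ 2 * a ^+ 2)).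
by split; [in_subfield|in_subfield|field; rewrite exprMn d_neq0].
Qed.

Lemma quadratic_ext_fixed (g : {rmorphism K -> K}) z :
  (forall u, F u -> g u = u) -> g a = - a -> a != 0 -> 2%:R != 0 :> K ->
  quadratic_ext z -> g z = z -> F z.
Proof.
move=> gF ga a_neq0 two_neq0 [b [c [Fb Fc ->]]].
rewrite rmorphD rmorphM ga (gF b) // (gF c) // => /eqP.
rewrite -subr_eq0 (_ : _ - _ = - (2%:R * c * a)); last by ring.
by rewrite oppr_eq0 !mulf_eq0 (negPf two_neq0) (negPf a_neq0) orbF /= => /eqP ->; rewrite mul0r addr0.
Qed.

End QuadraticStep.

(** The element t0 has the conjugates t1 and t2 under g, with symmetric
    functions in F. *)
Section CubicStep.
Variables (K : fieldType) (F : K -> Prop) (fF : subfield F).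
Variables (g : {rmorphism K -> K}) (t0 t1 t2 : K).
Hypothesis gF : forall u, F u -> g u = u.
Hypotheses (gt0 : g t0 = t1) (gt1 : g t1 = t2) (gt2 : g t2 = t0).
Hypotheses (t01 : t0 != t1) (t12 : t1 != t2) (t20 : t2 != t0).
Hypotheses (Fe1 : F (t0 + t1 + t2)) (Fe2 : F (t0 * t1 + t1 * t2 + t2 * t0))
  (Fe3 : F (t0 * t1 * t2)).

Definition cubic_ext : K -> Prop :=
  fun z => exists a b c, [/\ F a, F b, F c & z = a + b * t0 + c * t0 ^+ 2].

Lemma cubic_ext_base z : F z -> cubic_ext z.
Proof.
by move=> Fz; exists z, 0, 0; split=> //; [apply: subfield0..|ring].
Qed.

Lemma cubic_ext_gen : cubic_ext t0.
Proof. by exists 0, 1, 0; split; [apply: subfield0|apply: subfield1|apply: subfield0|ring]. Qed.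

(** A polynomial of degree at most two that takes one value at three distinct
    conjugates is constant; no division by three is involved. *)
Lemma cubic_ext_fixed z : cubic_ext z -> g z = z -> F z.
Proof.
case=> a [b [c [Fa Fb Fc ->]]] gz.
have g1 : a + b * t1 + c * t1 ^+ 2 = a + b * t0 + c * t0 ^+ 2.
  by rewrite -[RHS]gz !rmorphD !rmorphM /= ?expr2 gt0 !gF.
have g2 : a + b * t2 + c * t2 ^+ 2 = a + b * t0 + c * t0 ^+ 2.
  by rewrite -[RHS]gz -[in RHS]g1 !rmorphD !rmorphM /= ?expr2 gt1 !gF.
have b01 : b + c * (t0 + t1) = 0.
  have /eqP : (t1 - t0) * (b + c * (t0 + t1)) = 0.
    rewrite -(subrr (a + b * t0 + c * t0 ^+ 2)) -[X in _ = X - _]g1; ring.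
  by rewrite mulf_eq0 subr_eq0 eq_sym (negPf t01) => /eqP.
have b02 : b + c * (t0 + t2) = 0.
  have /eqP : (t2 - t0) * (b + c * (t0 + t2)) = 0.
    rewrite -(subrr (a + b * t0 + c * t0 ^+ 2)) -[X in _ = X - _]g2; ring.
  by rewrite mulf_eq0 subr_eq0 (negPf t20) => /eqP.
have c0 : c = 0.
  have /eqP : (t1 - t2) * c = 0.
    rewrite -[RHS](subrr (b + c * (t0 + t1))) [X in _ = _ - X]b01 -b02; ring.
  by rewrite mulf_eq0 subr_eq0 (negPf t12) => /eqP.
by move: b01; rewrite c0 !mul0r !addr0 => ->; rewrite mul0r addr0.
Qed.

(** The inverse of z is the product of its other two conjugates over its norm,
    and that product is a polynomial in t0, being symmetric in t1 and t2. *)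
Lemma cubic_ext_subfield : subfield cubic_ext.
Proof.
pose e1 := t0 + t1 + t2; pose e2 := t0 * t1 + t1 * t2 + t2 * t0.
pose e3 := t0 * t1 * t2.
have Fe_1 : F e1 := Fe1; have Fe_2 : F e2 := Fe2; have Fe_3 : F e3 := Fe3.
have cubD u v : cubic_ext u -> cubic_ext v -> cubic_ext (u - v).
  move=> [a [b [c [Fa Fb Fc ->]]]] [a' [b' [c' [Fa' Fb' Fc' ->]]]].
  exists (a - a'), (b - b'), (c - c').
  by split; [in_subfield..|ring].
have cubM u v : cubic_ext u -> cubic_ext v -> cubic_ext (u * v).
  move=> [a [b [c [Fa Fb Fc ->]]]] [a' [b' [c' [Fa' Fb' Fc' ->]]]].
  (* reduction modulo t0^3 = e1 t0^2 - e2 t0 + e3 *)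
  pose p3 := b * c' + c * b'; pose p4 := c * c'.
  exists (a * a' + p3 * e3 + p4 * e1 * e3),
    (a * b' + b * a' - p3 * e2 + p4 * (e3 - e1 * e2)),
    (a * c' + b * b' + c * a' + p3 * e1 + p4 * (e1 ^+ 2 - e2)).
  split; rewrite /p3 /p4; [in_subfield..|rewrite /e1 /e2 /e3; ring].
split=> //; first by apply: cubic_ext_base; apply: subfield1.
move=> z [a [b [c [Fa Fb Fc zE]]]].
have [->|z_neq0] := eqVneq z 0; first by rewrite invr0; apply: cubic_ext_base; apply: subfield0.
have cz : cubic_ext z by exists a, b, c.
have gz : g z = a + b * t1 + c * t1 ^+ 2.
  by rewrite zE !rmorphD !rmorphM /= ?expr2 gt0 !gF.
have ggz : g (g z) = a + b * t2 + c * t2 ^+ 2.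
  by rewrite gz !rmorphD !rmorphM /= ?expr2 gt1 !gF.
have gggz : g (g (g z)) = z.
  by rewrite ggz !rmorphD !rmorphM /= ?expr2 gt2 !gF.
(* the product of the other two conjugates is symmetric in t1 and t2 *)
have cz' : cubic_ext (g z * g (g z)).
  pose s := e1 - t0; pose q := e2 - t0 * s.
  have -> : g z * g (g z) = a ^+ 2 + a * b * s + a * c * (s ^+ 2 - 2%:R * q)
     + b ^+ 2 * q + b * c * q * s + c ^+ 2 * q ^+ 2.
    by rewrite ggz gz /q /s /e1 /e2; ring.
  have F1 := cubic_ext_base Fa; have F2 := cubic_ext_base Fb.
  have F3 := cubic_ext_base Fc; have F4 := cubic_ext_base Fe_1.
  have F5 := cubic_ext_base Fe_2; have F6 := cubic_ext_gen.
  have N u : cubic_ext u -> cubic_ext (- u).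
    by move=> cu; rewrite -sub0r; apply: cubD => //; apply: cubic_ext_base; apply: subfield0.
  have A u v : cubic_ext u -> cubic_ext v -> cubic_ext (u + v).
    by move=> cu cv; rewrite -(opprK v); apply: cubD => //; apply: N.
  have C2 : cubic_ext 2%:R by apply: cubic_ext_base; in_subfield.
  rewrite /q /s !expr2.
  by repeat first [assumption | apply A | apply N | apply cubM].
have Fn : F (z * (g z * g (g z))).
  apply: cubic_ext_fixed; first exact: cubM.
  by rewrite !rmorphM /= gggz; ring.
have -> : z^-1 = (z * (g z * g (g z)))^-1 * (g z * g (g z)).
  by field; rewrite !fmorph_eq0 z_neq0.
by apply: cubM => //; apply: cubic_ext_base; apply: subfieldV.
Qed.

End CubicStep.

(** * Algebraic dependence *)

Section SubfieldType.
Variables (K : fieldType) (F : K -> Prop) (fF : subfield F).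

Definition subfield_mem of subfield F : {pred K} :=
  fun z => if excluded_middle_informative (F z) then true else false.

Lemma subfield_memP z : reflect (F z) (z \in subfield_mem fF).
Proof.
by rewrite unfold_in /subfield_mem; case: excluded_middle_informative => Fz; constructor.
Qed.

Lemma subfield_mem_divring_closed : divring_closed (subfield_mem fF).
Proof.
split=> [|u v /subfield_memP Fu /subfield_memP Fv|u v /subfield_memP Fu /subfield_memP Fv];
  apply/subfield_memP; first exact: subfield1; last by in_subfield.
exact: subfieldB.
Qed.

HB.instance Definition _ := GRing.isDivringClosed.Build K (subfield_mem fF)
  subfield_mem_divring_closed.

(** As a type, a subfield can be the base ring in the theory of integral
    elements, from which the transitivity of algebraicity is taken. *)
Record subfield_type : Type := SubfieldElt {
  subfield_val :> K;
  _ : subfield_val \in subfield_mem fF }.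

HB.instance Definition _ := [isSub for subfield_val].
HB.instance Definition _ := [Choice of subfield_type by <:].
HB.instance Definition _ := [SubChoice_isSubIntegralDomain of subfield_type by <:].
HB.instance Definition _ := [SubIntegralDomain_isSubField of subfield_type by <:].

End SubfieldType.

Section Fractions.
Variables (K : fieldType) (A : K -> Prop).

Record subring : Prop := Subring {
  subring1 : A 1;
  subringB : forall u v, A u -> A v -> A (u - v);
  subringM : forall u v, A u -> A v -> A (u * v)
}.

Definition fraction_of (z : K) := exists a b, [/\ A a, A b, b != 0 & z = a / b].

Hypothesis rA : subring.

Lemma fraction_base z : A z -> fraction_of z.
Proof. by move=> Az; exists z, 1; split; rewrite ?oner_neq0 ?divr1 //; apply: subring1. Qed.

Lemma fraction_subfield : subfield fraction_of.
Proof.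
have AM := subringM rA.
split=> [|_ _ [a [b [Aa Ab b0 ->]]] [c [d [Ac Ad d0 ->]]]
  |_ _ [a [b [Aa Ab b0 ->]]] [c [d [Ac Ad d0 ->]]]|_ [a [b [Aa Ab b0 ->]]]].
- exact/fraction_base/subring1.
- exists (a * d - c * b), (b * d); split; [|exact: AM|exact: mulf_neq0|by field; rewrite b0 d0].
  by apply: subringB => //; apply: AM.
- by exists (a * c), (b * d); split; [apply: AM|apply: AM|apply: mulf_neq0|field; rewrite b0 d0].
have [->|a0] := eqVneq a 0; last by exists b, a; split=> //; rewrite invf_div.
exists 0, 1; split; rewrite ?oner_neq0 ?mul0r ?invr0 //; last exact: subring1.
by rewrite -(subrr 1); apply: subringB => //; apply: subring1.
Qed.

Lemma common_denominator (c : nat -> K) n : (forall i, fraction_of (c i)) ->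
  exists2 d, A d /\ d != 0 & forall i, (i < n)%N -> A (d * c i).
Proof.
move=> Ac; have AM := subringM rA; elim: n => [|n [d [Ad d_neq0] dc]].
  by exists 1 => //; split; [apply: subring1|apply: oner_neq0].
have [a [b [Aa Ab b0 cnE]]] := Ac n.
exists (d * b) => [|i]; first by split; [apply: AM|apply: mulf_neq0].
rewrite ltnS leq_eqVlt => /predU1P [->|/dc Adci].
  by rewrite cnE (_ : d * b * _ = d * a); [apply: AM|field].
by rewrite mulrAC; apply: AM.
Qed.

End Fractions.

Section AlgebraicDependence.
Variables (k K : fieldType) (iota : {rmorphism k -> K}).
Implicit Types (S T F : K -> Prop) (z : K) (X Y : seq K).

Definition coefs_in F (p : {poly K}) := forall i, F p`_i.

Definition algebraic F z := exists p : {poly K}, [/\ p != 0, coefs_in F p & root p z].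

Definition algebraic_on S := algebraic (adjoin iota S).

Section Transfer.
Variables (F : K -> Prop) (fF : subfield F).
Let v : {rmorphism subfield_type fF -> K} := val.

Lemma algebraicE z : algebraic F z <-> integralOver v z.
Proof.
split=> [[p [p_neq0 Fp pz]]|/integral_algebraic [p p_neq0 pz]].
  apply: (integral_root p_neq0 pz) => _ /(nthP 0) [i _ <-].
  have Fi : p`_i \in subfield_mem fF by apply/subfield_memP.
  by rewrite (_ : p`_i = v (SubfieldElt Fi)) //; apply: integral_id.
exists (map_poly v p); split=> //; first by rewrite map_poly_eq0.
by move=> i; rewrite coef_map; apply/(subfield_memP fF)/(valP p`_i).
Qed.

Lemma algebraic_subfield : subfield (algebraic F).
Proof.
split=> [|x y|x y|x]; rewrite !algebraicE; first exact: integral1.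
- exact: integral_sub.
- exact: integral_mul.
- exact: integral_inv.
Qed.

Lemma algebraic_base z : F z -> algebraic F z.
Proof.
move=> Fz; exists ('X - z%:P); split; first by rewrite polyXsubC_eq0.
  move=> i; rewrite coefB coefX coefC; apply: subfieldB => //.
    by case: eqP => _; [apply: subfield1|apply: subfield0].
  by case: eqP => _ //; apply: subfield0.
by rewrite root_XsubC.
Qed.

Lemma algebraic_root (p : {poly K}) z :
  p != 0 -> coefs_in (algebraic F) p -> root p z -> algebraic F z.
Proof.
move=> p_neq0 Fp pz; apply/algebraicE.
by apply: (integral_root p_neq0 pz) => _ /(nthP 0) [i _ <-]; apply/algebraicE.
Qed.

End Transfer.

Lemma algebraic_on_subfield S : subfield (algebraic_on S).
Proof. exact/algebraic_subfield/adjoin_subfield. Qed.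

Lemma algebraic_on_mem S z : S z -> algebraic_on S z.
Proof. by move=> Sz; apply/algebraic_base; [apply: adjoin_subfield|apply: adjoin_mem]. Qed.

Lemma algebraic_on_trans S T z :
  (forall s, S s -> algebraic_on T s) -> algebraic_on S z -> algebraic_on T z.
Proof.
move=> ST [p [p_neq0 Sp pz]]; apply: algebraic_root pz => //; first exact: adjoin_subfield.
move=> i; apply: (adjoin_least _ _ ST) (Sp i); first exact: algebraic_on_subfield.
by move=> c; apply/algebraic_base; [apply: adjoin_subfield|apply: adjoin_base].
Qed.

Lemma algebraic_on_mono S T z :
  (forall s, S s -> T s) -> algebraic_on S z -> algebraic_on T z.
Proof. by move=> ST; apply: algebraic_on_trans => s /ST; apply: algebraic_on_mem. Qed.

Definition adjoined S w : K -> Prop := fun z => S z \/ z = w.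

Lemma coefs_in_mul F (p q : {poly K}) : subfield F ->
  coefs_in F p -> coefs_in F q -> coefs_in F (p * q).
Proof. by move=> fF Fp Fq i; rewrite coefM; apply: subfield_sum => // j; apply: subfieldM. Qed.

Lemma coefs_in_const F c : subfield F -> F c -> coefs_in F c%:P.
Proof. by move=> fF Fc i; rewrite coefC; case: eqP => // _; apply: subfield0. Qed.

Lemma polynomials_subring F w : subfield F ->
  subring (fun u => exists2 p, coefs_in F p & u = p.[w]).
Proof.
move=> fF; split=> [|_ _ [p Fp ->] [q Fq ->]|_ _ [p Fp ->] [q Fq ->]].
- by exists 1; rewrite ?hornerC //; apply: coefs_in_const => //; apply: subfield1.
- exists (p - q); last by rewrite hornerD hornerN.
  by move=> i; rewrite coefB; apply: subfieldB.
- by exists (p * q); [apply: coefs_in_mul|rewrite hornerM].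
Qed.

(** The quotients of polynomials in w form a field with the required generators. *)
Lemma adjoined_fraction S w z : adjoin iota (adjoined S w) z ->
  fraction_of (fun u => exists2 p, coefs_in (adjoin iota S) p & u = p.[w]) z.
Proof.
pose F := adjoin iota S; have fF : subfield F := adjoin_subfield iota S.
set A := fun u => _.
have rA : subring A by exact: polynomials_subring.
apply: adjoin_least; first exact: fraction_subfield.
  move=> c; apply: fraction_base => //; exists (iota c)%:P; last by rewrite hornerC.
  by apply: coefs_in_const => //; apply: adjoin_base.
move=> u [Su|->]; apply: fraction_base => //.
  exists u%:P; last by rewrite hornerC.
  by apply: coefs_in_const => //; apply: adjoin_mem.
exists 'X; last by rewrite hornerX.
by move=> i; rewrite coefX; case: eqP => _; [apply: subfield1|apply: subfield0].
Qed.

(** An equation for z over S(w) is a polynomial relation between w and z. Read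
    as an equation for w over S(z) it can only be void if its coefficients at
    powers of w are equations for z over S. *)
Lemma algebraic_exchange S w z :
  algebraic_on (adjoined S w) z -> ~ algebraic_on S z ->
  algebraic_on (adjoined S z) w.
Proof.
pose F := adjoin iota S; have fF : subfield F := adjoin_subfield iota S.
have fFz := adjoin_subfield iota (adjoined S z).
have FFz u : F u -> adjoin iota (adjoined S z) u by apply: adjoin_mono => s Ss; left.
have Fzz : adjoin iota (adjoined S z) z by apply: adjoin_mem; right.
move=> [r [r_neq0 Fr rz]] z_free.
have rA : subring (fun u => exists2 p, coefs_in F p & u = p.[w]) by exact: polynomials_subring.
have [d [_ d_neq0] rd] := common_denominator rA (size r) (fun i => adjoined_fraction (Fr i)).
have [p Fp] : exists p : 'I_(size r) -> {poly K},
    forall j, coefs_in F (p j) /\ d * r`_j = (p j).[w].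
  apply: (@fin_all_exists _ (fun=> {poly K}) (fun j q => coefs_in F q /\ _ = q.[w])) => j.
  by have [q Fq qE] := rd j (ltn_ord j); exists q.
(* the relation sum_j p_j(w) z^j = 0, read as a polynomial in w *)
pose q := \sum_(j < size r) z ^+ j *: p j.
have qw : root q w.
  suff qwE : q.[w] = d * r.[z] by rewrite rootE qwE (rootP rz) mulr0.
  rewrite [r.[z]]horner_coef mulr_sumr /q horner_sum; apply: eq_bigr => j _.
  by rewrite hornerZ -(Fp j).2; ring.
have [q0|q_neq0] := eqVneq q 0; last first.
  exists q; split=> // i; rewrite coef_sum; apply: subfield_sum => // j.
  rewrite coefZ; apply: subfieldM => //; last exact: FFz ((Fp j).1 i).
  exact: subfieldX.
(* otherwise each power of w contributes a relation for z over F *)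
have [j pj0] : exists j, p j != 0.
  have szr : ((size r).-1 < size r)%N by rewrite prednK // size_poly_gt0.
  exists (Ordinal szr); apply: contraNneq r_neq0 => p0.
  have := (Fp (Ordinal szr)).2; rewrite p0 horner0 => /eqP.
  by rewrite mulf_eq0 (negPf d_neq0) /= -lead_coef_eq0.
pose i := (size (p j)).-1.
case: z_free; exists (\sum_(l < size r) (p l)`_i *: 'X^l); split.
- have pji : (p j)`_i != 0 by rewrite -lead_coefE lead_coef_eq0.
  apply: contraNneq pji => /polyP /(_ j); rewrite coef0 coef_sum.
  rewrite (bigD1 j) //= coefZ coefXn eqxx mulr1 big1 ?addr0 => [->//|l lj].
  by rewrite coefZ coefXn eq_sym (inj_eq val_inj) (negPf lj) mulr0.
- move=> l; rewrite coef_sum; apply: subfield_sum => // m.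
  rewrite coefZ coefXn; apply: subfieldM => //; first exact: (Fp m).1.
  by apply: subfield_natmul => //; apply: subfield1.
apply/rootP; rewrite horner_sum; have /polyP /(_ i) := q0.
rewrite coef0 coef_sum => qi; rewrite -[RHS]qi; apply: eq_bigr => l _.
by rewrite hornerZ hornerXn coefZ mulrC.
Qed.

(** Algebraic independence in triangular form, so that the head of a list can
    be moved to the base. *)
Fixpoint free_over S X : Prop :=
  if X is x :: X' then ~ algebraic_on S x /\ free_over (adjoined S x) X' else True.

Definition extended S Y : K -> Prop := fun z => S z \/ z \in Y.

(** The head x of X becomes algebraic when some y of Y is reached; y can then be
    exchanged for x, and over S(x) both lists have become shorter by one. *)
Lemma steinitz X : forall S Y, free_over S X ->
  (forall x, x \in X -> algebraic_on (extended S Y) x) -> (size X <= size Y)%N.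
Proof.
elim: X => [|x X IHX] // S Y [x_free X_free] XY.
have [Y1 [y [Y2 [YE xY1 xY2]]]] : exists Y1 y Y2, [/\ Y = Y1 ++ y :: Y2,
    ~ algebraic_on (extended S Y1) x & algebraic_on (adjoined (extended S Y1) y) x].
  have : algebraic_on (extended S Y) x by apply: XY; rewrite inE eqxx.
  elim/last_ind: {IHX XY} Y => [|Y y IHY] xY.
    by case: x_free; apply: algebraic_on_mono xY => s [].
  have [xY'|xY'] := classic (algebraic_on (extended S Y) x).
    have [Y1 [y1 [Y2 [-> ? ?]]]] := IHY xY'.
    by exists Y1, y1, (rcons Y2 y); rewrite rcons_cat.
  exists Y, y, [::]; split; rewrite ?cats1 //.
  apply: algebraic_on_mono xY => s [Ss|]; first by left; left.
  by rewrite mem_rcons inE => /orP [/eqP ->|sY]; [right|left; right].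
have yx := algebraic_exchange xY2 xY1.
have sz : size Y = (size (Y1 ++ Y2)).+1 by rewrite YE !size_cat /= addnS.
rewrite sz ltnS; apply: (IHX _ _ X_free) => x' Xx'.
have {Xx'} : algebraic_on (extended S Y) x' by apply: XY; rewrite inE Xx' orbT.
apply: algebraic_on_trans => s; rewrite YE => -[Ss|].
  by apply: algebraic_on_mem; left; left.
rewrite mem_cat inE => /or3P [sY1|/eqP ->|sY2].
- by apply: algebraic_on_mem; right; rewrite mem_cat sY1.
- apply: algebraic_on_mono yx => u [[Su|uY1]|->]; first by left; left.
    by right; rewrite mem_cat uY1.
  by left; right.
- by apply: algebraic_on_mem; right; rewrite mem_cat sY2 orbT.
Qed.

Lemma free_over_family (I : eqType) (y : I -> K) (s : seq I) S : uniq s ->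
  (forall i, i \in s -> ~ algebraic_on (fun z => exists2 j, j != i & z = y j) (y i)) ->
  (forall z, S z -> exists2 j, j \notin s & z = y j) -> free_over S (map y s).
Proof.
elim: s S => [|i s IHs] S //= /andP [i_s s_uniq] y_free Ss; split.
  apply: contra_not (y_free i (mem_head i s)); apply: algebraic_on_mono => z /Ss [j].
  by rewrite inE negb_or => /andP [ji _] ->; exists j.
apply: IHs => // [j js|z [/Ss [j]|->]]; first by apply: y_free; rewrite inE js orbT.
  by rewrite inE negb_or => /andP [_ js] ->; exists j.
by exists i.
Qed.

End AlgebraicDependence.

(** * Transcendence degree *)

Local Notation widen := (widen_ord (leqnSn _)).

Lemma muni_eq0 (k : fieldType) n (p : {mpoly k[n.+1]}) : muni p = 0 -> p = 0.
Proof.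
move=> p0; apply/mpolyP => m; rewrite mcoeff0.
pose w (u : 'X_{1..n.+1}) : 'X_{1..n} := [multinom (u (widen i)) | i < n].
have [m_p|] := boolP (m \in msupp p); last by rewrite mcoeff_msupp negbK => /eqP.
have : ((muni p)`_(m ord_max))@_(w m) = p@_m.
  rewrite muniE coef_sum raddf_sum /= (bigD1_seq m) ?msupp_uniq //=.
  rewrite big1 => [|u um]; rewrite coefZ coefXn.
    by rewrite eqxx mulr1 mcoeffZ mcoeffX eqxx mulr1 addr0.
  have [umax|] := eqVneq (m ord_max) (u ord_max); last by rewrite mulr0 mcoeff0.
  rewrite mulr1 mcoeffZ mcoeffX; case: eqP => [uw|]; last by rewrite mulr0.
  case/eqP: um; apply/mnmP => i; have [j ->|->] := unliftP ord_max i; last by rewrite umax.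
  have := congr1 (fun v : 'X_{1..n} => v j) uw; rewrite /w !mnmE.
  suff -> : lift ord_max j = widen j by [].
  by apply/val_inj; rewrite /= /bump leqNgt ltn_ord add0n.
by rewrite p0 coef0 mcoeff0 => <-.
Qed.

Section Independence.
Variables (k K : fieldType) (iota : {rmorphism k -> K}).

Lemma mmap_muni n (y : 'I_n.+1 -> K) (p : {mpoly k[n.+1]}) :
  mmap iota y p =
    (map_poly (mmap iota (y \o @widen_ord n n.+1 (leqnSn n))) (muni p)).[y ord_max].
Proof.
rewrite muniE raddf_sum /= horner_sum; apply: eq_bigr => m _.
rewrite map_polyZ map_polyXn hornerZ hornerXn /= mmapZ mmapX -mulrA; congr (_ * _).
rewrite /mmap1 big_ord_recr /=; congr (_ * _).
by apply: eq_bigr => i _; rewrite mnmE.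
Qed.

Lemma adjoin_mmap m (y : 'I_m -> K) (S : K -> Prop) (p : {mpoly k[m]}) :
  (forall i, S (y i)) -> adjoin iota S (mmap iota y p).
Proof.
move=> Sy; have fS := adjoin_subfield iota S.
rewrite /mmap; apply: subfield_sum => // u; apply: subfieldM => //; first exact: adjoin_base.
rewrite /mmap1; elim/big_ind: _ => [|a b|i _]; first exact: subfield1.
  exact: subfieldM.
by apply: subfieldX => //; apply: adjoin_mem.
Qed.

(** A relation, as a polynomial in its last variable, either makes the last y
    algebraic over the others or has relations between these as coefficients. *)
Lemma alg_independent_free m (y : 'I_m -> K) :
  (forall i, ~ algebraic_on iota (fun z => exists2 j, j != i & z = y j) (y i)) ->
  alg_independent iota y.
Proof.
elim: m y => [|m IHm] y y_free p.
  have [c ->] : exists c, p = c%:MP.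
    by exists p@_0; apply/mpolyP => u; rewrite mcoeffC (_ : u = 0%MM) ?eqxx ?mulr1 //; apply/mnmP; case.
  by rewrite mmapC => /eqP; rewrite fmorph_eq0 => /eqP ->; rewrite mpolyC0.
pose y' := y \o @widen_ord m m.+1 (leqnSn m).
have widen_neq i : widen i != ord_max :> 'I_m.+1.
  by rewrite -(inj_eq val_inj) /= neq_ltn ltn_ord.
move=> py; apply: muni_eq0; apply/polyP => j; rewrite coef0.
have y'_ind : alg_independent iota y'.
  apply: IHm => i; apply: contra_not (y_free (widen i)).
  apply: algebraic_on_mono => z [l li ->]; exists (widen l) => //.
apply: y'_ind; rewrite -coef_map.
have [->|q_neq0] := eqVneq (map_poly (mmap iota y') (muni p)) 0; first by rewrite coef0.
case: (y_free ord_max); exists (map_poly (mmap iota y') (muni p)); split=> //.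
  move=> i; rewrite coef_map; apply: adjoin_mmap => l.
  by exists (widen l).
by rewrite rootE -mmap_muni py.
Qed.

End Independence.

Section Variables.
Variables (k : fieldType) (n : nat).
Let K := ratfun k n.

(** Polynomials that do not involve the i-th variable are those that the
    splitting off of this variable leaves constant. *)
Definition split_var (i : 'I_n) : {mpoly k[n]} -> {poly {mpoly k[n]}} :=
  mmap (polyC \o @mpolyC n k) (fun j => if j == i then 'X else ('X_j)%:P).

HB.instance Definition _ i := GRing.RMorphism.on (split_var i).

(** Cleared of denominators, an equation for x_i is a sum of p_l x_i^l with p_l
    free of x_i, and such a sum only vanishes with all p_l. *)
Lemma ratvar_not_algebraic (i : 'I_n) :
  ~ algebraic_on (ratfunC k n) (fun z => exists2 j, j != i & z = ratvar k j) (ratvar k i).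
Proof.
pose A (z : K) := exists2 p : {mpoly k[n]}, split_var i p = p%:P & z = tofrac p.
have rA : subring A.
  split=> [|_ _ [p pE ->] [q qE ->]|_ _ [p pE ->] [q qE ->]].
  - by exists 1; rewrite ?rmorph1.
  - by exists (p - q); rewrite ?rmorphB //= pE qE.
  - by exists (p * q); rewrite ?rmorphM //= pE qE.
move=> [r [r_neq0 Fr rz]].
have Ar l : fraction_of A r`_l.
  apply: adjoin_least (Fr l); first exact: fraction_subfield.
    by move=> c; apply: fraction_base => //; exists c%:MP; rewrite // /split_var mmapC.
  move=> _ [j ji ->]; apply: fraction_base => //; exists 'X_j => //.
  by rewrite /split_var mmapX mmap1U (negPf ji).
have [d [_ d_neq0] rd] := common_denominator rA (size r) Ar.
have [p pE] : exists p : 'I_(size r) -> {mpoly k[n]},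
    forall l, split_var i (p l) = (p l)%:P /\ d * r`_l = tofrac (p l).
  apply: (@fin_all_exists _ (fun=> {mpoly k[n]}) (fun l q => split_var i q = q%:P /\ _ = tofrac q)) => l.
  by have [q qE1 qE2] := rd l (ltn_ord l); exists q.
have rel0 : \sum_(l < size r) p l * 'X_i ^+ l = 0.
  apply/eqP; rewrite -tofrac_eq0 rmorph_sum /=.
  have r0 : r.[ratvar k i] = 0 by exact/rootP.
  suff -> : \sum_(l < size r) tofrac (p l * 'X_i ^+ l) = d * r.[ratvar k i].
    by rewrite r0 mulr0 eqxx.
  rewrite horner_coef mulr_sumr; apply: eq_bigr => l _.
  by rewrite rmorphM rmorphXn /= -(pE l).2 mulrA.
have p0 l : p l = 0.
  have /polyP /(_ l) := congr1 (split_var i) rel0.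
  rewrite rmorph0 coef0 rmorph_sum /= coef_sum (bigD1 l) //= big1 => [|m ml].
    by rewrite rmorphM rmorphXn /= (pE l).1 /split_var mmapX mmap1U eqxx coefCM coefXn eqxx mulr1 addr0.
  rewrite rmorphM rmorphXn /= (pE m).1 /split_var mmapX mmap1U eqxx coefCM coefXn.
  by rewrite eq_sym (inj_eq val_inj) (negPf ml) mulr0.
have szr : ((size r).-1 < size r)%N by rewrite prednK // size_poly_gt0.
have := (pE (Ordinal szr)).2; rewrite p0 rmorph0 => /eqP.
by rewrite mulf_eq0 (negPf d_neq0) /= -lead_coefE lead_coef_eq0 (negPf r_neq0).
Qed.

(** The transcendence degree of k(x_1, ..., x_n) being n, no n - 1 elements
    suffice to make all variables algebraic. *)
Lemma spanning_family_free (y : 'I_n -> K) :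
  (forall i, algebraic_on (ratfunC k n) (fun z => exists j, z = y j) (ratvar k i)) ->
  forall i, ~ algebraic_on (ratfunC k n) (fun z => exists2 j, j != i & z = y j) (y i).
Proof.
move=> xy i yi.
pose Y := [seq y j | j <- enum 'I_n & j != i].
have : (size [seq ratvar k j | j <- enum 'I_n] <= size Y)%N.
  apply: (@steinitz _ _ (ratfunC k n) _ (fun=> False)).
    apply: free_over_family => //; first exact: enum_uniq.
    by move=> j _; apply: ratvar_not_algebraic.
  move=> _ /mapP [j _ ->]; apply: algebraic_on_trans (xy j) => _ [l ->].
  have others z : (exists2 j, j != i & z = y j) -> extended (fun=> False) Y z.
    by move=> [m mi ->]; right; apply: map_f; rewrite mem_filter mi mem_enum.
  have [->|li] := eqVneq l i; first exact: algebraic_on_mono yi.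
  by apply: algebraic_on_mem; apply: others; exists l.
rewrite !size_map -enumT size_enum_ord size_filter.
have : (count (pred1 i) (enum 'I_n) + count (predC (pred1 i)) (enum 'I_n) = n)%N.
  by rewrite count_predC size_enum_ord.
rewrite count_uniq_mem ?enum_uniq // mem_enum inE => nE.
by rewrite -[X in (X <= _)%N]nE ltnn.
Qed.

End Variables.

(** * Matrices acting on rational functions *)

Section FractionRepresentative.
Local Open Scope quotient_scope.

Lemma fraction_repr (R : idomainType) (f : {fraction R}) :
  f = tofrac \n_(repr f) / tofrac \d_(repr f).
Proof.
apply: (canRL (mulfK _)); first by rewrite tofrac_eq0 denom_ratioP.
set x := repr f; rewrite -{1}[f]reprK -/x; unlock FracField.tofrac.
rewrite -[LHS]FracField.pi_mul; apply/eqmodP; rewrite /= FracField.equivfE /FracField.mulf.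
by rewrite !numden_Ratio ?mulf_neq0 ?denom_ratioP ?oner_neq0 // !mulr1 mulrC.
Qed.

End FractionRepresentative.

Lemma subf_div (F : fieldType) (a b c d : F) : b != 0 -> d != 0 ->
  a / b - c / d = (a * d - c * b) / (b * d).
Proof. by move=> b0 d0; field; rewrite b0 d0. Qed.

Section LinearAction.
Variables (k : fieldType) (n : nat).
Implicit Types (A B : 'M[k]_n) (p q : {mpoly k[n]}) (f : ratfun k n).

Lemma mpoly_act_is_zmod_morphism A : zmod_morphism (mpoly_act A).
Proof. by move=> p q; rewrite /mpoly_act rmorphB. Qed.

Lemma mpoly_act_is_monoid_morphism A : monoid_morphism (mpoly_act A).
Proof. by split=> [|p q]; rewrite /mpoly_act ?rmorph1 ?rmorphM. Qed.

HB.instance Definition _ A := GRing.isZmodMorphism.Build _ _ (mpoly_act A)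
  (mpoly_act_is_zmod_morphism A).
HB.instance Definition _ A := GRing.isMonoidMorphism.Build _ _ (mpoly_act A)
  (mpoly_act_is_monoid_morphism A).

Lemma mpoly_actX A j : mpoly_act A 'X_j = \sum_(i < n) A i j *: 'X_i.
Proof. by rewrite /mpoly_act comp_mpolyXU -tnth_nth tnth_mktuple. Qed.

Lemma mpoly_actC A c : mpoly_act A c%:MP = c%:MP.
Proof. by rewrite /mpoly_act comp_mpolyC. Qed.

Lemma mpoly_rmorph_eq (S : comNzRingType) (g h : {rmorphism {mpoly k[n]} -> S}) :
  (forall c, g c%:MP = h c%:MP) -> (forall i, g 'X_i = h 'X_i) -> g =1 h.
Proof.
move=> ghC ghX p; rewrite [p]mpolyE !rmorph_sum /=; apply: eq_bigr => m _.
rewrite -mul_mpolyC !rmorphM /= ghC mpolyXE_id !rmorph_prod /=; congr (_ * _).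
by apply: eq_bigr => i _; rewrite !rmorphXn /= ghX.
Qed.

Lemma mpoly_actM A B p : mpoly_act A (mpoly_act B p) = mpoly_act (A *m B) p.
Proof.
apply: (@mpoly_rmorph_eq _ (mpoly_act A \o mpoly_act B) (mpoly_act (A *m B))) => [c|j] /=.
  by rewrite !mpoly_actC.
rewrite !mpoly_actX rmorph_sum /= (eq_bigr (fun i => B i j *: \sum_(l < n) A l i *: 'X_l)).
  rewrite (eq_bigr (fun i => \sum_(l < n) (A l i * B i j) *: 'X_l)) => [|i _]; last first.
    by rewrite scaler_sumr; apply: eq_bigr => l _; rewrite scalerA mulrC.
  by rewrite exchange_big /=; apply: eq_bigr => l _; rewrite mxE -scaler_suml.
by move=> i _; rewrite -mul_mpolyC rmorphM /= mpoly_actC mpoly_actX mul_mpolyC.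
Qed.

Lemma mpoly_act1 p : mpoly_act 1%:M p = p.
Proof.
apply: (@mpoly_rmorph_eq _ (mpoly_act 1%:M) idfun) => [c|j] /=; first exact: mpoly_actC.
rewrite mpoly_actX (bigD1 j) //= mxE eqxx scale1r big1 ?addr0 // => i ij.
by rewrite mxE (negPf ij) scale0r.
Qed.

Lemma mpoly_act_eq0 A p : A \in unitmx -> (mpoly_act A p == 0) = (p == 0).
Proof.
move=> uA; apply/eqP/eqP => [p0|->]; last exact: rmorph0.
by rewrite -(mpoly_act1 p) -(mulVmx uA) -mpoly_actM p0 rmorph0.
Qed.

Lemma ratfun_act_frac A p q : A \in unitmx -> q != 0 ->
  ratfun_act A (tofrac p / tofrac q) = tofrac (mpoly_act A p) / tofrac (mpoly_act A q).
Proof.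
move=> uA q0; rewrite /ratfun_act; set f := tofrac p / tofrac q; set r := repr f.
have d0 : \d_r != 0 by exact: denom_ratioP.
have /eqP : tofrac \n_r / tofrac \d_r = tofrac p / tofrac q by rewrite -fraction_repr.
rewrite eqr_div ?tofrac_eq0 // -!tofracM tofrac_eq => /eqP /(congr1 (mpoly_act A)).
rewrite !rmorphM /= => E; apply/eqP.
by rewrite eqr_div ?tofrac_eq0 ?mpoly_act_eq0 // -!tofracM tofrac_eq E.
Qed.

Lemma ratfunP f : exists p q, q != 0 /\ f = tofrac p / tofrac q.
Proof. by exists \n_(repr f), \d_(repr f); split; [apply: denom_ratioP|apply: fraction_repr]. Qed.

Lemma ratfun_act_tofrac A p : A \in unitmx -> ratfun_act A (tofrac p) = tofrac (mpoly_act A p).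
Proof.
move=> uA; have := ratfun_act_frac p uA (oner_neq0 _).
by rewrite !rmorph1 !divr1.
Qed.

Section Automorphism.
Variables (A : 'M[k]_n) (uA : A \in unitmx).

Definition ratfun_aut of A \in unitmx : ratfun k n -> ratfun k n := ratfun_act A.

Lemma ratfun_aut_is_zmod_morphism : zmod_morphism (ratfun_aut uA).
Proof.
move=> f g; have [p [q [q0 ->]]] := ratfunP f; have [r [s [s0 ->]]] := ratfunP g.
rewrite subf_div ?tofrac_eq0 // -!tofracM -tofracB.
rewrite /ratfun_aut !ratfun_act_frac ?mulf_neq0 // subf_div ?tofrac_eq0 ?mpoly_act_eq0 //.
by rewrite -!tofracM -tofracB rmorphB !rmorphM.
Qed.

Lemma ratfun_aut_is_monoid_morphism : monoid_morphism (ratfun_aut uA).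
Proof.
split=> [|f g]; first by rewrite /ratfun_aut -tofrac1 ratfun_act_tofrac // rmorph1.
have [p [q [q0 ->]]] := ratfunP f; have [r [s [s0 ->]]] := ratfunP g.
rewrite mulf_div -!tofracM.
rewrite /ratfun_aut !ratfun_act_frac ?mulf_neq0 // mulf_div.
by rewrite -!tofracM !rmorphM.
Qed.

HB.instance Definition _ := GRing.isZmodMorphism.Build _ _ (ratfun_aut uA)
  ratfun_aut_is_zmod_morphism.
HB.instance Definition _ := GRing.isMonoidMorphism.Build _ _ (ratfun_aut uA)
  ratfun_aut_is_monoid_morphism.

Lemma ratfun_autC c : ratfun_aut uA (ratfunC k n c) = ratfunC k n c.
Proof. by rewrite /ratfun_aut /= ratfun_act_tofrac // mpoly_actC. Qed.

Lemma ratfun_aut_var j :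
  ratfun_aut uA (ratvar k j) = \sum_(i < n) ratfunC k n (A i j) * ratvar k i.
Proof.
rewrite /ratfun_aut ratfun_act_tofrac // mpoly_actX rmorph_sum /=.
by apply: eq_bigr => i _; rewrite -mul_mpolyC rmorphM.
Qed.

End Automorphism.

Lemma ratfun_actM A B f : A \in unitmx -> B \in unitmx ->
  ratfun_act A (ratfun_act B f) = ratfun_act (A *m B) f.
Proof.
move=> uA uB; have [p [q [q0 ->]]] := ratfunP f.
have uAB : A *m B \in unitmx by rewrite unitmx_mul uA.
have Bq : mpoly_act B q != 0 by rewrite mpoly_act_eq0.
by rewrite (ratfun_act_frac p uB q0) (ratfun_act_frac _ uA Bq) (ratfun_act_frac p uAB q0) !mpoly_actM.
Qed.

Lemma ratfun_act1 f : ratfun_act 1%:M f = f.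
Proof.
have [p [q [q0 ->]]] := ratfunP f.
by rewrite ratfun_act_frac ?unitmx1 // !mpoly_act1.
Qed.

Lemma ratfun_actV A f g : A \in unitmx -> ratfun_act A f = g -> ratfun_act (invmx A) g = f.
Proof. by move=> uA <-; rewrite ratfun_actM ?unitmx_inv // mulVmx // ratfun_act1. Qed.

Lemma mxgenerated_unit (s : seq 'M[k]_n) A :
  (forall B, B \in s -> B \in unitmx) -> mxgenerated s A -> A \in unitmx.
Proof.
move=> us; elim=> {A} [A /us //||A B _ uA _ uB|A _ uA]; rewrite ?unitmx1 ?unitmx_inv //.
by rewrite unitmx_mul uA.
Qed.

Lemma mxgenerated_fixed (s : seq 'M[k]_n) f :
  (forall B, B \in s -> B \in unitmx) -> (forall B, B \in s -> ratfun_act B f = f) ->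
  forall A, mxgenerated s A -> ratfun_act A f = f.
Proof.
move=> us fs A sA; elim: sA => {A} [A /fs //||A B sA fA sB fB|A sA fA].
- exact: ratfun_act1.
- by rewrite -(ratfun_actM _ (mxgenerated_unit us sA) (mxgenerated_unit us sB)) fB.
- by apply: ratfun_actV => //; apply: mxgenerated_unit sA.
Qed.

(** Over the fixed field of a finite group each function is a root of the
    product of the linear factors at its conjugates. *)
Lemma algebraic_over_fixed_field (G : 'M[k]_n -> Prop) f :
  is_GL_subgroup G -> finite_mxset G ->
  algebraic (fixed_field G (whole_field k n)) f.
Proof.
move=> gG [s0 Gs0].
pose s := [seq A <- undup s0 | if excluded_middle_informative (G A) then true else false].
have sG A : reflect (G A) (A \in s).
  rewrite mem_filter mem_undup; case: excluded_middle_informative => GA.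
    by rewrite (Gs0 _ GA); constructor.
  by constructor.
have us : uniq s by rewrite filter_uniq ?undup_uniq.
pose p := \prod_(A <- s) ('X - (ratfun_act A f)%:P).
exists p; split; first by rewrite monic_neq0 // monic_prod_XsubC.
  move=> i; split=> // B GB; have uB := GL_subgroup_unit gG GB.
  suff pB : map_poly (ratfun_aut uB) p = p by rewrite -[in RHS]pB coef_map.
  rewrite /p rmorph_prod /=.
  have ps : perm_eq [seq B *m A | A <- s] s.
    apply: uniq_perm => //; first by rewrite map_inj_uniq // => C D; apply: (can_inj (mulKmx uB)).
    move=> C; apply/mapP/sG => [[A /sG GA ->]|GC]; first exact: (GL_subgroupM gG).
    exists (invmx B *m C); last by rewrite mulKVmx.
    by apply/sG/(GL_subgroupM gG) => //; apply: (GL_subgroupV gG).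
  rewrite -[RHS](perm_big _ ps) big_map; apply: eq_big_seq => A /sG GA.
  rewrite rmorphB /= map_polyX map_polyC /= /ratfun_aut ratfun_actM //.
  exact: GL_subgroup_unit gG _ GA.
rewrite /p -(big_map (fun A => ratfun_act A f) xpredT (fun a => 'X - a%:P)) root_prod_XsubC; apply/mapP; exists 1%:M; last by rewrite ratfun_act1.
by apply/sG/(GL_subgroup1 gG).
Qed.

End LinearAction.

Section Degree0.
Variables (k : fieldType) (n : nat).
Let K := ratfun k n.+1.
Let iota := ratfunC k n.+1.

Lemma ratvar_neq0 m (i : 'I_m) : ratvar k i != 0.
Proof.
rewrite tofrac_eq0; apply/eqP => /(congr1 (meval (fun=> 1))).
by rewrite mevalXU rmorph0; apply/eqP/oner_neq0.
Qed.

Lemma degree0_ratio i j : degree0_field k n (ratvar k i / ratvar k j : K).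
Proof.
have fF := adjoin_subfield iota (fun z : K => exists i : 'I_n, z = ratvar k (lift ord_max i) / ratvar k ord_max).
have quot l : degree0_field k n (ratvar k l / ratvar k ord_max : K).
  have [m ->|->] := unliftP ord_max l; first by apply: adjoin_mem; exists m.
  by rewrite divff ?ratvar_neq0 //; apply: subfield1 fF.
have -> : ratvar k i / ratvar k j
    = (ratvar k i / ratvar k ord_max) / (ratvar k j / ratvar k ord_max) :> K.
  by rewrite invf_div mulrA divfK // ratvar_neq0.
by apply: subfieldM => //; apply: subfieldV.
Qed.

Lemma degree0_act A (f : K) : A \in unitmx -> degree0_field k n f -> degree0_field k n (ratfun_act A f).
Proof.
move=> uA; have fF := adjoin_subfield iota (fun z : K => exists i : 'I_n, z = ratvar k (lift ord_max i) / ratvar k ord_max).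
elim=> {f} [c|_ [i ->]|u v _ IHu _ IHv|u _ IHu|u v _ IHu _ IHv|u _ IHu];
  rewrite -[ratfun_act A _]/(ratfun_aut uA _).
- by rewrite ratfun_autC; apply: adjoin_base.
- have linear j : degree0_field k n (ratfun_aut uA (ratvar k j) / ratvar k ord_max : K).
    rewrite ratfun_aut_var mulr_suml; apply: subfield_sum => // l; rewrite -mulrA.
    by apply: subfieldM => //; [apply: adjoin_base|apply: degree0_ratio].
  have -> : ratfun_aut uA (ratvar k (lift ord_max i) / ratvar k ord_max)
     = (ratfun_aut uA (ratvar k (lift ord_max i)) / ratvar k ord_max)
       / (ratfun_aut uA (ratvar k ord_max) / ratvar k ord_max).
    by rewrite fmorph_div invf_div mulrA divfK // ratvar_neq0.
  by apply: subfieldM => //; apply: subfieldV.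
- by rewrite rmorphD; apply: subfieldD.
- by rewrite rmorphN; apply: subfieldN.
- by rewrite rmorphM; apply: subfieldM.
- by rewrite fmorphV; apply: subfieldV.
Qed.

(** Rationality of both fixed fields is invariant under conjugation in GL, so
    it can be read off from generators y, N of the invariants of a conjugate
    of G; that they are algebraically independent is then automatic, because
    the variables are algebraic over the fixed field of a finite group. *)
Theorem rational_from_generators (G : 'M[k]_n.+1 -> Prop) (P : 'M[k]_n.+1)
    (s : seq 'M[k]_n.+1) (y : 'I_n -> K) (N : K) :
  is_GL_subgroup G -> finite_mxset G -> P \in unitmx ->
  (forall A, A \in s -> A \in unitmx) ->
  (forall A, G A <-> mxgenerated s (P *m A *m invmx P)) ->
  (forall i, degree0_field k n (y i)) ->
  (forall A, A \in s -> ratfun_act A N = N /\ forall i, ratfun_act A (y i) = y i) ->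
  (forall f, (forall A, A \in s -> ratfun_act A f = f) ->
     adjoin iota (fun z => z = N \/ exists i, z = y i) f) ->
  (forall f, degree0_field k n f -> (forall A, A \in s -> ratfun_act A f = f) ->
     adjoin iota (fun z => exists i, z = y i) f) ->
  rational_over iota (fixed_field G (whole_field k n.+1)) /\
  rational_over iota (fixed_field G (degree0_field k n)).
Proof.
move=> gG fG uP us GE y0 ys genN gen.
pose Q := invmx P; have uQ : Q \in unitmx by rewrite unitmx_inv.
have actPQ f : ratfun_act P (ratfun_act Q f) = f by rewrite ratfun_actM // mulmxV // ratfun_act1.
have actQP f : ratfun_act Q (ratfun_act P f) = f by rewrite ratfun_actM // mulVmx // ratfun_act1.
have fixedE f : (forall A, G A -> ratfun_act A f = f) <->
    (forall A, A \in s -> ratfun_act A (ratfun_act P f) = ratfun_act P f).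
  split=> [Gf B sB|sf A GA].
    have uB := us B sB; pose A := Q *m B *m P.
    have uA : A \in unitmx by rewrite !unitmx_mul uQ uB.
    have GA : G A.
      by apply/GE; rewrite /A /Q !mulmxA mulmxV // mul1mx mulmxK //; apply: mxgen_mem.
    rewrite -[in RHS](Gf A GA) (ratfun_actM _ uB uP) (ratfun_actM _ uP uA).
    by rewrite /A /Q !mulmxA mulmxV // mul1mx.
  have uA := GL_subgroup_unit gG GA.
  have /GE sA := GA; have := mxgenerated_fixed us sf sA.
  rewrite (ratfun_actM _ (mxgenerated_unit us sA) uP) (mulmxKV uP) -(ratfun_actM _ uP uA).
  by move=> /(congr1 (ratfun_act Q)); rewrite !actQP.
pose y' i := ratfun_act Q (y i); pose N' := ratfun_act Q N.
pose z i : K := oapp y' N' (unlift ord_max i).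
have zE u : (exists i, u = z i) <-> u = N' \/ exists i, u = y' i.
  split=> [[i ->]|[->|[i ->]]]; rewrite /z.
  - by case: unliftP => [j _|_] /=; [right; exists j|left].
  - by exists ord_max; rewrite unlift_none.
  - by exists (lift ord_max i); rewrite liftK.
have conjQ S f : adjoin iota S (ratfun_act P f) ->
    adjoin iota (fun u => exists2 v, S v & u = ratfun_act Q v) f.
  rewrite -{2}[f]actQP; elim=> {f} [c|v Sv|u v _ IHu _ IHv|u _ IHu|u v _ IHu _ IHv|u _ IHu];
    rewrite -/(ratfun_aut uQ _).
  - by rewrite ratfun_autC; apply: adjoin_base.
  - by apply: adjoin_mem; exists v.
  - by rewrite rmorphD; apply: adjoinD.
  - by rewrite rmorphN; apply: adjoinN.
  - by rewrite rmorphM; apply: adjoinM.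
  - by rewrite fmorphV; apply: adjoinV.
have adjoin_act S (S' : K -> Prop) f : (forall v, S v -> S' (ratfun_act Q v)) ->
    adjoin iota S (ratfun_act P f) -> adjoin iota S' f.
  by move=> SS' /conjQ; apply: adjoin_mono => _ [v Sv ->]; apply: SS'.
have fixS (S : K -> Prop) f : (forall v, S v -> forall A, A \in s -> ratfun_act A v = v) ->
    adjoin iota (fun u => exists2 v, S v & u = ratfun_act Q v) f ->
    forall A, G A -> ratfun_act A f = f.
  move=> Ss Sf A GA; have uA := GL_subgroup_unit gG GA.
  apply: (@adjoin_fixed _ _ iota (ratfun_aut uA) _ _ _ _ Sf) => [c|_ [v Sv ->]].
    exact: ratfun_autC.
  by apply: (fixedE (ratfun_act Q v)).2 GA => B sB; rewrite actPQ; apply: Ss.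
have z_fixed f : adjoin iota (fun u => exists i, u = z i) f <->
    fixed_field G (whole_field k n.+1) f.
  split=> [zf|[_ /fixedE /genN]].
    split=> //; apply: (fixS (fun v => v = N \/ exists i, v = y i)) => [v vE A sA|].
      by have [sN sy] := ys A sA; case: vE => [->|[i ->]].
    apply: adjoin_mono zf => u /zE [->|[i ->]]; first by exists N; [left|].
    by exists (y i); [right; exists i|].
  apply: adjoin_act => v [->|[i ->]]; apply/zE; first by left.
  by right; exists i.
have z_free := @spanning_family_free k n.+1 z.
have {}z_free : forall i, ~ algebraic_on iota (fun u => exists2 j, j != i & u = z j) (z i).
  apply: z_free => i; have [p [p0 Gp pi]] := algebraic_over_fixed_field (ratvar k i) gG fG.
  by exists p; split=> // l; apply/z_fixed.
split.
  by exists n.+1, z; [apply: alg_independent_free|move=> f; rewrite z_fixed].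
exists n, y'; first apply: alg_independent_free => i.
  have zy j : z (lift ord_max j) = y' j by rewrite /z liftK.
  rewrite -zy; apply: contra_not (z_free (lift ord_max i)).
  apply: algebraic_on_mono => _ [j ji ->]; exists (lift ord_max j); rewrite ?zy //.
  by rewrite (inj_eq lift_inj).
move=> f; split=> [[f0 /fixedE Gf]|y'f].
  apply: (adjoin_act (fun u => exists i, u = y i)) => [_ [i ->]|]; first by exists i.
  by apply: gen => //; apply: degree0_act.
split.
  apply: adjoin_least y'f; first exact: adjoin_subfield.
    by move=> c; apply: adjoin_base.
  by move=> _ [i ->]; apply: degree0_act.
apply: (fixS (fun u => exists i, u = y i)) => [_ [i ->] A sA|]; first by have [_ ->] := ys A sA.
by apply: adjoin_mono y'f => _ [i ->]; exists (y i); [exists i|].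
Qed.

End Degree0.

(** * The quadric of a triangle *)

(** The rows of a rotation matrix, taken up to sign, are three orthogonal lines,
    hence the vertices of a triangle that is self-polar for the standard conic.
    Let V and H be the images of (1, 1, 1) and (0, 0, 1). Then w_i = V_i^2,
    h_i = H_i / V_i and m = V_0 V_1 V_2 do not change when two rows change sign,
    and the relations |V|^2 = 3, V.H = 1 and |H|^2 = 1 read as follows. *)
Record triangle (K : fieldType) (w0 w1 w2 h0 h1 h2 m : K) : Prop := Triangle {
  triangle_two : 2%:R != 0 :> K;
  triangle_w_neq0 : [/\ w0 != 0, w1 != 0 & w2 != 0];
  triangle_w_distinct : [/\ w0 != w1, w1 != w2 & w2 != w0];
  triangle_sum_w : w0 + w1 + w2 = 3%:R;
  triangle_sum_wh : w0 * h0 + w1 * h1 + w2 * h2 = 1;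
  triangle_sum_whh : w0 * h0 ^+ 2 + w1 * h1 ^+ 2 + w2 * h2 ^+ 2 = 1;
  triangle_prod_w : w0 * w1 * w2 = m ^+ 2
}.

Lemma triangle_rot (K : fieldType) (w0 w1 w2 h0 h1 h2 m : K) :
  triangle w0 w1 w2 h0 h1 h2 m -> triangle w1 w2 w0 h1 h2 h0 m.
Proof.
case=> two [n0 n1 n2] [d01 d12 d20] sw swh swhh pw; split=> //.
- by rewrite -sw; ring.
- by rewrite -swh; ring.
- by rewrite -swhh; ring.
- by rewrite -pw; ring.
Qed.

Section Quadric.
Variable K : fieldType.
Variables w0 w1 w2 h0 h1 h2 m : K.

(** The u_i = m / w_i are chosen such that u_i u_j = w_k; thus m, a square root
    of w_0 w_1 w_2, becomes their product. *)
Definition sum_u := m / w0 + m / w1 + m / w2.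
Definition delta_u := (m / w0 - m / w1) * (m / w1 - m / w2) * (m / w2 - m / w0).
(** For f = V x H, the image of (1, -1, 0), the quotient f_i / V_i is
    m (h_(i+2) - h_(i+1)) / w_i. Together with 1 - 3 h_i it gives coordinates of
    the i-th vertex on which rotations about (1, 1, 1) act linearly; sum_f and
    sum_g are those of the centroid, up to scalars. *)
Definition sum_f := m * ((h2 - h1) / w0 + (h0 - h2) / w1 + (h1 - h0) / w2).
Definition sum_g := 1 - (h0 + h1 + h2).
Definition den_D := sum_u - 3%:R * m.
Definition den_n := sum_u ^+ 2 - 9%:R.
Definition trace_A := 2%:R * sum_u ^+ 3 - 27%:R * sum_u + 27%:R * m.

(** The number trace_A - 3 sqrt(-3) delta_u is twice the cube of the resolvent
    u_0 + r u_1 + r^2 u_2 for a primitive cube root of unity r, and den_n is the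
    norm of this resolvent. Its product with sum_f + sqrt(-3) sum_g is
    alpha + beta sqrt(-3), up to the factor m / (den_n den_D). *)
Definition quad_alpha := m * (sum_f * trace_A + 9%:R * delta_u * sum_g) / (den_n * den_D).
Definition quad_beta := m * (sum_g * trace_A - 3%:R * sum_f * delta_u) / (den_n * den_D).
Definition quad_zeta := 2%:R * (3%:R - sum_u * m) / den_D.
Definition quad_pi := delta_u / den_D.

Record general_position : Prop := GeneralPosition {
  general_position_three : 3%:R != 0 :> K;
  general_position_D : den_D != 0;
  general_position_n : den_n != 0;
  general_position_zeta : quad_zeta != 0
}.

Hypothesis tri : triangle w0 w1 w2 h0 h1 h2 m.

Let two_neq0 : 2%:R != 0 :> K := triangle_two tri.
Let w0_neq0 : w0 != 0. Proof. by case: (triangle_w_neq0 tri). Qed.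
Let w1_neq0 : w1 != 0. Proof. by case: (triangle_w_neq0 tri). Qed.
Let w2_neq0 : w2 != 0. Proof. by case: (triangle_w_neq0 tri). Qed.
Let sum_w := triangle_sum_w tri.
Let sum_wh := triangle_sum_wh tri.
Let sum_whh := triangle_sum_whh tri.
Let prod_w := triangle_prod_w tri.

Let u0 := m / w0.
Let u1 := m / w1.
Let u2 := m / w2.

Lemma m_neq0 : m != 0.
Proof.
have : m ^+ 2 != 0 by rewrite -prod_w !mulf_neq0.
by rewrite expf_eq0.
Qed.

Lemma e2_u : u0 * u1 + u1 * u2 + u2 * u0 = 3%:R.
Proof.
rewrite -sum_w; have -> : u0 * u1 + u1 * u2 + u2 * u0 = m ^+ 2 * (w0 + w1 + w2) / (w0 * w1 * w2).
  by rewrite /u0 /u1 /u2; field; rewrite w0_neq0 w1_neq0 w2_neq0.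
by rewrite prod_w; field; exact: m_neq0.
Qed.

Lemma e3_u : u0 * u1 * u2 = m.
Proof.
have -> : u0 * u1 * u2 = m ^+ 3 / (w0 * w1 * w2).
  by rewrite /u0 /u1 /u2; field; rewrite w0_neq0 w1_neq0 w2_neq0.
by rewrite prod_w; field; exact: m_neq0.
Qed.

(** The norm of the cube of the resolvent is the cube of its norm. *)
Lemma discriminant_u : trace_A ^+ 2 + 27%:R * delta_u ^+ 2 = 4%:R * den_n ^+ 3.
Proof.
have -> : trace_A = 2%:R * sum_u ^+ 3 - 9%:R * sum_u * (u0 * u1 + u1 * u2 + u2 * u0) + 27%:R * (u0 * u1 * u2).
  by rewrite e2_u e3_u /trace_A; ring.
have -> : den_n = sum_u ^+ 2 - 3%:R * (u0 * u1 + u1 * u2 + u2 * u0) by rewrite e2_u /den_n; ring.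
by rewrite /sum_u /delta_u -/u0 -/u1 -/u2; ring.
Qed.

Hypothesis gen : general_position.

Let three_neq0 : 3%:R != 0 :> K := general_position_three gen.
Let D_neq0 := general_position_D gen.
Let n_neq0 := general_position_n gen.
Let zeta_neq0 := general_position_zeta gen.

(** The same identity, divided by 27 after elimination of trace_A. *)
Lemma discriminant_u' :
  4%:R * (3%:R - sum_u * m) * den_n = 3%:R * den_D ^+ 2 + delta_u ^+ 2.
Proof.
apply: (mulfI (_ : 27%:R != 0)).
  by rewrite (_ : 27%:R = 3%:R ^+ 3); [rewrite expf_neq0|ring].
have -> : 27%:R * (3%:R * den_D ^+ 2 + delta_u ^+ 2) = 81%:R * den_D ^+ 2 + (4%:R * den_n ^+ 3 - trace_A ^+ 2).
  by rewrite -discriminant_u; ring.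
by rewrite /den_D /trace_A /den_n; ring.
Qed.

(** This is the squared length of (1 / V_i), computed in the orthogonal frame
    V, f, V x f. *)
Lemma norm_fg : m * (sum_f ^+ 2 + 3%:R * sum_g ^+ 2) = 2%:R * den_D.
Proof.
pose q := w0 * h0 ^+ 2 + w1 * h1 ^+ 2 + w2 * h2 ^+ 2.
pose Q := w0^-1 + w1^-1 + w2^-1 - 3%:R.
pose Y := (h2 - h1) / w0 + (h0 - h2) / w1 + (h1 - h0) / w2.
have -> : den_D = m * Q by rewrite /den_D /sum_u /Q; field; rewrite w0_neq0 w1_neq0 w2_neq0.
(* the right-hand side is the multiple of the relation |H|^2 = 1 that turns the
   claim into an identity depending on the other two relations only *)
suff : w0 * w1 * w2 * Y ^+ 2 + 3%:R * sum_g ^+ 2 - 2%:R * Q = 3%:R * Q * (q - 1).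
  rewrite /q sum_whh subrr mulr0 prod_w => /eqP; rewrite subr_eq0 => /eqP E.
  rewrite [RHS](_ : _ = m * (2%:R * Q)); last by ring.
  by rewrite -E /sum_f -/Y; ring.
have h0E : h0 = (1 - w1 * h1 - w2 * h2) / w0 by rewrite -sum_wh; field.
have w0E : w0 = 3%:R - w1 - w2 by rewrite -sum_w; ring.
rewrite /Q /Y /sum_g /q h0E.
move: w0_neq0; rewrite w0E => w_neq0.
by field; rewrite w_neq0 w1_neq0 w2_neq0.
Qed.

Lemma quad_norm : quad_alpha ^+ 2 + 3%:R * quad_beta ^+ 2 = 8%:R * m * den_n / den_D.
Proof.
have -> : quad_alpha ^+ 2 + 3%:R * quad_beta ^+ 2
    = m * (m * (sum_f ^+ 2 + 3%:R * sum_g ^+ 2)) * (trace_A ^+ 2 + 27%:R * delta_u ^+ 2)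
      / (den_n * den_D) ^+ 2.
  by rewrite /quad_alpha /quad_beta; field; rewrite D_neq0 n_neq0.
by rewrite norm_fg discriminant_u; field; rewrite D_neq0 n_neq0.
Qed.

(** The norm of alpha + beta sqrt(-3) is multiplicative, and the discriminant of
    the u_i turns its value into one of the form in zeta and pi. *)
Theorem quadric_equation :
  quad_alpha ^+ 2 + 3%:R * quad_beta ^+ 2 + 6%:R * quad_zeta ^+ 2 + 2%:R * quad_pi ^+ 2 = 18%:R.
Proof.
rewrite quad_norm; have -> : quad_pi ^+ 2
    = (4%:R * (3%:R - sum_u * m) * den_n - 3%:R * den_D ^+ 2) / den_D ^+ 2.
  by rewrite discriminant_u' /quad_pi; field.
apply: (mulIf (expf_neq0 2 D_neq0)).
rewrite [LHS](_ : _ = 8%:R * m * den_n * den_D + 24%:R * (3%:R - sum_u * m) ^+ 2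
   + 2%:R * (4%:R * (3%:R - sum_u * m) * den_n - 3%:R * den_D ^+ 2)).
  by rewrite /den_n /den_D; ring.
by rewrite /quad_zeta; field.
Qed.

(** Already zeta and pi determine the cubic with the roots u_i. *)
Lemma quad_kappa : (3%:R + quad_pi ^+ 2) / (2%:R * quad_zeta) = den_n / den_D.
Proof.
have z0 : 3%:R - sum_u * m != 0.
  by move: zeta_neq0; rewrite /quad_zeta !mulf_eq0 !negb_or => /andP [/andP [_ ->]].
have -> : quad_pi ^+ 2
    = (4%:R * (3%:R - sum_u * m) * den_n - 3%:R * den_D ^+ 2) / den_D ^+ 2.
  by rewrite discriminant_u' /quad_pi; field.
by rewrite /quad_zeta; field; rewrite D_neq0 z0 two_neq0.
Qed.

Lemma sum_u_kappa :
  sum_u = (9%:R + 4%:R * (den_n / den_D) ^+ 2 + 3%:R * quad_pi ^+ 2) / (4%:R * (den_n / den_D)).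
Proof.
have -> : quad_pi ^+ 2
    = (4%:R * (3%:R - sum_u * m) * den_n - 3%:R * den_D ^+ 2) / den_D ^+ 2.
  by rewrite discriminant_u' /quad_pi; field.
have four : 4%:R != 0 :> K by rewrite (_ : 4%:R = 2%:R ^+ 2); [rewrite expf_neq0|ring].
apply: (mulIf (mulf_neq0 four n_neq0)).
transitivity ((4%:R * den_n ^+ 2 + 12%:R * (3%:R - sum_u * m) * den_n) / den_D).
  apply: (mulIf D_neq0); rewrite divfK //.
  have E : sum_u * den_D = den_n + 3%:R * (3%:R - sum_u * m) by rewrite /den_n /den_D; ring.
  by rewrite mulrAC E; ring.
by field; rewrite D_neq0 n_neq0 four.
Qed.

Section Recovery.
Variables (F : K -> Prop) (fF : subfield F).
Hypotheses (Fa : F quad_alpha) (Fb : F quad_beta) (Fz : F quad_zeta) (Fp : F quad_pi).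

Let Fkappa : F (den_n / den_D).
Proof. by rewrite -quad_kappa; in_subfield. Qed.

Lemma recover_sum_u : F sum_u.
Proof. by rewrite sum_u_kappa; in_subfield. Qed.

Let Fn : F den_n.
Proof. by have := recover_sum_u; rewrite /den_n => Fs; in_subfield. Qed.

Let FD : F den_D.
Proof.
by rewrite (_ : den_D = den_n / (den_n / den_D)); [in_subfield|field; rewrite D_neq0 n_neq0].
Qed.

Lemma recover_m : F m.
Proof.
rewrite (_ : m = (sum_u - den_D) / 3%:R); last by rewrite /den_D; field.
by have := recover_sum_u => Fs; in_subfield.
Qed.

Let Fdelta : F delta_u.
Proof. by rewrite (_ : delta_u = quad_pi * den_D); [in_subfield|rewrite /quad_pi; field]. Qed.

Let FA : F trace_A.
Proof. by have := recover_sum_u; have := recover_m; rewrite /trace_A => Fm Fs; in_subfield. Qed.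

Let four_neq0 : 4%:R != 0 :> K.
Proof. by rewrite (_ : 4%:R = 2%:R ^+ 2); [rewrite expf_neq0|ring]. Qed.

Lemma recover_sum_f : F sum_f.
Proof.
rewrite (_ : sum_f = (trace_A * quad_alpha - 9%:R * delta_u * quad_beta) * den_D
   / ((4%:R * den_n ^+ 3) / den_n * m)).
  by have := recover_m => Fm; in_subfield.
have E : 4%:R * den_n ^+ 3 != 0 by rewrite mulf_neq0 ?expf_neq0.
move: E; rewrite -discriminant_u => E.
by rewrite /quad_alpha /quad_beta; field; rewrite D_neq0 n_neq0 m_neq0 E.
Qed.

Lemma recover_sum_g : F sum_g.
Proof.
rewrite (_ : sum_g = (trace_A * quad_beta + 3%:R * delta_u * quad_alpha) * den_D
   / ((4%:R * den_n ^+ 3) / den_n * m)).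
  by have := recover_m => Fm; in_subfield.
have E : 4%:R * den_n ^+ 3 != 0 by rewrite mulf_neq0 ?expf_neq0.
move: E; rewrite -discriminant_u => E.
by rewrite /quad_alpha /quad_beta; field; rewrite D_neq0 n_neq0 m_neq0 E.
Qed.

Let w01 : w0 != w1. Proof. by case: (triangle_w_distinct tri). Qed.
Let w20 : w2 != w0. Proof. by case: (triangle_w_distinct tri). Qed.

Hypothesis Fu0 : F u0.

Lemma recover_u12 : F u1 /\ F u2.
Proof.
have Fs := recover_sum_u.
have neq_u a b : a != 0 -> b != 0 -> a != b -> m / a - m / b != 0.
  move=> a0 b0; apply: contra_neq => E.
  have : m * (b - a) = 0 by rewrite -(mulr0 (a * b)) -E; field; rewrite a0 b0.
  by move/eqP; rewrite mulf_eq0 (negPf m_neq0) subr_eq0 => /eqP.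
have d01 : u0 - u1 != 0 by apply: neq_u.
have d20 : u2 - u0 != 0 by apply: neq_u.
have d_E : u1 - u2 = delta_u / (- (u0 ^+ 2 - u0 * (sum_u - u0) + (3%:R - u0 * (sum_u - u0)))).
  rewrite -e2_u [X in _ / X](_ : _ = (u0 - u1) * (u2 - u0)).
    by rewrite /delta_u -/u0 -/u1 -/u2; field; rewrite d01 d20.
  by rewrite /sum_u -/u0 -/u1 -/u2; ring.
have u1E : u1 = ((sum_u - u0) + (u1 - u2)) / 2%:R by rewrite /sum_u -/u0 -/u1 -/u2; field.
have u2E : u2 = ((sum_u - u0) - (u1 - u2)) / 2%:R by rewrite /sum_u -/u0 -/u1 -/u2; field.
by split; [rewrite u1E|rewrite u2E]; rewrite d_E; in_subfield.
Qed.

Lemma recover_w : [/\ F w0, F w1 & F w2].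
Proof.
have [Fu1 Fu2] := recover_u12; have Fm := recover_m; have m0 := m_neq0.
have wE w : w != 0 -> w = m / (m / w) by move=> wn0; field; rewrite wn0 m0.
by split; [rewrite (wE _ w0_neq0)|rewrite (wE _ w1_neq0)|rewrite (wE _ w2_neq0)]; in_subfield.
Qed.

(** The vector V x f is determined by its products with V, with (1 / V_i) and
    with the cross product of these two, and its entries are V_i (1 - 3 h_i). *)
Lemma h0_formula : h0 = (1 - (3%:R * sum_g * (w0^-1 - 1) - sum_f * (w2 - w1) / m) * m / den_D) / 3%:R.
Proof.
pose Q := w0^-1 + w1^-1 + w2^-1 - 3%:R.
have DE : den_D = m * Q by rewrite /den_D /sum_u /Q; field; rewrite w0_neq0 w1_neq0 w2_neq0.
have Q0 : Q != 0 by move: D_neq0; rewrite DE mulf_eq0 negb_or => /andP [].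
have m0 := m_neq0.
rewrite DE /sum_f; apply: (mulfI three_neq0); apply: (mulIf Q0).
rewrite [RHS](_ : _ = Q - (3%:R * sum_g * (w0^-1 - 1) - ((h2 - h1) / w0 + (h0 - h2) / w1 + (h1 - h0) / w2) * (w2 - w1))); last first.
  by field; rewrite w0_neq0 w1_neq0 w2_neq0 m0 Q0 three_neq0.
have h0E : h0 = (1 - w1 * h1 - w2 * h2) / w0 by rewrite -sum_wh; field.
have w0E : w0 = 3%:R - w1 - w2 by rewrite -sum_w; ring.
rewrite /Q /sum_g h0E.
move: w0_neq0; rewrite w0E => w_neq0.
by field; rewrite w_neq0 w1_neq0 w2_neq0.
Qed.

End Recovery.
End Quadric.

(** * Symmetries and projection of the quadric *)

Ltac push_rmorph := rewrite ?(rmorphD, rmorphB, rmorphN, rmorphM, fmorphV, rmorphXn, rmorph_nat, rmorph1) /=.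

Section Symmetries.
Variable K : fieldType.
Implicit Types w h m : K.

Lemma sum_u_rot w0 w1 w2 m : sum_u w1 w2 w0 m = sum_u w0 w1 w2 m.
Proof. by rewrite /sum_u; ring. Qed.

Lemma sum_f_rot w0 w1 w2 h0 h1 h2 m : sum_f w1 w2 w0 h1 h2 h0 m = sum_f w0 w1 w2 h0 h1 h2 m.
Proof. by rewrite /sum_f; ring. Qed.

Lemma sum_g_rot h0 h1 h2 : sum_g h1 h2 h0 = sum_g h0 h1 h2.
Proof. by rewrite /sum_g; ring. Qed.

Lemma delta_u_rot w0 w1 w2 m : delta_u w1 w2 w0 m = delta_u w0 w1 w2 m.
Proof. by rewrite /delta_u; ring. Qed.

Lemma general_position_rot w0 w1 w2 m : general_position w0 w1 w2 m -> general_position w1 w2 w0 m.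
Proof.
by case=> t D n z; split; rewrite ?/quad_zeta ?/den_n ?/den_D ?(sum_u_rot w0).
Qed.

Lemma sum_u_swap w0 w1 w2 m : sum_u w1 w0 w2 m = sum_u w0 w1 w2 m.
Proof. by rewrite /sum_u; ring. Qed.

Lemma sum_f_swap w0 w1 w2 h0 h1 h2 m : sum_f w1 w0 w2 h1 h0 h2 m = - sum_f w0 w1 w2 h0 h1 h2 m.
Proof. by rewrite /sum_f; ring. Qed.

Lemma sum_g_swap h0 h1 h2 : sum_g h1 h0 h2 = sum_g h0 h1 h2.
Proof. by rewrite /sum_g; ring. Qed.

Lemma delta_u_swap w0 w1 w2 m : delta_u w1 w0 w2 m = - delta_u w0 w1 w2 m.
Proof. by rewrite /delta_u; ring. Qed.

Lemma quad_rot w0 w1 w2 h0 h1 h2 m :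
  [/\ quad_alpha w1 w2 w0 h1 h2 h0 m = quad_alpha w0 w1 w2 h0 h1 h2 m,
      quad_beta w1 w2 w0 h1 h2 h0 m = quad_beta w0 w1 w2 h0 h1 h2 m,
      quad_zeta w1 w2 w0 m = quad_zeta w0 w1 w2 m
    & quad_pi w1 w2 w0 m = quad_pi w0 w1 w2 m].
Proof.
by rewrite /quad_alpha /quad_beta /quad_zeta /quad_pi /trace_A /den_n /den_D
  (sum_u_rot w0) (sum_f_rot w0) (sum_g_rot h0) (delta_u_rot w0).
Qed.

Lemma quad_swap w0 w1 w2 h0 h1 h2 m :
  [/\ quad_alpha w1 w0 w2 h1 h0 h2 m = - quad_alpha w0 w1 w2 h0 h1 h2 m,
      quad_beta w1 w0 w2 h1 h0 h2 m = quad_beta w0 w1 w2 h0 h1 h2 m,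
      quad_zeta w1 w0 w2 m = quad_zeta w0 w1 w2 m
    & quad_pi w1 w0 w2 m = - quad_pi w0 w1 w2 m].
Proof.
rewrite /quad_alpha /quad_beta /quad_zeta /quad_pi /trace_A /den_n /den_D
  (sum_u_swap w0) (sum_f_swap w0) (sum_g_swap h0) (delta_u_swap w0).
by split; rewrite ?mulrN ?mulNr -?opprD ?mulrN ?mulNr ?opprK.
Qed.

Variable g : {rmorphism K -> K}.

Lemma rmorph_quad w0 w1 w2 h0 h1 h2 m :
  [/\ g (quad_alpha w0 w1 w2 h0 h1 h2 m)
        = quad_alpha (g w0) (g w1) (g w2) (g h0) (g h1) (g h2) (g m),
      g (quad_beta w0 w1 w2 h0 h1 h2 m)
        = quad_beta (g w0) (g w1) (g w2) (g h0) (g h1) (g h2) (g m),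
      g (quad_zeta w0 w1 w2 m) = quad_zeta (g w0) (g w1) (g w2) (g m)
    & g (quad_pi w0 w1 w2 m) = quad_pi (g w0) (g w1) (g w2) (g m)].
Proof.
have uE : sum_u (g w0) (g w1) (g w2) (g m) = g (sum_u w0 w1 w2 m).
  by rewrite /sum_u; push_rmorph.
have fE : sum_f (g w0) (g w1) (g w2) (g h0) (g h1) (g h2) (g m) = g (sum_f w0 w1 w2 h0 h1 h2 m).
  by rewrite /sum_f; push_rmorph.
have gE : sum_g (g h0) (g h1) (g h2) = g (sum_g h0 h1 h2) by rewrite /sum_g; push_rmorph.
have dE : delta_u (g w0) (g w1) (g w2) (g m) = g (delta_u w0 w1 w2 m).
  by rewrite /delta_u; push_rmorph.
rewrite /quad_alpha /quad_beta /quad_zeta /quad_pi /trace_A /den_n /den_D uE fE gE dE.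
move: (sum_u _ _ _ _) (sum_f _ _ _ _ _ _ _) (sum_g _ _ _) (delta_u _ _ _ _) => u f t d.
by split; push_rmorph.
Qed.

End Symmetries.

(** Right multiplication of the quaternion by an element of order three fixes
    the w_i and rotates the centroid of the triangle. *)
Section Rotation.
Variables (K : fieldType) (w0 w1 w2 h0 h1 h2 m : K).
Hypothesis tri : triangle w0 w1 w2 h0 h1 h2 m.

Let two_neq0 : 2%:R != 0 :> K := triangle_two tri.
Let w0_neq0 : w0 != 0. Proof. by case: (triangle_w_neq0 tri). Qed.
Let w1_neq0 : w1 != 0. Proof. by case: (triangle_w_neq0 tri). Qed.
Let w2_neq0 : w2 != 0. Proof. by case: (triangle_w_neq0 tri). Qed.
Let sum_w := triangle_sum_w tri.
Let sum_wh := triangle_sum_wh tri.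
Let prod_w := triangle_prod_w tri.

Definition rotate_h (w h h' h'' : K) := (1 - h + m * (h'' - h') / w) / 2%:R.

Let k0 := rotate_h w0 h0 h1 h2.
Let k1 := rotate_h w1 h1 h2 h0.
Let k2 := rotate_h w2 h2 h0 h1.

Lemma sum_g_rotate : sum_g k0 k1 k2 = (- sum_g h0 h1 h2 - sum_f w0 w1 w2 h0 h1 h2 m) / 2%:R.
Proof.
rewrite /sum_g /k0 /k1 /k2 /rotate_h /sum_f; field.
by rewrite two_neq0 w0_neq0 w1_neq0 w2_neq0.
Qed.

Lemma sum_f_rotate : sum_f w0 w1 w2 k0 k1 k2 m
  = (3%:R * sum_g h0 h1 h2 - sum_f w0 w1 w2 h0 h1 h2 m) / 2%:R.
Proof.
pose q := m ^+ 2 * ((h1 - h0) / w2 - (h0 - h2) / w1) / w0 +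
  m ^+ 2 * ((h2 - h1) / w0 - (h1 - h0) / w2) / w1 +
  m ^+ 2 * ((h0 - h2) / w1 - (h2 - h1) / w0) / w2.
have -> : sum_f w0 w1 w2 k0 k1 k2 m = (q - sum_f w0 w1 w2 h0 h1 h2 m) / 2%:R.
  rewrite /sum_f /k0 /k1 /k2 /rotate_h /q; field.
  by rewrite two_neq0 w0_neq0 w1_neq0 w2_neq0.
suff -> : q = 3%:R * sum_g h0 h1 h2 by [].
transitivity (3%:R * (w0 * h0 + w1 * h1 + w2 * h2) - (h0 + h1 + h2) * (w0 + w1 + w2)).
  by rewrite /q -prod_w; field; rewrite w0_neq0 w1_neq0 w2_neq0.
by rewrite sum_wh sum_w /sum_g; ring.
Qed.

Lemma quad_rotate :
  quad_alpha w0 w1 w2 k0 k1 k2 m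
    = (3%:R * quad_beta w0 w1 w2 h0 h1 h2 m - quad_alpha w0 w1 w2 h0 h1 h2 m) / 2%:R /\
  quad_beta w0 w1 w2 k0 k1 k2 m
    = (- quad_alpha w0 w1 w2 h0 h1 h2 m - quad_beta w0 w1 w2 h0 h1 h2 m) / 2%:R.
Proof.
rewrite /quad_alpha /quad_beta sum_f_rotate sum_g_rotate.
set x := sum_f _ _ _ _ _ _ _; set y := sum_g _ _ _; set d := (_ * den_D _ _ _ _)^-1.
by split; field.
Qed.

(** The half turn about (1, 1, 1) carries H to 2 V / 3 - H. *)
Lemma quad_half_turn : 3%:R != 0 :> K -> let r h := 2%:R / 3%:R - h in
  quad_alpha w0 w1 w2 (r h0) (r h1) (r h2) m = - quad_alpha w0 w1 w2 h0 h1 h2 m /\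
  quad_beta w0 w1 w2 (r h0) (r h1) (r h2) m = - quad_beta w0 w1 w2 h0 h1 h2 m.
Proof.
move=> three_neq0 r.
have fE : sum_f w0 w1 w2 (r h0) (r h1) (r h2) m = - sum_f w0 w1 w2 h0 h1 h2 m.
  by rewrite /sum_f /r; ring.
have gE : sum_g (r h0) (r h1) (r h2) = - sum_g h0 h1 h2 by rewrite /sum_g /r; field.
by rewrite /quad_alpha /quad_beta fE gE; split; ring.
Qed.

End Rotation.

(** Points (a, b, z, p) of the quadric a^2 + 3 b^2 + 6 z^2 + 2 p^2 = 18 are
    projected from its rational point (0, 2, 1, 0). *)
Section Projection.
Variables (K : fieldType) (a b z p : K).
Hypothesis quadric : a ^+ 2 + 3%:R * b ^+ 2 + 6%:R * z ^+ 2 + 2%:R * p ^+ 2 = 18%:R.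
Hypotheses (two_neq0 : 2%:R != 0 :> K) (three_neq0 : 3%:R != 0 :> K).
Hypotheses (b_neq2 : b - 2%:R != 0) (bz_neq3 : b + z - 3%:R != 0).

Definition slope := (z - 1) / (b - 2%:R).

(** A line through the centre meets the quadric in one further point. *)
Lemma projection_inverse :
  b - 2%:R = - (12%:R * (1 + slope))
    / ((a / (b - 2%:R)) ^+ 2 + 3%:R + 6%:R * slope ^+ 2 + 2%:R * (p / (b - 2%:R)) ^+ 2).
Proof.
have twelve : 12%:R != 0 :> K by rewrite (_ : 12%:R = 2%:R * 2%:R * 3%:R); [rewrite !mulf_neq0|ring].
have E : (b - 2%:R) * ((a / (b - 2%:R)) ^+ 2 + 3%:R + 6%:R * slope ^+ 2 + 2%:R * (p / (b - 2%:R)) ^+ 2)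
    = - (12%:R * (1 + slope)).
  apply/eqP; rewrite -addr_eq0 -(inj_eq (mulfI b_neq2)) mulr0; apply/eqP.
  rewrite [LHS](_ : _ = a ^+ 2 + 3%:R * b ^+ 2 + 6%:R * z ^+ 2 + 2%:R * p ^+ 2 - 18%:R).
    by rewrite quadric subrr.
  by rewrite /slope; field.
rewrite -E mulfK //; apply: contraNneq bz_neq3 => E0.
move: E; rewrite E0 mulr0 => /esym/eqP; rewrite oppr_eq0 mulf_eq0 (negPf twelve) /= => /eqP c0.
apply/eqP; rewrite -(mulr0 (b - 2%:R)) -c0 /slope; field; exact: b_neq2.
Qed.
End Projection.

Section ProjectionFields.
Variables (K : fieldType) (a b z p : K) (F : K -> Prop) (fF : subfield F).
Hypothesis quadric : a ^+ 2 + 3%:R * b ^+ 2 + 6%:R * z ^+ 2 + 2%:R * p ^+ 2 = 18%:R.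
Hypotheses (two_neq0 : 2%:R != 0 :> K) (three_neq0 : 3%:R != 0 :> K).
Hypotheses (b_neq2 : b - 2%:R != 0) (bz_neq3 : b + z - 3%:R != 0).
Hypothesis Fslope : F (slope b z).

Lemma projection_recover : F ((a / (b - 2%:R)) ^+ 2) -> F ((p / (b - 2%:R)) ^+ 2) ->
  [/\ F (b - 2%:R), F b & F z].
Proof.
move=> Fa Fp; have Fs : F (b - 2%:R).
  by rewrite (projection_inverse quadric two_neq0 three_neq0 b_neq2 bz_neq3); in_subfield.
split=> //; first by rewrite -(subrK 2%:R b); in_subfield.
rewrite (_ : z = slope b z * (b - 2%:R) + 1); last by rewrite /slope; field.
in_subfield.
Qed.

Lemma projection_recover_all : F (a / (b - 2%:R)) -> F (p / (b - 2%:R)) ->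
  [/\ F a, F b, F z & F p].
Proof.
move=> Fa Fp; have [||Fs Fb Fz] := projection_recover; [in_subfield|in_subfield|].
split=> //; last by rewrite -(divfK b_neq2 p); in_subfield.
by rewrite -(divfK b_neq2 a); in_subfield.
Qed.

(** The equation involves a and p through their squares only, so that the
    invariants of the sign change of (a, p) still determine the point up to it. *)
Lemma projection_recover_even : p != 0 -> F (a / p) -> F ((p / (b - 2%:R)) ^+ 2) ->
  [/\ F b, F z & F (p ^+ 2)].
Proof.
move=> p_neq0 Fap Fp.
have [||Fs Fb Fz] := projection_recover => //.
  rewrite (_ : a / (b - 2%:R) = a / p * (p / (b - 2%:R))); last by field; rewrite p_neq0 b_neq2.
  by rewrite exprMn; in_subfield.
split=> //; rewrite -(divfK b_neq2 p) exprMn; in_subfield.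
Qed.

End ProjectionFields.

Section QuadricSymmetries.
Variable K : fieldType.
Variables (g3 gr : {rmorphism K -> K}) (A B Z P : K).
Hypotheses (two_neq0 : 2%:R != 0 :> K) (three_neq0 : 3%:R != 0 :> K).
Hypothesis g3A : g3 A = (3%:R * B - A) / 2%:R.
Hypothesis g3B : g3 B = (- A - B) / 2%:R.
Hypotheses (grA : gr A = - A) (grB : gr B = - B) (grZ : gr Z = Z).
Hypothesis nu_neq0 : A ^+ 2 + 3%:R * B ^+ 2 != 0.

Lemma B_neq0 : B != 0.
Proof.
apply: contraNneq nu_neq0 => B0.
have : g3 B = 0 by rewrite B0 rmorph0.
rewrite g3B B0 subr0 => /eqP; rewrite mulf_eq0 invr_eq0 (negPf two_neq0) orbF oppr_eq0 => /eqP ->.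
by apply/eqP; ring.
Qed.

(** The rotation g3 has no rational eigenvector: A = c B would be carried to an
    equation that leaves (c^2 + 3) B = 0. *)
Lemma not_on_line c : g3 c = c -> 3%:R + c ^+ 2 != 0 -> A != c * B.
Proof.
move=> gc c_neq0; apply: contraNneq (mulf_neq0 c_neq0 B_neq0) => AE.
have E : 3%:R * B - A = c * (- A - B).
  rewrite (_ : 3%:R * B - A = 2%:R * g3 A); last by rewrite g3A; field.
  rewrite (_ : - A - B = 2%:R * g3 B); last by rewrite g3B; field.
  by rewrite {1}AE rmorphM gc; ring.
by rewrite -(subrr (3%:R * B - A)) {2}E AE; apply/eqP; ring.
Qed.

Lemma A_neq0 : A != 0.
Proof. by rewrite -(mul0r B) not_on_line ?rmorph0 // expr0n addr0. Qed.

Let four_neq0 : 3%:R + 1 != 0 :> K.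
Proof. by rewrite (_ : 3%:R + 1 = 2%:R * 2%:R); [rewrite mulf_neq0|ring]. Qed.

Let twelve_neq0 : 3%:R + 3%:R ^+ 2 != 0 :> K.
Proof.
by rewrite (_ : 3%:R + 3%:R ^+ 2 = 2%:R * 2%:R * 3%:R); [rewrite !mulf_neq0|ring].
Qed.

Lemma A_neqB : (A - B != 0) && (A + B != 0).
Proof.
rewrite subr_eq0 addr_eq0 -{1}[B]mul1r -mulN1r !not_on_line ?rmorphN ?rmorph1 //.
  by rewrite sqrrN expr1n.
by rewrite expr1n.
Qed.

Lemma A_neq3B : (A - 3%:R * B != 0) && (A + 3%:R * B != 0).
Proof.
rewrite subr_eq0 addr_eq0 -mulNr !not_on_line ?rmorphN ?rmorph_nat //.
by rewrite sqrrN.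
Qed.

(** The components of the cube of A + B sqrt(-3), divided by its norm: they
    generate the invariants of the rotation g3 and have the same norm. *)
Definition cube_alpha := (A ^+ 3 - 9%:R * A * B ^+ 2) / (A ^+ 2 + 3%:R * B ^+ 2).
Definition cube_beta := 3%:R * (A ^+ 2 * B - B ^+ 3) / (A ^+ 2 + 3%:R * B ^+ 2).

Lemma cube_norm : cube_alpha ^+ 2 + 3%:R * cube_beta ^+ 2 = A ^+ 2 + 3%:R * B ^+ 2.
Proof. by rewrite /cube_alpha /cube_beta; field. Qed.

Lemma cube_reflect (g : {rmorphism K -> K}) : g A = - A -> g B = B ->
  g cube_alpha = - cube_alpha /\ g cube_beta = cube_beta.
Proof.
move=> gA gB; rewrite /cube_alpha /cube_beta; push_rmorph.
by rewrite gA gB sqrrN; split; field.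
Qed.

Lemma cube_beta_neq0 : cube_beta != 0.
Proof.
rewrite /cube_beta (_ : A ^+ 2 * B - B ^+ 3 = B * (A - B) * (A + B)); last by ring.
by have /andP [? ?] := A_neqB; rewrite !mulf_neq0 ?invr_neq0 ?B_neq0.
Qed.

Lemma g3_norm : g3 (A ^+ 2 + 3%:R * B ^+ 2) = A ^+ 2 + 3%:R * B ^+ 2.
Proof. by push_rmorph; rewrite g3A g3B; field. Qed.

Lemma g3_cube_alpha : g3 cube_alpha = cube_alpha.
Proof.
rewrite /cube_alpha fmorph_div g3_norm; congr (_ / _).
by push_rmorph; rewrite g3A g3B; field.
Qed.

Lemma g3_cube_beta : g3 cube_beta = cube_beta.
Proof.
rewrite /cube_beta fmorph_div g3_norm; congr (_ / _).
by push_rmorph; rewrite g3A g3B; field.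
Qed.

Lemma gr_cube_beta : gr cube_beta = - cube_beta.
Proof.
rewrite /cube_beta.
by push_rmorph; rewrite grA grB; field.
Qed.

(** If b - 2 vanished, so would its image - b - 2, and then 4 = 0; if b + Z - 3
    did, then so would 2 b. *)
Lemma off_centre b : b != 0 -> gr b = - b -> (b - 2%:R != 0) /\ (b + Z - 3%:R != 0).
Proof.
move=> b0 grb; split; apply/eqP => E.
  have : gr (b - 2%:R) = 0 by rewrite E rmorph0.
  push_rmorph; rewrite grb => E'.
  have /eqP : 2%:R * 2%:R = 0 :> K.
    by rewrite -[RHS]oppr0 -[in RHS](addr0 0) -{1}E -{1}E'; ring.
  by rewrite mulf_eq0 (negPf two_neq0).
have : gr (b + Z - 3%:R) = 0 by rewrite E rmorph0.
push_rmorph; rewrite grb grZ => E'.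
have /eqP : 2%:R * b = 0 by rewrite -(subrr 0) -{1}E -E'; ring.
by rewrite mulf_eq0 (negPf two_neq0) (negPf b0).
Qed.

Section CubicDescent.
Variables (F : K -> Prop) (fF : subfield F).
Hypothesis g3F : forall u, F u -> g3 u = u.
Hypotheses (FA : F cube_alpha) (FB : F cube_beta) (Fnu : F (A ^+ 2 + 3%:R * B ^+ 2)).

Let t1 := (- A - B) / 2%:R.
Let t2 := (A - B) / 2%:R.

Let g3t1 : g3 t1 = t2.
Proof. by rewrite /t1 /t2; push_rmorph; rewrite g3A g3B; field. Qed.

Let g3t2 : g3 t2 = B.
Proof. by rewrite /t2; push_rmorph; rewrite g3A g3B; field. Qed.

Let t_distinct : [/\ B != t1, t1 != t2 & t2 != B].
Proof.
have /andP [A3B A3B'] := A_neq3B; split; rewrite -subr_eq0.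
- rewrite (_ : B - t1 = (A + 3%:R * B) / 2%:R); last by rewrite /t1; field.
  by rewrite mulf_neq0 ?invr_neq0.
- rewrite (_ : t1 - t2 = - A); last by rewrite /t1 /t2; field.
  by rewrite oppr_eq0 A_neq0.
- rewrite (_ : t2 - B = (A - 3%:R * B) / 2%:R); last by rewrite /t2; field.
  by rewrite mulf_neq0 ?invr_neq0.
Qed.

Let four0 : 4%:R != 0 :> K.
Proof. by rewrite (_ : 4%:R = 2%:R * 2%:R); [rewrite mulf_neq0|ring]. Qed.

Let twelve0 : 12%:R != 0 :> K.
Proof. by rewrite (_ : 12%:R = 2%:R * 2%:R * 3%:R); [rewrite !mulf_neq0|ring]. Qed.

Lemma rotation_descent_subfield :
  [/\ subfield (cubic_ext F B), cubic_ext F B A & cubic_ext F B B].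
Proof.
have [B1 t12 t2B] := t_distinct.
have fC : subfield (cubic_ext F B).
  apply: (cubic_ext_subfield fF g3F g3B g3t1 g3t2 B1 t12 t2B).
  - by rewrite (_ : B + _ + _ = 0); [apply: subfield0|rewrite -/t1 /t1 /t2; field].
  - rewrite (_ : _ + _ + _ = - (A ^+ 2 + 3%:R * B ^+ 2) / 4%:R); first by in_subfield.
    by rewrite /t2; field; rewrite four0 two_neq0.
  - rewrite (_ : _ * _ * _ = - cube_beta * (A ^+ 2 + 3%:R * B ^+ 2) / 12%:R); first by in_subfield.
    by rewrite /t2 /cube_beta; field; rewrite twelve0 nu_neq0 two_neq0.
have CB := cubic_ext_gen fF B; have C := @cubic_ext_base _ _ fF B.
split=> //.
have /andP [A3B A3B'] := A_neq3B.
rewrite (_ : A = cube_alpha * (A ^+ 2 + 3%:R * B ^+ 2)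
   / ((A ^+ 2 + 3%:R * B ^+ 2) - 12%:R * B ^+ 2)).
  have := C _ Fnu; have := C _ FA => ? ?; in_subfield.
have E : A ^+ 2 + 3%:R * B ^+ 2 - 12%:R * B ^+ 2 = (A - 3%:R * B) * (A + 3%:R * B) by ring.
by rewrite E /cube_alpha; field; rewrite nu_neq0 A3B A3B'.
Qed.

Lemma rotation_descent_fixed z : cubic_ext F B z -> g3 z = z -> F z.
Proof. by have [B1 t12 t2B] := t_distinct; apply: (cubic_ext_fixed g3F g3B g3t1). Qed.

End CubicDescent.
End QuadricSymmetries.

(** * Invariants of triangles *)

Definition fixed_by (K : fieldType) (g : {rmorphism K -> K}) (z : K) : Prop := g z = z.

Lemma fixed_by_subfield (K : fieldType) (g : {rmorphism K -> K}) : subfield (fixed_by g).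
Proof.
by split=> [|u v gu gv|u v gu gv|u gu]; rewrite /fixed_by ?rmorph1 ?rmorphB ?rmorphM ?fmorphV
  ?(gu : g u = u) ?(gv : g v = v).
Qed.

Lemma sign_change_generators (K : fieldType) (g : {rmorphism K -> K}) (a b z p : K) :
  g a = - a -> g b = b -> g z = z -> g p = - p ->
  [/\ g (slope b z) = slope b z, g (a / p) = a / p
    & g ((p / (b - 2%:R)) ^+ 2) = (p / (b - 2%:R)) ^+ 2].
Proof.
move=> ga gb gz gp; split; rewrite /slope; push_rmorph; rewrite ?ga ?gb ?gz ?gp //.
  by rewrite invrN mulrNN.
by rewrite mulNr sqrrN.
Qed.

Section KleinDescent.
Variables (K : fieldType) (C : K -> Prop) (fC : subfield C) (v0 v2 : K).
Variables (l1 l2 : {rmorphism K -> K}).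
Hypothesis two_neq0 : 2%:R != 0 :> K.
Hypotheses (l1C : forall u, C u -> l1 u = u) (l2C : forall u, C u -> l2 u = u).
Hypotheses (Cv0 : C (v0 ^+ 2)) (Cv2 : C (v2 ^+ 2)) (v0_neq0 : v0 != 0) (v2_neq0 : v2 != 0).
Hypotheses (l1v0 : l1 v0 = v0) (l2v0 : l2 v0 = - v0) (l1v2 : l1 v2 = - v2).

Definition biquadratic_ext := quadratic_ext (quadratic_ext C v0) v2.

Let fC0 := quadratic_ext_subfield fC Cv0.

Lemma biquadratic_ext_subfield : subfield biquadratic_ext.
Proof. by apply: quadratic_ext_subfield => //; apply: quadratic_ext_base. Qed.

Lemma biquadratic_ext_mem :
  [/\ forall u, C u -> biquadratic_ext u, biquadratic_ext v0 & biquadratic_ext v2].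
Proof.
split; last exact: quadratic_ext_gen.
  by move=> u Cu; do 2! apply: quadratic_ext_base => //.
by apply: quadratic_ext_base => //; apply: quadratic_ext_gen.
Qed.

Lemma biquadratic_ext_fixed f : biquadratic_ext f -> l1 f = f -> l2 f = f -> C f.
Proof.
move=> Bf l1f l2f; apply: (quadratic_ext_fixed l2C l2v0) => //.
apply: (quadratic_ext_fixed _ l1v2) Bf l1f => // _ [a [b [Ca Cb ->]]].
by rewrite rmorphD rmorphM l1v0 !l1C.
Qed.

End KleinDescent.

(** The automorphisms l1 and l2 act by signs on the square roots v_i of the w_i,
    and sg permutes the indices cyclically: together they induce the alternating
    group A4. The field top is generated over base by v_0, v_1, v_2 and the h_i. *)
Section Tower.
Variables (K : fieldType) (w0 w1 w2 h0 h1 h2 m v0 v2 : K).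
Variables (base top : K -> Prop).
Variables (l1 l2 sg : {rmorphism K -> K}).
Hypothesis tri : triangle w0 w1 w2 h0 h1 h2 m.
Hypotheses (v0E : v0 ^+ 2 = w0) (v2E : v2 ^+ 2 = w2).
Hypothesis top_least : forall F : K -> Prop, subfield F -> (forall z, base z -> F z) ->
  [/\ F w0, F w1 & F w2] -> [/\ F h0, F h1 & F h2] -> [/\ F m, F v0 & F v2] ->
  forall z, top z -> F z.
Hypotheses (l1v0 : l1 v0 = v0) (l2v0 : l2 v0 = - v0) (l1v2 : l1 v2 = - v2).
Hypothesis l1D : [/\ l1 w0 = w0, l1 w1 = w1 & l1 w2 = w2] /\
  [/\ l1 h0 = h0, l1 h1 = h1 & l1 h2 = h2] /\ l1 m = m.
Hypothesis l2D : [/\ l2 w0 = w0, l2 w1 = w1 & l2 w2 = w2] /\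
  [/\ l2 h0 = h0, l2 h1 = h1 & l2 h2 = h2] /\ l2 m = m.
Hypothesis sgD : [/\ sg w0 = w1, sg w1 = w2 & sg w2 = w0] /\
  [/\ sg h0 = h1, sg h1 = h2 & sg h2 = h0] /\ sg m = m.

Let two_neq0 : 2%:R != 0 :> K := triangle_two tri.
Let w0_neq0 : w0 != 0. Proof. by case: (triangle_w_neq0 tri). Qed.
Let w1_neq0 : w1 != 0. Proof. by case: (triangle_w_neq0 tri). Qed.
Let w2_neq0 : w2 != 0. Proof. by case: (triangle_w_neq0 tri). Qed.
Let w01 : w0 != w1. Proof. by case: (triangle_w_distinct tri). Qed.
Let w12 : w1 != w2. Proof. by case: (triangle_w_distinct tri). Qed.
Let w20 : w2 != w0. Proof. by case: (triangle_w_distinct tri). Qed.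
Let sum_w := triangle_sum_w tri.
Let sum_wh := triangle_sum_wh tri.
Let sum_whh := triangle_sum_whh tri.
Let prod_w := triangle_prod_w tri.
Let mn0 : m != 0 := m_neq0 tri.

Definition A4_fixed z := [/\ l1 z = z, l2 z = z & sg z = z].

Lemma A4_fixed_subfield : subfield A4_fixed.
Proof.
split=> [|u v [u1 u2 u3] [v1 v2' v3]|u v [u1 u2 u3] [v1 v2' v3]|u [u1 u2 u3]]; split;
  push_rmorph; by rewrite ?u1 ?u2 ?u3 ?v1 ?v2' ?v3.
Qed.

Let v0_neq0 : v0 != 0.
Proof. by apply: contraNneq w0_neq0 => v00; rewrite -v0E v00 expr0n. Qed.

Let v2_neq0 : v2 != 0.
Proof. by apply: contraNneq w2_neq0 => v20; rewrite -v2E v20 expr0n. Qed.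

(** Over F the element t0 generates a cubic extension containing the triangle,
    and top arises from it by the square roots v_0 and v_2. An invariant descends
    from v_2 by l1, from v_0 by l2 and from t0 by sg. *)
Lemma A4_descent (F : K -> Prop) (t0 t1 t2 : K) : subfield F ->
  (forall z, base z -> F z) -> (forall z, F z -> A4_fixed z) ->
  sg t0 = t1 -> sg t1 = t2 -> sg t2 = t0 -> t0 != t1 -> t1 != t2 -> t2 != t0 ->
  l1 t0 = t0 -> l2 t0 = t0 ->
  F (t0 + t1 + t2) -> F (t0 * t1 + t1 * t2 + t2 * t0) -> F (t0 * t1 * t2) ->
  (forall C, subfield C -> (forall z, F z -> C z) -> C t0 ->
     [/\ [/\ C w0, C w1 & C w2], [/\ C h0, C h1 & C h2] & C m]) ->
  forall z, top z -> A4_fixed z -> F z.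
Proof.
move=> fF bF Ffix sgt0 sgt1 sgt2 t01 t12 t20 l1t l2t Fe1 Fe2 Fe3 gen z topz [l1z l2z sgz].
have sgF u : F u -> sg u = u by move=> /Ffix [].
apply: (cubic_ext_fixed sgF sgt0 sgt1) => //.
have fC := cubic_ext_subfield fF sgF sgt0 sgt1 sgt2 t01 t12 t20 Fe1 Fe2 Fe3.
have [Cw Ch Cm] := gen _ fC (fun u => @cubic_ext_base _ _ fF t0 u) (cubic_ext_gen fF t0).
have [Cw0 Cw1 Cw2] := Cw; have [Ch0 Ch1 Ch2] := Ch.
have Cv0 : cubic_ext F t0 (v0 ^+ 2) by rewrite v0E.
have Cv2 : cubic_ext F t0 (v2 ^+ 2) by rewrite v2E.
have l1C u : cubic_ext F t0 u -> l1 u = u.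
  by move=> [a [b [c [/Ffix [l1a _ _] /Ffix [l1b _ _] /Ffix [l1c _ _] ->]]]]; push_rmorph; rewrite l1a l1b l1c l1t.
have l2C u : cubic_ext F t0 u -> l2 u = u.
  by move=> [a [b [c [/Ffix [_ l2a _] /Ffix [_ l2b _] /Ffix [_ l2c _] ->]]]]; push_rmorph; rewrite l2a l2b l2c l2t.
apply: (biquadratic_ext_fixed two_neq0 l1C l2C v0_neq0 v2_neq0 l1v0 l2v0 l1v2) => //.
have [CB Bv0 Bv2] := @biquadratic_ext_mem _ _ fC v0 v2 Cv0.
apply: top_least topz; first exact: biquadratic_ext_subfield.
- by move=> u /bF Fu; apply: CB; apply: cubic_ext_base.
- by split; apply: CB.
- by split; apply: CB.
- by split=> //; apply: CB.
Qed.

Section CharNot3.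
Hypothesis gen : general_position w0 w1 w2 m.

Let three_neq0 : 3%:R != 0 :> K := general_position_three gen.

Notation A := (quad_alpha w0 w1 w2 h0 h1 h2 m).
Notation B := (quad_beta w0 w1 w2 h0 h1 h2 m).
Notation Z := (quad_zeta w0 w1 w2 m).
Notation P := (quad_pi w0 w1 w2 m).

Lemma recover_cubic (F : K -> Prop) : subfield F -> F Z -> F P -> F (sum_u w0 w1 w2 m) /\ F m.
Proof.
move=> fF FZ FP; split.
  exact: (recover_sum_u tri gen fF FZ FP).
exact: (recover_m tri gen fF FZ FP).
Qed.

Lemma recover_triangle (F : K -> Prop) : subfield F -> F A -> F B -> F Z -> F P -> F (m / w0) ->
  [/\ [/\ F w0, F w1 & F w2], [/\ F h0, F h1 & F h2] & F m].
Proof.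
move=> fF FA FB FZ FP Fu0.
have [Fs Fm] := recover_cubic fF FZ FP.
have Fw : [/\ F w0, F w1 & F w2].
  exact: (recover_w tri gen fF FZ FP Fu0).
have Ff : F (sum_f w0 w1 w2 h0 h1 h2 m).
  exact: (recover_sum_f tri gen fF FA FB FZ FP).
have Fg : F (sum_g h0 h1 h2).
  exact: (recover_sum_g tri gen fF FA FB FZ FP).
have FD : F (den_D w0 w1 w2 m) by rewrite /den_D; in_subfield.
have gen1 : general_position w1 w2 w0 m by exact: general_position_rot.
have gen2 : general_position w2 w0 w1 m by exact: general_position_rot.
have tri1 := triangle_rot tri; have tri2 := triangle_rot tri1.
have [Fw0 Fw1 Fw2] := Fw; split=> //; split.
- by rewrite (h0_formula tri gen); in_subfield.
- by rewrite (h0_formula tri1 gen1) /den_D (sum_f_rot w0) (sum_g_rot h0) (sum_u_rot w0) -/(den_D w0 w1 w2 m); in_subfield.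
- rewrite (h0_formula tri2 gen2) /den_D (sum_f_rot w1) (sum_f_rot w0) (sum_g_rot h1) (sum_g_rot h0).
  by rewrite (sum_u_rot w1) (sum_u_rot w0) -/(den_D w0 w1 w2 m); in_subfield.
Qed.

Lemma A4_invariants (F : K -> Prop) : subfield F ->
  (forall z, base z -> F z) -> (forall z, F z -> A4_fixed z) ->
  F A -> F B -> F Z -> F P -> forall z, top z -> A4_fixed z -> F z.
Proof.
have [[l1w0 l1w1 l1w2] [[l1h0 l1h1 l1h2] l1m]] := l1D.
have [[l2w0 l2w1 l2w2] [[l2h0 l2h1 l2h2] l2m]] := l2D.
have [[sgw0 sgw1 sgw2] [[sgh0 sgh1 sgh2] sgm]] := sgD.
move=> fF bF Ffix FA FB FZ FP.
have [Fs Fm] := recover_cubic fF FZ FP.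
have neq_u a b : a != 0 -> b != 0 -> a != b -> m / a != m / b.
  move=> a0 b0; apply: contra_neq => E.
  by apply: invr_inj; apply: (mulfI mn0).
apply: (A4_descent fF bF Ffix (t0 := m / w0) (t1 := m / w1) (t2 := m / w2)).
- by rewrite fmorph_div sgm sgw0.
- by rewrite fmorph_div sgm sgw1.
- by rewrite fmorph_div sgm sgw2.
- exact: neq_u.
- exact: neq_u.
- exact: neq_u.
- by rewrite fmorph_div l1m l1w0.
- by rewrite fmorph_div l2m l2w0.
- exact: Fs.
- by rewrite (e2_u tri); in_subfield.
- by rewrite (e3_u tri).
- by move=> C fC FC; apply: recover_triangle => //; apply: FC.
Qed.

Lemma quad_A4_fixed : [/\ A4_fixed A, A4_fixed B, A4_fixed Z & A4_fixed P].
Proof.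
have [[l1w0 l1w1 l1w2] [[l1h0 l1h1 l1h2] l1m]] := l1D.
have [[l2w0 l2w1 l2w2] [[l2h0 l2h1 l2h2] l2m]] := l2D.
have [[sgw0 sgw1 sgw2] [[sgh0 sgh1 sgh2] sgm]] := sgD.
have [a1 b1 z1 p1] := rmorph_quad l1 w0 w1 w2 h0 h1 h2 m.
have [a2 b2 z2 p2] := rmorph_quad l2 w0 w1 w2 h0 h1 h2 m.
have [a3 b3 z3 p3] := rmorph_quad sg w0 w1 w2 h0 h1 h2 m.
have [ra rb rz rp] := quad_rot w0 w1 w2 h0 h1 h2 m.
split; split.
- by rewrite a1 l1w0 l1w1 l1w2 l1h0 l1h1 l1h2 l1m.
- by rewrite a2 l2w0 l2w1 l2w2 l2h0 l2h1 l2h2 l2m.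
- by rewrite a3 sgw0 sgw1 sgw2 sgh0 sgh1 sgh2 sgm ra.
- by rewrite b1 l1w0 l1w1 l1w2 l1h0 l1h1 l1h2 l1m.
- by rewrite b2 l2w0 l2w1 l2w2 l2h0 l2h1 l2h2 l2m.
- by rewrite b3 sgw0 sgw1 sgw2 sgh0 sgh1 sgh2 sgm rb.
- by rewrite z1 l1w0 l1w1 l1w2 l1m.
- by rewrite z2 l2w0 l2w1 l2w2 l2m.
- by rewrite z3 sgw0 sgw1 sgw2 sgm rz.
- by rewrite p1 l1w0 l1w1 l1w2 l1m.
- by rewrite p2 l2w0 l2w1 l2w2 l2m.
- by rewrite p3 sgw0 sgw1 sgw2 sgm rp.
Qed.

Lemma quadric_ABZP : A ^+ 2 + 3%:R * B ^+ 2 + 6%:R * Z ^+ 2 + 2%:R * P ^+ 2 = 18%:R.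
Proof. exact: (quadric_equation tri gen). Qed.

Variables (l3 l4 gr : {rmorphism K -> K}).
Hypothesis l3D : [/\ l3 w0 = w0, l3 w1 = w1 & l3 w2 = w2] /\
  [/\ l3 h0 = rotate_h m w0 h0 h1 h2, l3 h1 = rotate_h m w1 h1 h2 h0
    & l3 h2 = rotate_h m w2 h2 h0 h1] /\ l3 m = m.
Hypothesis grD : [/\ gr w0 = w0, gr w1 = w1 & gr w2 = w2] /\
  [/\ gr h0 = 2%:R / 3%:R - h0, gr h1 = 2%:R / 3%:R - h1
    & gr h2 = 2%:R / 3%:R - h2] /\ gr m = m.
Hypothesis l4D : [/\ l4 w0 = w1, l4 w1 = w0 & l4 w2 = w2] /\
  [/\ l4 h0 = h1, l4 h1 = h0 & l4 h2 = h2] /\ l4 m = m.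

Lemma l3_quad : [/\ l3 A = (3%:R * B - A) / 2%:R, l3 B = (- A - B) / 2%:R, l3 Z = Z & l3 P = P].
Proof.
have [[l3w0 l3w1 l3w2] [[l3h0 l3h1 l3h2] l3m]] := l3D.
have [-> -> -> ->] := rmorph_quad l3 w0 w1 w2 h0 h1 h2 m.
rewrite l3w0 l3w1 l3w2 l3h0 l3h1 l3h2 l3m.
by have [] := quad_rotate tri.
Qed.

Lemma gr_quad : [/\ gr A = - A, gr B = - B, gr Z = Z & gr P = P].
Proof.
have [[grw0 grw1 grw2] [[grh0 grh1 grh2] grm]] := grD.
have [-> -> -> ->] := rmorph_quad gr w0 w1 w2 h0 h1 h2 m.
rewrite grw0 grw1 grw2 grh0 grh1 grh2 grm.
by have [] := quad_half_turn w0 w1 w2 h0 h1 h2 m three_neq0.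
Qed.

Lemma l4_quad : [/\ l4 A = - A, l4 B = B, l4 Z = Z & l4 P = - P].
Proof.
have [[l4w0 l4w1 l4w2] [[l4h0 l4h1 l4h2] l4m]] := l4D.
have [-> -> -> ->] := rmorph_quad l4 w0 w1 w2 h0 h1 h2 m.
rewrite l4w0 l4w1 l4w2 l4h0 l4h1 l4h2 l4m.
exact: quad_swap.
Qed.

Lemma P_neq0 : P != 0.
Proof.
have neq_u a b : a != 0 -> b != 0 -> a != b -> m / a - m / b != 0.
  move=> a0 b0; rewrite subr_eq0; apply: contra_neq => E.
  by apply: invr_inj; apply: (mulfI mn0).
by case: gen => _ D0 _ _; rewrite mulf_neq0 ?invr_neq0 // !mulf_neq0 // neq_u.
Qed.

Let nu_neq0 : A ^+ 2 + 3%:R * B ^+ 2 != 0.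
Proof.
rewrite (quad_norm tri gen); case: gen => _ D0 n0 _.
rewrite !mulf_neq0 ?invr_neq0 //.
by rewrite (_ : 8%:R = 2%:R ^+ 3); [rewrite expf_neq0|ring].
Qed.

Notation A' := (cube_alpha A B).
Notation B' := (cube_beta A B).

Lemma cube_quadric : A' ^+ 2 + 3%:R * B' ^+ 2 + 6%:R * Z ^+ 2 + 2%:R * P ^+ 2 = 18%:R.
Proof. by rewrite cube_norm // quadric_ABZP. Qed.

Lemma B_off_centre : (B - 2%:R != 0) /\ (B + Z - 3%:R != 0).
Proof.
have [l3A l3B _ _] := l3_quad; have [grA grB grZ _] := gr_quad.
by apply: (off_centre two_neq0 grZ _ grB); apply: (B_neq0 two_neq0 l3B).
Qed.

Lemma B'_off_centre : (B' - 2%:R != 0) /\ (B' + Z - 3%:R != 0).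
Proof.
have [l3A l3B _ _] := l3_quad; have [grA grB grZ _] := gr_quad.
apply: (off_centre two_neq0 grZ); last exact: gr_cube_beta grA grB nu_neq0.
exact: cube_beta_neq0 two_neq0 three_neq0 l3A l3B nu_neq0.
Qed.

(** Nothing remains to be divided out on the quadric, and its projection is
    birational. *)
Theorem invariants_33_3 (F : K -> Prop) : subfield F ->
  (forall z, base z -> F z) -> (forall z, F z -> A4_fixed z) ->
  F (A / (B - 2%:R)) -> F (P / (B - 2%:R)) -> F (slope B Z) ->
  forall z, top z -> A4_fixed z -> F z.
Proof.
move=> fF bF Ffix Fa Fp Fs; have [b2 b3] := B_off_centre.
have [FA FB FZ FP] := projection_recover_all fF quadric_ABZP two_neq0 three_neq0 b2 b3 Fs Fa Fp.
exact: A4_invariants.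
Qed.

Let sign_descent (F : K -> Prop) a b : subfield F -> F (a / P) -> F b -> F Z -> F (P ^+ 2) ->
  [/\ subfield (quadratic_ext F P), quadratic_ext F P a, quadratic_ext F P b,
      quadratic_ext F P Z & quadratic_ext F P P].
Proof.
move=> fF Fa Fb FZ FP2; have fQ := quadratic_ext_subfield fF FP2.
have QP := quadratic_ext_gen fF P; have Q := @quadratic_ext_base _ _ fF P.
split=> //; try exact: Q.
by rewrite -(divfK P_neq0 a); apply: subfieldM => //; apply: Q.
Qed.

(** On the quadric, l4 is the sign change of (alpha, pi). *)
Theorem invariants_33_6 (F : K -> Prop) : subfield F ->
  (forall z, base z -> F z) -> (forall z, F z -> A4_fixed z /\ l4 z = z) ->
  F (A / P) -> F ((P / (B - 2%:R)) ^+ 2) -> F (slope B Z) ->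
  forall z, top z -> A4_fixed z -> l4 z = z -> F z.
Proof.
move=> fF bF Ffix Fa Fp Fs z topz fz l4z; have [b2 b3] := B_off_centre.
have [FB FZ FP2] := projection_recover_even fF quadric_ABZP two_neq0 three_neq0 b2 b3 Fs P_neq0 Fa Fp.
have [fQ QA QB QZ QP] := sign_descent fF Fa FB FZ FP2.
have [_ _ _ l4P] := l4_quad.
apply: (quadratic_ext_fixed _ l4P P_neq0 two_neq0) l4z => [u /Ffix []//|].
apply: (A4_invariants fQ) => //; first by move=> u /bF Fu; apply: quadratic_ext_base.
have fA := A4_fixed_subfield; have [_ _ _ fP] := quad_A4_fixed.
by move=> _ [a [b [/Ffix [fa _] /Ffix [fb _] ->]]]; in_subfield.
Qed.

Let A4_fixed_cubic (F : K -> Prop) u : (forall z, F z -> A4_fixed z) ->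
  cubic_ext F B u -> A4_fixed u.
Proof.
have [_ fB _ _] := quad_A4_fixed.
have fA := A4_fixed_subfield.
by move=> Ffix [a [b [c [/Ffix fa /Ffix fb /Ffix fc ->]]]]; in_subfield.
Qed.

Let rotation_step (F : K -> Prop) z : subfield F ->
  (forall z, base z -> F z) -> (forall z, F z -> A4_fixed z /\ l3 z = z) ->
  F A' -> F B' -> F Z -> F P -> top z -> A4_fixed z -> l3 z = z -> F z.
Proof.
move=> fF bF Ffix FA FB FZ FP topz fz l3z.
have [l3A l3B _ _] := l3_quad.
have l3F u : F u -> l3 u = u by move=> /Ffix [].
have Fnu : F (A ^+ 2 + 3%:R * B ^+ 2).
  rewrite (_ : _ + _ = 18%:R - 6%:R * Z ^+ 2 - 2%:R * P ^+ 2); last by rewrite -quadric_ABZP; ring.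
  by in_subfield.
have [fC CA CB] := rotation_descent_subfield two_neq0 three_neq0 l3A l3B nu_neq0 fF l3F FA FB Fnu.
apply: (rotation_descent_fixed two_neq0 three_neq0 l3A l3B nu_neq0 l3F) l3z.
have C := @cubic_ext_base _ _ fF B.
apply: (A4_invariants fC) => //; [by move=> u /bF /C | | exact: C | exact: C].
by move=> u; apply: A4_fixed_cubic => v /Ffix [].
Qed.

(** On the quadric, l3 multiplies alpha + beta sqrt(-3) by a cube root of unity;
    the cube divided by the norm has the same norm, so that the quotient is
    again the same quadric. *)
Theorem invariants_33_7 (F : K -> Prop) : subfield F ->
  (forall z, base z -> F z) -> (forall z, F z -> A4_fixed z /\ l3 z = z) ->
  F (A' / (B' - 2%:R)) -> F (P / (B' - 2%:R)) -> F (slope B' Z) ->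
  forall z, top z -> A4_fixed z -> l3 z = z -> F z.
Proof.
move=> fF bF Ffix Fa Fp Fs z; have [b2 b3] := B'_off_centre.
have [FA FB FZ FP] := projection_recover_all fF cube_quadric two_neq0 three_neq0 b2 b3 Fs Fa Fp.
exact: rotation_step.
Qed.

Theorem invariants_33_11 (F : K -> Prop) : subfield F ->
  (forall z, base z -> F z) -> (forall z, F z -> [/\ A4_fixed z, l3 z = z & l4 z = z]) ->
  F (A' / P) -> F ((P / (B' - 2%:R)) ^+ 2) -> F (slope B' Z) ->
  forall z, top z -> A4_fixed z -> l3 z = z -> l4 z = z -> F z.
Proof.
move=> fF bF Ffix Fa Fp Fs z topz fz l3z l4z; have [b2 b3] := B'_off_centre.
have [FB FZ FP2] := projection_recover_even fF cube_quadric two_neq0 three_neq0 b2 b3 Fs P_neq0 Fa Fp.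
have [fQ QA QB QZ QP] := sign_descent fF Fa FB FZ FP2.
have [_ _ _ l4P] := l4_quad; have [_ _ _ l3P] := l3_quad.
apply: (quadratic_ext_fixed _ l4P P_neq0 two_neq0) l4z => [u /Ffix []//|].
apply: (rotation_step fQ) => //; first by move=> u /bF Fu; apply: quadratic_ext_base.
have fA := A4_fixed_subfield; have [_ _ _ fP] := quad_A4_fixed.
move=> _ [a [b [/Ffix [fa l3a _] /Ffix [fb l3b _] ->]]]; split; first by in_subfield.
by rewrite rmorphD rmorphM l3a l3b l3P.
Qed.

Lemma generators_fixed :
  [/\ A4_fixed (A / (B - 2%:R)), A4_fixed (P / (B - 2%:R)), A4_fixed (slope B Z) & A4_fixed (A / P)].
Proof.
have fA := A4_fixed_subfield; have [? ? ? ?] := quad_A4_fixed.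
by split; rewrite /slope; in_subfield.
Qed.

Lemma generators_l4 :
  [/\ l4 (slope B Z) = slope B Z, l4 (A / P) = A / P & l4 ((P / (B - 2%:R)) ^+ 2) = (P / (B - 2%:R)) ^+ 2].
Proof.
by have [l4A l4B l4Z l4P] := l4_quad; apply: sign_change_generators.
Qed.

Lemma cube_fixed :
  [/\ A4_fixed A', A4_fixed B', l3 A' = A' & l3 B' = B'] /\ (l4 A' = - A' /\ l4 B' = B').
Proof.
have fA := A4_fixed_subfield; have [? ? ? ?] := quad_A4_fixed.
have [l3A l3B _ _] := l3_quad; have [l4A l4B _ _] := l4_quad.
split; first split.
- by rewrite /cube_alpha; in_subfield.
- by rewrite /cube_beta; in_subfield.
- exact: g3_cube_alpha two_neq0 l3A l3B.
- exact: g3_cube_beta two_neq0 l3A l3B.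
exact: cube_reflect.
Qed.

Lemma cube_generators_fixed : let a := A' / (B' - 2%:R) in let p := P / (B' - 2%:R) in
  let c := slope B' Z in let q := A' / P in
  [/\ A4_fixed a, A4_fixed p, A4_fixed c & A4_fixed q] /\
  [/\ l3 a = a, l3 p = p, l3 c = c & l3 q = q] /\
  [/\ l4 c = c, l4 q = q & l4 (p ^+ 2) = p ^+ 2].
Proof.
have fA := A4_fixed_subfield; have [? ? ? ?] := quad_A4_fixed.
have [_ _ l3Z l3P] := l3_quad; have [_ _ l4Z l4P] := l4_quad.
have [[? ? l3A' l3B'] [l4A' l4B']] := cube_fixed.
split; first by split; rewrite /slope; in_subfield.
split; last exact: sign_change_generators.
have f3 := fixed_by_subfield l3.
have f3A : fixed_by l3 A' := l3A'; have f3B : fixed_by l3 B' := l3B'.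
have f3Z : fixed_by l3 Z := l3Z; have f3P : fixed_by l3 P := l3P.
by split; rewrite -/(fixed_by l3 _) /slope; in_subfield.
Qed.

End CharNot3.
(** In characteristic three (1, 1, 1) is isotropic and the w_i are in arithmetic
    progression, so that the quadric is not available. *)
Section Char3.
Hypothesis three_eq0 : 3%:R = 0 :> K.

Definition width := w1 - w0.
(** The sum of the w_i^2 f_i / V_i, with f = V x H as before. *)
Definition moment := w0 ^+ 2 * (m * (h2 - h1) / w0) + w1 ^+ 2 * (m * (h0 - h2) / w1)
  + w2 ^+ 2 * (m * (h1 - h0) / w2).

Let f0 := m * (h2 - h1) / w0.
Let f1 := m * (h0 - h2) / w1.
Let f2 := m * (h1 - h0) / w2.

Let w_sum0 : w0 + w1 + w2 = 0.
Proof. by rewrite sum_w three_eq0. Qed.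

Let width_neq0 : width != 0.
Proof. by rewrite subr_eq0 eq_sym. Qed.

Let w1E : w1 = w0 + width.
Proof. by rewrite /width; ring. Qed.

Let w2E : w2 = w0 - width.
Proof.
apply/eqP; rewrite -subr_eq0; apply/eqP.
transitivity (w0 + w1 + w2 - 3%:R * w0); first by rewrite /width; ring.
by rewrite w_sum0 three_eq0; ring.
Qed.

(* V x f = V, since the image of (1, 1, 1) x (1, -1, 0) = (1, 1, -2) is that of
   (1, 1, 1) modulo 3 *)
Let f1E : f1 = f0 + w2 / m.
Proof.
suff E : m * (f1 - f0) = w2 by rewrite -E; field; exact: mn0.
transitivity (w2 * ((w0 * h0 + w1 * h1 + w2 * h2) - h2 * (w0 + w1 + w2))).
  rewrite /f1 /f0 (_ : m * _ = m ^+ 2 * ((h0 - h2) / w1 - (h2 - h1) / w0)); last by ring.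
  by rewrite -prod_w; field; rewrite w0_neq0 w1_neq0.
by rewrite sum_wh w_sum0; ring.
Qed.

Let f2E : f2 = f0 - w1 / m.
Proof.
suff E : m * (f0 - f2) = w1 by rewrite -E; field; exact: mn0.
transitivity (w1 * ((w0 * h0 + w1 * h1 + w2 * h2) - h1 * (w0 + w1 + w2))).
  rewrite /f2 /f0 (_ : m * _ = m ^+ 2 * ((h2 - h1) / w0 - (h1 - h0) / w2)); last by ring.
  by rewrite -prod_w; field; rewrite w0_neq0 w2_neq0.
by rewrite sum_wh w_sum0; ring.
Qed.

Let f0E : f0 = (moment - (w1 ^+ 2 * w2 - w2 ^+ 2 * w1) / m) / (2%:R * width ^+ 2).
Proof.
have -> : moment = 2%:R * width ^+ 2 * f0 + (w1 ^+ 2 * w2 - w2 ^+ 2 * w1) / m.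
  rewrite /moment -/f0 -/f1 -/f2 f1E f2E.
  transitivity ((w0 ^+ 2 + w1 ^+ 2 + w2 ^+ 2) * f0 + (w1 ^+ 2 * w2 - w2 ^+ 2 * w1) / m); first by ring.
  congr (_ * _ + _); rewrite w2E {1}w1E.
  by transitivity (3%:R * w0 ^+ 2 + 2%:R * width ^+ 2); [ring|rewrite three_eq0; ring].
by field; rewrite mn0 two_neq0 width_neq0.
Qed.

Let h0E : h0 = (1 - w1 * (w2 * f2 / m) ^+ 2 - w2 * (w1 * f1 / m) ^+ 2) / 2%:R.
Proof.
have aE : w2 * f2 / m = h1 - h0 by rewrite /f2; field; rewrite mn0 w2_neq0.
have bE : w1 * f1 / m = h0 - h2 by rewrite /f1; field; rewrite mn0 w1_neq0.
rewrite aE bE -{1}sum_whh.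
have -> : w0 * h0 ^+ 2 + w1 * h1 ^+ 2 + w2 * h2 ^+ 2 - w1 * (h1 - h0) ^+ 2 - w2 * (h0 - h2) ^+ 2
   = 2%:R * h0 * (w0 * h0 + w1 * h1 + w2 * h2) - h0 ^+ 2 * (w0 + w1 + w2) by ring.
by rewrite sum_wh w_sum0; field.
Qed.

(** The cubic with the roots w_i is T^3 - width^2 T - m^2. The differences of the
    f_i / V_i being known, the moment determines them all, and the relation
    |H|^2 = 1 then gives h_0. *)
Lemma A4_invariants_char3 (F : K -> Prop) : subfield F ->
  (forall z, base z -> F z) -> (forall z, F z -> A4_fixed z) ->
  F width -> F m -> F moment -> forall z, top z -> A4_fixed z -> F z.
Proof.
move=> fF bF Ffix Fd Fm FS.
have [[l1w0 l1w1 l1w2] _] := l1D.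
have [[l2w0 l2w1 l2w2] _] := l2D.
have [[sgw0 sgw1 sgw2] _] := sgD.
apply: (A4_descent fF bF Ffix (t0 := w0) (t1 := w1) (t2 := w2)) => //.
- by rewrite sum_w; in_subfield.
- rewrite (_ : _ + _ = - width ^+ 2); first by in_subfield.
  rewrite w2E w1E; transitivity (3%:R * w0 ^+ 2 - width ^+ 2); first by ring.
  by rewrite three_eq0; ring.
- by rewrite prod_w; in_subfield.
move=> C fC FC Cw0.
have Cd := FC _ Fd; have Cm := FC _ Fm; have CS := FC _ FS.
have Cw1 : C w1 by rewrite w1E; in_subfield.
have Cw2 : C w2 by rewrite w2E; in_subfield.
have Cf0 : C f0 by rewrite f0E; in_subfield.
have Cf1 : C f1 by rewrite f1E; in_subfield.
have Cf2 : C f2 by rewrite f2E; in_subfield.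
have Ch0 : C h0 by rewrite h0E; in_subfield.
have Ch1 : C h1.
  by rewrite (_ : h1 = h0 + w2 * f2 / m); [in_subfield|rewrite /f2; field; rewrite mn0 w2_neq0].
have Ch2 : C h2.
  by rewrite (_ : h2 = h0 - w1 * f1 / m); [in_subfield|rewrite /f1; field; rewrite mn0 w1_neq0].
by [].
Qed.

Lemma width_moment_fixed : [/\ A4_fixed width, A4_fixed m & A4_fixed moment].
Proof.
have [[l1w0 l1w1 l1w2] [[l1h0 l1h1 l1h2] l1m]] := l1D.
have [[l2w0 l2w1 l2w2] [[l2h0 l2h1 l2h2] l2m]] := l2D.
have [[sgw0 sgw1 sgw2] [[sgh0 sgh1 sgh2] sgm]] := sgD.
split; first split.
- by rewrite rmorphB l1w0 l1w1.
- by rewrite rmorphB l2w0 l2w1.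
- by rewrite rmorphB sgw0 sgw1 w2E w1E; apply/eqP; rewrite -subr_eq0; apply/eqP;
   transitivity (- (3%:R * width)); [ring|rewrite three_eq0; ring].
- by split.
split; rewrite /moment; push_rmorph.
- by rewrite l1w0 l1w1 l1w2 l1h0 l1h1 l1h2 l1m.
- by rewrite l2w0 l2w1 l2w2 l2h0 l2h1 l2h2 l2m.
- by rewrite sgw0 sgw1 sgw2 sgh0 sgh1 sgh2 sgm; ring.
Qed.

Variable l4 : {rmorphism K -> K}.
Hypothesis l4D : [/\ l4 w0 = w1, l4 w1 = w0 & l4 w2 = w2] /\
  [/\ l4 h0 = h1, l4 h1 = h0 & l4 h2 = h2] /\ l4 m = m.

Lemma width_moment_l4 : l4 width = - width /\ l4 moment = - moment.
Proof.
have [[l4w0 l4w1 l4w2] [[l4h0 l4h1 l4h2] l4m]] := l4D.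
split; first by rewrite rmorphB l4w0 l4w1 opprB.
by rewrite /moment; push_rmorph; rewrite l4w0 l4w1 l4w2 l4h0 l4h1 l4h2 l4m; ring.
Qed.

Theorem invariants_33_6_char3 (F : K -> Prop) : subfield F ->
  (forall z, base z -> F z) -> (forall z, F z -> A4_fixed z /\ l4 z = z) ->
  F m -> F (moment / width) -> F (width ^+ 2) ->
  forall z, top z -> A4_fixed z -> l4 z = z -> F z.
Proof.
move=> fF bF Ffix Fm FS Fd z topz fz l4z.
have [l4d _] := width_moment_l4; have [fd _ _] := width_moment_fixed.
have fQ := quadratic_ext_subfield fF Fd; have Q := @quadratic_ext_base _ _ fF width.
have Qd := quadratic_ext_gen fF width.
apply: (quadratic_ext_fixed _ l4d width_neq0 two_neq0) l4z => [u /Ffix []//|].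
apply: (A4_invariants_char3 fQ) => //; first by move=> u /bF /Q.
- have fA := A4_fixed_subfield.
  by move=> _ [a [b [/Ffix [fa _] /Ffix [fb _] ->]]]; in_subfield.
- exact: Q.
- by rewrite -(divfK width_neq0 moment); apply: subfieldM => //; apply: Q.
Qed.

Lemma width_moment_generators_l4 :
  l4 (moment / width) = moment / width /\ l4 (width ^+ 2) = width ^+ 2.
Proof.
have [l4d l4S] := width_moment_l4.
by rewrite fmorph_div rmorphXn /= l4d l4S invrN mulrNN sqrrN.
Qed.

End Char3.
End Tower.

(** * Quaternion coordinates *)

Section Coordinates.
Variable K : fieldType.

Definition qnorm (x1 x2 x3 x4 : K) := x1 ^+ 2 + x2 ^+ 2 + x3 ^+ 2 + x4 ^+ 2.

(** For the quaternion q = x2 + x1 i + x3 j + x4 k of norm N, the pole_i and the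
    axis_i are the coordinates of q k q^-1 and of q (i + j + k) q^-1. *)
Definition pole0 (x1 x2 x3 x4 : K) := 2%:R * (x1 * x4 + x2 * x3) / qnorm x1 x2 x3 x4.
Definition pole1 (x1 x2 x3 x4 : K) := 2%:R * (x3 * x4 - x2 * x1) / qnorm x1 x2 x3 x4.
Definition pole2 (x1 x2 x3 x4 : K) :=
  (x2 ^+ 2 - x1 ^+ 2 - x3 ^+ 2 + x4 ^+ 2) / qnorm x1 x2 x3 x4.

Definition axis0 (x1 x2 x3 x4 : K) :=
  (x1 ^+ 2 + x2 ^+ 2 - x3 ^+ 2 - x4 ^+ 2 + 2%:R * (x1 * x3 - x2 * x4) + 2%:R * (x1 * x4 + x2 * x3))
  / qnorm x1 x2 x3 x4.
Definition axis1 (x1 x2 x3 x4 : K) :=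
  (2%:R * (x1 * x3 + x2 * x4) + (x2 ^+ 2 - x1 ^+ 2 + x3 ^+ 2 - x4 ^+ 2) + 2%:R * (x3 * x4 - x2 * x1))
  / qnorm x1 x2 x3 x4.
Definition axis2 (x1 x2 x3 x4 : K) :=
  (2%:R * (x1 * x4 - x2 * x3) + 2%:R * (x3 * x4 + x2 * x1) + (x2 ^+ 2 - x1 ^+ 2 - x3 ^+ 2 + x4 ^+ 2))
  / qnorm x1 x2 x3 x4.

Section Relations.
Variables x1 x2 x3 x4 : K.
Hypothesis two_neq0 : 2%:R != 0 :> K.
Hypothesis q0 : qnorm x1 x2 x3 x4 != 0.
Notation V0 := (axis0 x1 x2 x3 x4).
Notation V1 := (axis1 x1 x2 x3 x4).
Notation V2 := (axis2 x1 x2 x3 x4).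
Notation H0 := (pole0 x1 x2 x3 x4).
Notation H1 := (pole1 x1 x2 x3 x4).
Notation H2 := (pole2 x1 x2 x3 x4).

Ltac by_field := rewrite /axis0 /axis1 /axis2 /pole0 /pole1 /pole2;
  let h := fresh "h" in have h := q0; rewrite /qnorm in h *; field; rewrite ?two_neq0 ?h.

Lemma axis_sqr : V0 ^+ 2 + V1 ^+ 2 + V2 ^+ 2 = 3%:R.
Proof. by by_field. Qed.

Lemma axis_col : V0 * H0 + V1 * H1 + V2 * H2 = 1.
Proof. by by_field. Qed.

Lemma col_sqr : H0 ^+ 2 + H1 ^+ 2 + H2 ^+ 2 = 1.
Proof. by by_field. Qed.

(** The columns V, H and V x H are the images of (1, 1, 1), (0, 0, 1) and
    (1, -1, 0), a basis when 2 is invertible; hence they give the rotation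
    matrix r, and with it the products of x2 with the coordinates. *)
Let r00 := (V0 - H0 + (V1 * H2 - V2 * H1)) / 2%:R.
Let r01 := (V0 - H0 - (V1 * H2 - V2 * H1)) / 2%:R.
Let r10 := (V1 - H1 + (V2 * H0 - V0 * H2)) / 2%:R.
Let r11 := (V1 - H1 - (V2 * H0 - V0 * H2)) / 2%:R.
Let r20 := (V2 - H2 + (V0 * H1 - V1 * H0)) / 2%:R.
Let r21 := (V2 - H2 - (V0 * H1 - V1 * H0)) / 2%:R.

Lemma rotation_matrix :
  [/\ (1 + r00 + r11 + H2) * qnorm x1 x2 x3 x4 = 4%:R * x2 ^+ 2,
      (r21 - H1) * qnorm x1 x2 x3 x4 = 4%:R * x2 * x1,
      (H0 - r20) * qnorm x1 x2 x3 x4 = 4%:R * x2 * x3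
    & (r10 - r01) * qnorm x1 x2 x3 x4 = 4%:R * x2 * x4].
Proof. by rewrite /r00 /r01 /r10 /r11 /r20 /r21; split; by_field. Qed.

Lemma ratios_in_subfield (F : K -> Prop) : subfield F -> x2 != 0 ->
  [/\ F V0, F V1 & F V2] -> [/\ F H0, F H1 & F H2] ->
  [/\ F (x1 / x2), F (x3 / x2) & F (x4 / x2)].
Proof.
move=> fF x2_neq0 [FV0 FV1 FV2] [FH0 FH1 FH2].
have [e0 e1 e2 e3] := rotation_matrix.
have four0 : 4%:R != 0 :> K by rewrite (_ : 4%:R = 2%:R * 2%:R); [rewrite mulf_neq0|ring].
have t0 : 1 + r00 + r11 + H2 != 0.
  have : (1 + r00 + r11 + H2) * qnorm x1 x2 x3 x4 != 0 by rewrite e0 mulf_neq0 ?expf_neq0.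
  by rewrite mulf_eq0 negb_or => /andP [].
have quot r y : r * qnorm x1 x2 x3 x4 = 4%:R * x2 * y -> y / x2 = r / (1 + r00 + r11 + H2).
  move=> re; apply: (mulIf (mulf_neq0 t0 (mulf_neq0 q0 x2_neq0))).
  transitivity (y * ((1 + r00 + r11 + H2) * qnorm x1 x2 x3 x4)); first by field.
  rewrite e0; transitivity ((r * qnorm x1 x2 x3 x4) * x2); first by rewrite re; ring.
  by field.
by rewrite (quot _ _ e1) (quot _ _ e2) (quot _ _ e3) /r00 /r01 /r10 /r11 /r20 /r21; split; in_subfield.
Qed.

End Relations.

Section Actions.
Variables x1 x2 x3 x4 : K.
Hypothesis two_neq0 : 2%:R != 0 :> K.
Hypothesis q0 : qnorm x1 x2 x3 x4 != 0.
Notation V0 := (axis0 x1 x2 x3 x4).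
Notation V1 := (axis1 x1 x2 x3 x4).
Notation V2 := (axis2 x1 x2 x3 x4).
Notation H0 := (pole0 x1 x2 x3 x4).
Notation H1 := (pole1 x1 x2 x3 x4).
Notation H2 := (pole2 x1 x2 x3 x4).

Lemma lambda1_action : let f F := F x2 (- x1) (- x4) x3 : K in
  [/\ f axis0 = V0, f axis1 = - V1 & f axis2 = - V2] /\
  [/\ f pole0 = H0, f pole1 = - H1 & f pole2 = - H2].
Proof.
move=> f; rewrite /f /axis0 /axis1 /axis2 /pole0 /pole1 /pole2.
have -> : qnorm x2 (- x1) (- x4) x3 = qnorm x1 x2 x3 x4 by rewrite /qnorm; ring.
by split; split; ring.
Qed.

Lemma lambda2_action : let f F := F x3 x4 (- x1) (- x2) : K in
  [/\ f axis0 = - V0, f axis1 = - V1 & f axis2 = V2] /\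
  [/\ f pole0 = - H0, f pole1 = - H1 & f pole2 = H2].
Proof.
move=> f; rewrite /f /axis0 /axis1 /axis2 /pole0 /pole1 /pole2.
have -> : qnorm x3 x4 (- x1) (- x2) = qnorm x1 x2 x3 x4 by rewrite /qnorm; ring.
by split; split; ring.
Qed.

Lemma lambda4_action : let f F := F x1 x4 (- x3) x2 : K in
  [/\ f axis0 = - V1, f axis1 = - V0 & f axis2 = V2] /\
  [/\ f pole0 = - H1, f pole1 = - H0 & f pole2 = H2].
Proof.
move=> f; rewrite /f /axis0 /axis1 /axis2 /pole0 /pole1 /pole2.
have -> : qnorm x1 x4 (- x3) x2 = qnorm x1 x2 x3 x4 by rewrite /qnorm; ring.
by split; split; ring.
Qed.

Lemma sigma_action : let f F := F ((- x1 - x2 - x3 - x4) / 2%:R) ((x1 - x2 + x3 - x4) / 2%:R)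
    ((x1 - x2 - x3 + x4) / 2%:R) ((x1 + x2 - x3 - x4) / 2%:R) : K in
  [/\ f axis0 = V1, f axis1 = - V2 & f axis2 = - V0] /\
  [/\ f pole0 = H1, f pole1 = - H2 & f pole2 = - H0].
Proof.
move=> f; rewrite /f /axis0 /axis1 /axis2 /pole0 /pole1 /pole2.
set q := qnorm (_ / _) _ _ _; have -> : q = qnorm x1 x2 x3 x4 by rewrite /q /qnorm; field.
by split; split; field; rewrite ?two_neq0 ?q0.
Qed.

Lemma lambda3_action : let f F := F ((- x1 - x2 - x3 + x4) / 2%:R) ((x1 - x2 + x3 + x4) / 2%:R)
    ((x1 - x2 - x3 - x4) / 2%:R) ((- x1 - x2 + x3 - x4) / 2%:R) : K in
  [/\ f axis0 = V0, f axis1 = V1 & f axis2 = V2] /\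
  [/\ f pole0 = (V0 - H0 + (V1 * H2 - V2 * H1)) / 2%:R,
      f pole1 = (V1 - H1 + (V2 * H0 - V0 * H2)) / 2%:R
    & f pole2 = (V2 - H2 + (V0 * H1 - V1 * H0)) / 2%:R].
Proof.
move=> f; rewrite /f /axis0 /axis1 /axis2 /pole0 /pole1 /pole2.
set q := qnorm (_ / _) _ _ _; have -> : q = qnorm x1 x2 x3 x4 by rewrite /q /qnorm; field.
by split; split; have h := q0; rewrite /qnorm in h *; field; rewrite ?two_neq0 ?h.
Qed.

(** Right multiplication by i + j + k. *)
Lemma half_turn_action : 3%:R != 0 :> K ->
  let f F := F (x2 + x3 - x4) (- x1 - x3 - x4) (x2 - x1 + x4) (x2 + x1 - x3) : K in
  [/\ f axis0 = V0, f axis1 = V1 & f axis2 = V2] /\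
  [/\ f pole0 = 2%:R / 3%:R * V0 - H0, f pole1 = 2%:R / 3%:R * V1 - H1
    & f pole2 = 2%:R / 3%:R * V2 - H2].
Proof.
move=> three_neq0 f; rewrite /f /axis0 /axis1 /axis2 /pole0 /pole1 /pole2.
set q := qnorm (_ - _) _ _ _; have -> : q = 3%:R * qnorm x1 x2 x3 x4 by rewrite /q /qnorm; ring.
by split; split; field; rewrite ?three_neq0 ?q0.
Qed.

End Actions.

Section Morphism.
Variable g : {rmorphism K -> K}.

Lemma rmorph_qnorm x1 x2 x3 x4 :
  g (qnorm x1 x2 x3 x4) = qnorm (g x1) (g x2) (g x3) (g x4).
Proof. by rewrite /qnorm; push_rmorph. Qed.

Lemma rmorph_axis_col x1 x2 x3 x4 : let f F := F (g x1) (g x2) (g x3) (g x4) : K in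
  [/\ g (axis0 x1 x2 x3 x4) = f axis0, g (axis1 x1 x2 x3 x4) = f axis1
    & g (axis2 x1 x2 x3 x4) = f axis2] /\
  [/\ g (pole0 x1 x2 x3 x4) = f pole0, g (pole1 x1 x2 x3 x4) = f pole1
    & g (pole2 x1 x2 x3 x4) = f pole2].
Proof.
by move=> f; rewrite /f /axis0 /axis1 /axis2 /pole0 /pole1 /pole2 /qnorm; push_rmorph.
Qed.

End Morphism.
Lemma homogeneity c x1 x2 x3 x4 : c != 0 -> qnorm x1 x2 x3 x4 != 0 ->
  let f F := F (x1 / c) (x2 / c) (x3 / c) (x4 / c) : K in
  [/\ f axis0 = axis0 x1 x2 x3 x4, f axis1 = axis1 x1 x2 x3 x4 & f axis2 = axis2 x1 x2 x3 x4] /\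
  [/\ f pole0 = pole0 x1 x2 x3 x4, f pole1 = pole1 x1 x2 x3 x4 & f pole2 = pole2 x1 x2 x3 x4].
Proof.
move=> c0 q0 f; rewrite /f /axis0 /axis1 /axis2 /pole0 /pole1 /pole2.
have -> : qnorm (x1 / c) (x2 / c) (x3 / c) (x4 / c) = qnorm x1 x2 x3 x4 / c ^+ 2.
  by rewrite /qnorm; field.
by split; split; field; rewrite ?c0 ?q0.
Qed.

End Coordinates.

(** * Triangles from quaternions *)

Section Assembly.
Variables (k K : fieldType) (iota : {rmorphism k -> K}) (x : 'I_4 -> K).

Notation o1 := (ord0 : 'I_4).
Notation o2 := (lift ord0 ord0 : 'I_4).
Notation o3 := (lift ord0 (lift ord0 ord0) : 'I_4).
Notation o4 := (lift ord0 (lift ord0 (lift ord0 ord0)) : 'I_4).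
Notation x1 := (x o1).
Notation x2 := (x o2).
Notation x3 := (x o3).
Notation x4 := (x o4).

Definition acts (g : {rmorphism K -> K}) (A : 'M[k]_4) :=
  forall j, g (x j) = \sum_(i < 4) iota (A i j) * x i.

Ltac acts_tac ga := split; rewrite ga !big_ord_recl big_ord0 !mxE /= ?(rmorphM, fmorphV, rmorphN, rmorph0, rmorph1, rmorph_nat); field.

Hypothesis two_neq0 : 2%:R != 0 :> K.

Lemma acts_lambda1 g : acts g (lambda1 k) ->
  [/\ g x1 = x2, g x2 = - x1, g x3 = - x4 & g x4 = x3].
Proof. by move=> ga; acts_tac ga. Qed.

Lemma acts_lambda2 g : acts g (lambda2 k) ->
  [/\ g x1 = x3, g x2 = x4, g x3 = - x1 & g x4 = - x2].
Proof. by move=> ga; acts_tac ga. Qed.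

Lemma acts_lambda4 g : acts g (lambda4 k) ->
  [/\ g x1 = x1, g x2 = x4, g x3 = - x3 & g x4 = x2].
Proof. by move=> ga; acts_tac ga. Qed.

Lemma acts_sigma g : acts g (sigma k) ->
  [/\ g x1 = (- x1 - x2 - x3 - x4) / 2%:R, g x2 = (x1 - x2 + x3 - x4) / 2%:R,
      g x3 = (x1 - x2 - x3 + x4) / 2%:R & g x4 = (x1 + x2 - x3 - x4) / 2%:R].
Proof. by move=> ga; acts_tac ga. Qed.

Lemma acts_lambda3 g : acts g (lambda3 k) ->
  [/\ g x1 = (- x1 - x2 - x3 + x4) / 2%:R, g x2 = (x1 - x2 + x3 + x4) / 2%:R,
      g x3 = (x1 - x2 - x3 - x4) / 2%:R & g x4 = (- x1 - x2 + x3 - x4) / 2%:R].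
Proof. by move=> ga; acts_tac ga. Qed.

(** Right multiplication by the quaternion i + j + k, of norm 3. *)
Definition half_turn : 'M[k]_4 := mx4_of_rows
  [:: [:: 0; -1; -1;  1];
      [:: 1;  0;  1;  1];
      [:: 1; -1;  0; -1];
      [:: -1; -1; 1;  0] ].

Lemma acts_half_turn g : acts g half_turn ->
  [/\ g x1 = x2 + x3 - x4, g x2 = - x1 - x3 - x4, g x3 = x2 - x1 + x4 & g x4 = x2 + x1 - x3].
Proof. by move=> ga; acts_tac ga. Qed.

Notation V0 := (axis0 x1 x2 x3 x4).
Notation V1 := (axis1 x1 x2 x3 x4).
Notation V2 := (axis2 x1 x2 x3 x4).
Notation H0 := (pole0 x1 x2 x3 x4).
Notation H1 := (pole1 x1 x2 x3 x4).
Notation H2 := (pole2 x1 x2 x3 x4).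

Definition klein_w0 := V0 ^+ 2.
Definition klein_w1 := V1 ^+ 2.
Definition klein_w2 := V2 ^+ 2.
Definition klein_h0 := H0 / V0.
Definition klein_h1 := H1 / V1.
Definition klein_h2 := H2 / V2.
Definition klein_m := V0 * V1 * V2.

Notation w0 := klein_w0.
Notation w1 := klein_w1.
Notation w2 := klein_w2.
Notation h0 := klein_h0.
Notation h1 := klein_h1.
Notation h2 := klein_h2.
Notation m := klein_m.

Hypothesis q0 : qnorm x1 x2 x3 x4 != 0.
Hypothesis x2_neq0 : x2 != 0.
Hypothesis V1_neq0 : V1 != 0.
Hypothesis w01 : w0 != w1.

Variables (l1 l2 sg l3 l4 gr : {rmorphism K -> K}).
Hypotheses (l1A : acts l1 (lambda1 k)) (l2A : acts l2 (lambda2 k)) (sgA : acts sg (sigma k)).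
Hypotheses (l3A : acts l3 (lambda3 k)) (l4A : acts l4 (lambda4 k)) (grA : acts gr half_turn).

Ltac images H g action :=
  let e1 := fresh in let e2 := fresh in let e3 := fresh in let e4 := fresh in
  have [e1 e2 e3 e4] := H; have := rmorph_axis_col g x1 x2 x3 x4;
  rewrite /= e1 e2 e3 e4; have := action; move=> /= [[-> -> ->] [-> -> ->]].

Lemma l1_axes : [/\ l1 V0 = V0, l1 V1 = - V1 & l1 V2 = - V2] /\
  [/\ l1 H0 = H0, l1 H1 = - H1 & l1 H2 = - H2].
Proof. by images (acts_lambda1 l1A) l1 (lambda1_action x1 x2 x3 x4). Qed.

Lemma l2_axes : [/\ l2 V0 = - V0, l2 V1 = - V1 & l2 V2 = V2] /\
  [/\ l2 H0 = - H0, l2 H1 = - H1 & l2 H2 = H2].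
Proof. by images (acts_lambda2 l2A) l2 (lambda2_action x1 x2 x3 x4). Qed.

Lemma l4_axes : [/\ l4 V0 = - V1, l4 V1 = - V0 & l4 V2 = V2] /\
  [/\ l4 H0 = - H1, l4 H1 = - H0 & l4 H2 = H2].
Proof. by images (acts_lambda4 l4A) l4 (lambda4_action x1 x2 x3 x4). Qed.

Lemma sg_axes : [/\ sg V0 = V1, sg V1 = - V2 & sg V2 = - V0] /\
  [/\ sg H0 = H1, sg H1 = - H2 & sg H2 = - H0].
Proof. by images (acts_sigma sgA) sg (sigma_action two_neq0 q0). Qed.

Lemma l3_axes : [/\ l3 V0 = V0, l3 V1 = V1 & l3 V2 = V2] /\
  [/\ l3 H0 = (V0 - H0 + (V1 * H2 - V2 * H1)) / 2%:R,
      l3 H1 = (V1 - H1 + (V2 * H0 - V0 * H2)) / 2%:R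
    & l3 H2 = (V2 - H2 + (V0 * H1 - V1 * H0)) / 2%:R].
Proof. by images (acts_lambda3 l3A) l3 (lambda3_action two_neq0 q0). Qed.

Lemma gr_axes : 3%:R != 0 :> K -> [/\ gr V0 = V0, gr V1 = V1 & gr V2 = V2] /\
  [/\ gr H0 = 2%:R / 3%:R * V0 - H0, gr H1 = 2%:R / 3%:R * V1 - H1
    & gr H2 = 2%:R / 3%:R * V2 - H2].
Proof. by move=> three_neq0; images (acts_half_turn grA) gr (half_turn_action q0 three_neq0). Qed.

Lemma axes_neq0 : [/\ V0 != 0, V1 != 0 & V2 != 0].
Proof.
have [[_ s1 s2] _] := sg_axes.
have V2_neq0 : V2 != 0 by rewrite -oppr_eq0 -s1 fmorph_eq0.
by split=> //; rewrite -oppr_eq0 -s2 fmorph_eq0.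
Qed.

Ltac generalize_axes := move: V0 V1 V2 H0 H1 H2 => v0 v1 v2 t0 t1 t2.

Lemma l1_klein : [/\ l1 w0 = w0, l1 w1 = w1 & l1 w2 = w2] /\
  [/\ l1 h0 = h0, l1 h1 = h1 & l1 h2 = h2] /\ l1 m = m.
Proof.
move: l1_axes; rewrite /w0 /w1 /w2 /h0 /h1 /h2 /m; generalize_axes => -[[a0 a1 a2] [c0 c1 c2]].
rewrite !rmorphXn !fmorph_div !rmorphM /= a0 a1 a2 c0 c1 c2.
by rewrite !sqrrN !invrN !mulrNN mulrN mulrN mulNr opprK.
Qed.

Lemma l2_klein : [/\ l2 w0 = w0, l2 w1 = w1 & l2 w2 = w2] /\
  [/\ l2 h0 = h0, l2 h1 = h1 & l2 h2 = h2] /\ l2 m = m.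
Proof.
move: l2_axes; rewrite /w0 /w1 /w2 /h0 /h1 /h2 /m; generalize_axes => -[[a0 a1 a2] [c0 c1 c2]].
rewrite !rmorphXn !fmorph_div !rmorphM /= a0 a1 a2 c0 c1 c2.
by rewrite !sqrrN !invrN !mulrNN.
Qed.

Lemma sg_klein : [/\ sg w0 = w1, sg w1 = w2 & sg w2 = w0] /\
  [/\ sg h0 = h1, sg h1 = h2 & sg h2 = h0] /\ sg m = m.
Proof.
move: sg_axes; rewrite /w0 /w1 /w2 /h0 /h1 /h2 /m; generalize_axes => -[[a0 a1 a2] [c0 c1 c2]].
rewrite !rmorphXn !fmorph_div !rmorphM /= a0 a1 a2 c0 c1 c2.
by rewrite !sqrrN !invrN !mulrNN; split=> //; split=> //; ring.
Qed.

Lemma l4_klein : [/\ l4 w0 = w1, l4 w1 = w0 & l4 w2 = w2] /\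
  [/\ l4 h0 = h1, l4 h1 = h0 & l4 h2 = h2] /\ l4 m = m.
Proof.
move: l4_axes; rewrite /w0 /w1 /w2 /h0 /h1 /h2 /m; generalize_axes => -[[a0 a1 a2] [c0 c1 c2]].
rewrite !rmorphXn !fmorph_div !rmorphM /= a0 a1 a2 c0 c1 c2.
by rewrite !sqrrN !invrN !mulrNN [v1 * v0]mulrC.
Qed.

Lemma l3_klein : [/\ l3 w0 = w0, l3 w1 = w1 & l3 w2 = w2] /\
  [/\ l3 h0 = rotate_h m w0 h0 h1 h2, l3 h1 = rotate_h m w1 h1 h2 h0
    & l3 h2 = rotate_h m w2 h2 h0 h1] /\ l3 m = m.
Proof.
move: l3_axes axes_neq0; rewrite /w0 /w1 /w2 /h0 /h1 /h2 /m; generalize_axes => -[[a0 a1 a2] [c0 c1 c2]] [n0 n1 n2].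
rewrite !rmorphXn !fmorph_div !rmorphM /= a0 a1 a2 c0 c1 c2.
by split=> //; split=> //; rewrite /rotate_h; split; field; rewrite ?two_neq0 ?n0 ?n1 ?n2.
Qed.

Lemma gr_klein : 3%:R != 0 :> K -> [/\ gr w0 = w0, gr w1 = w1 & gr w2 = w2] /\
  [/\ gr h0 = 2%:R / 3%:R - h0, gr h1 = 2%:R / 3%:R - h1
    & gr h2 = 2%:R / 3%:R - h2] /\ gr m = m.
Proof.
move=> three_neq0.
move: (gr_axes three_neq0) axes_neq0; rewrite /w0 /w1 /w2 /h0 /h1 /h2 /m; generalize_axes => -[[a0 a1 a2] [c0 c1 c2]] [n0 n1 n2].
rewrite !rmorphXn !fmorph_div !rmorphM /= a0 a1 a2 c0 c1 c2.
by split=> //; split=> //; rewrite !mulrBl !mulfK.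
Qed.

Lemma klein_relations : [/\ w0 + w1 + w2 = 3%:R, w0 * h0 + w1 * h1 + w2 * h2 = 1,
  w0 * h0 ^+ 2 + w1 * h1 ^+ 2 + w2 * h2 ^+ 2 = 1 & w0 * w1 * w2 = m ^+ 2].
Proof.
have [n0 n1 n2] := axes_neq0.
have cE (v c : K) : v != 0 -> v ^+ 2 * (c / v) = v * c by move=> vn; field.
have cE2 (v c : K) : v != 0 -> v ^+ 2 * (c / v) ^+ 2 = c ^+ 2 by move=> vn; field.
rewrite /w0 /w1 /w2 /h0 /h1 /h2 /m !cE ?cE2 // axis_sqr // axis_col // col_sqr //.
by split=> //; ring.
Qed.

Lemma w_neq0 : [/\ w0 != 0, w1 != 0 & w2 != 0].
Proof. by have [? ? ?] := axes_neq0; rewrite /w0 /w1 /w2 !expf_neq0. Qed.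

Lemma w_distinct : [/\ w0 != w1, w1 != w2 & w2 != w0].
Proof.
have [[a0 a1 a2] _] := sg_klein.
have w12 : w1 != w2 by rewrite -[X in _ != X]a1 -[X in X != _]a0 (inj_eq (fmorph_inj _)).
by split=> //; rewrite -[X in _ != X]a2 -[X in X != _]a1 (inj_eq (fmorph_inj _)).
Qed.

Definition ratio_field (T : K -> Prop) : K -> Prop :=
  adjoin iota (fun z => T z \/ exists i j, z = x i / x j).

Definition constants_and (T : K -> Prop) : K -> Prop := fun z => T z \/ exists c, z = iota c.

Lemma ratio_field_least (T F : K -> Prop) : subfield F ->
  (forall z, constants_and T z -> F z) ->
  [/\ F w0, F w1 & F w2] -> [/\ F h0, F h1 & F h2] -> [/\ F m, F V0 & F V2] ->
  forall z, ratio_field T z -> F z.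
Proof.
move=> fF bF _ [Fh0 Fh1 Fh2] [Fm FV0 FV2]; have [n0 n1 n2] := axes_neq0.
have FV1 : F V1 by rewrite (_ : V1 = m / (V0 * V2)); [in_subfield|rewrite /m; field; rewrite ?n0 ?n2].
have FH : [/\ F H0, F H1 & F H2].
  by split; [rewrite -(divfK n0 H0)|rewrite -(divfK n1 H1)|rewrite -(divfK n2 H2)]; apply: subfieldM.
have FV : [/\ F V0, F V1 & F V2] by [].
have [F1 F3 F4] := ratios_in_subfield two_neq0 q0 fF x2_neq0 FV FH.
have Fx i : F (x i / x2).
  have [j ->|->] := unliftP ord0 i; last exact: F1.
  have [l ->|->] := unliftP ord0 j; last by rewrite divff //; apply: subfield1.
  have [p ->|->] := unliftP ord0 l; last exact: F3.
  by rewrite (ord1 p).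
apply: adjoin_least => // [c|z [Tz|[i [j ->]]]].
- by apply: bF; right; exists c.
- by apply: bF; left.
- rewrite (_ : x i / x j = (x i / x2) / (x j / x2)); last by rewrite invf_div mulrA divfK.
  by apply: subfieldM => //; apply: subfieldV.
Qed.

Lemma axes_ratio T : let R := ratio_field T in
  [/\ R V0, R V1 & R V2] /\ [/\ R H0, R H1 & R H2].
Proof.
move=> R; have fR : subfield R := adjoin_subfield iota _.
have Rx i : R (x i / x2) by apply: adjoin_mem; right; exists i, o2.
have [R1 R2 R3 R4] : [/\ R (x1 / x2), R (x2 / x2), R (x3 / x2) & R (x4 / x2)] by [].
have [[<- <- <-] [<- <- <-]] := homogeneity x2_neq0 q0.
rewrite /axis0 /axis1 /axis2 /pole0 /pole1 /pole2 /qnorm.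
by split; split; in_subfield.
Qed.

Lemma klein_ratio T : let R := ratio_field T in
  [/\ R w0, R w1 & R w2] /\ [/\ R h0, R h1 & R h2] /\ R m.
Proof.
move=> R; have fR : subfield R := adjoin_subfield iota _.
have [[RV0 RV1 RV2] [RH0 RH1 RH2]] := axes_ratio T.
rewrite /w0 /w1 /w2 /h0 /h1 /h2 /m.
by split; [split|split; [split|]]; in_subfield.
Qed.

Lemma klein_triangle : triangle w0 w1 w2 h0 h1 h2 m.
Proof. by have [sw swh swhh pw] := klein_relations; split=> //; [apply: w_neq0|apply: w_distinct]. Qed.

(** The set T serves to treat both fixed fields at once: it is empty for the
    functions of degree zero and consists of the norm of q for all functions. *)
Definition generating_triple (fixed : K -> Prop) := exists y : 'I_3 -> K,
  [/\ forall i, ratio_field (fun=> False) (y i), forall i, fixed (y i)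
    & forall T, (forall z, T z -> fixed z) -> forall f, ratio_field T f -> fixed f ->
      adjoin iota (fun z => T z \/ exists i, z = y i) f].

Lemma generating_tripleI (fixed : K -> Prop) (a b c : K) : subfield fixed ->
  (forall u, fixed (iota u)) ->
  [/\ ratio_field (fun=> False) a, ratio_field (fun=> False) b & ratio_field (fun=> False) c] ->
  [/\ fixed a, fixed b & fixed c] ->
  (forall T F, subfield F -> (forall z, constants_and T z -> F z) ->
     (forall z, F z -> fixed z) -> F a -> F b -> F c ->
     forall z, ratio_field T z -> fixed z -> F z) ->
  generating_triple fixed.
Proof.
move=> fF kF [Ra Rb Rc] [Fa Fb Fc] gen_abc.
pose y (i : 'I_3) := nth 0 [:: a; b; c] i.
have Py (P : K -> Prop) : P a -> P b -> P c -> forall i, P (y i).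
  by move=> Pa Pb Pc [[|[|[|//]]] ilt].
exists y; split; [exact: Py|exact: Py|] => T TF.
set F := adjoin iota _.
have yF i : F (y i) by apply: adjoin_mem; right; exists i.
apply: (gen_abc T F); first exact: adjoin_subfield.
- by move=> z [Tz|[u ->]]; [apply: adjoin_mem; left|apply: adjoin_base].
- by apply: adjoin_least => // z [/TF|[i ->]]; last exact: Py.
- exact: (yF ord0).
- exact: (yF (@Ordinal 3 1 isT)).
- exact: (yF (@Ordinal 3 2 isT)).
Qed.

Hypotheses (l1k : forall c, l1 (iota c) = iota c) (l2k : forall c, l2 (iota c) = iota c)
  (sgk : forall c, sg (iota c) = iota c) (l3k : forall c, l3 (iota c) = iota c)
  (l4k : forall c, l4 (iota c) = iota c).

Notation A4_fix := (A4_fixed l1 l2 sg).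
Let tri := klein_triangle.

Let l1V0 : l1 V0 = V0. Proof. by case: l1_axes => [[]]. Qed.
Let l2V0 : l2 V0 = - V0. Proof. by case: l2_axes => [[]]. Qed.
Let l1V2 : l1 V2 = - V2. Proof. by case: l1_axes => [[]]. Qed.

Let A4_fix_subfield : subfield A4_fix := A4_fixed_subfield l1 l2 sg.
Let A4_fix_iota u : A4_fix (iota u). Proof. by split. Qed.

Let fixed_meet_subfield (g : {rmorphism K -> K}) (P : K -> Prop) :
  subfield P -> subfield (fun z => P z /\ g z = z).
Proof.
move=> fP; have fg := fixed_by_subfield g.
split=> [|u v [Pu gu] [Pv gv]|u v [Pu gu] [Pv gv]|u [Pu gu]].
- by split; [apply: subfield1|apply: (subfield1 fg)].
- by split; [apply: subfieldB|apply: (subfieldB fg)].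
- by split; [apply: subfieldM|apply: (subfieldM fg)].
- by split; [apply: subfieldV|apply: (subfieldV fg)].
Qed.

(** Cleared of denominators, the conditions are polynomial in the w_i and m, so
    that they can be checked where some w_i vanishes. *)
Lemma general_positionI : let e2 := w0 * w1 + w1 * w2 + w2 * w0 in
  3%:R != 0 :> K -> e2 - 3%:R * m ^+ 2 != 0 -> e2 ^+ 2 - 9%:R * m ^+ 2 != 0 -> 3%:R - e2 != 0 ->
  general_position w0 w1 w2 m.
Proof.
move=> e2 three_neq0 D0 n0 z0; have [w0n w1n w2n] := w_neq0.
have m0 : m != 0 := m_neq0 tri.
have uE : sum_u w0 w1 w2 m = e2 / m.
  have [_ _ _ pw] := klein_relations.
  transitivity (m * e2 / (w0 * w1 * w2)); last by rewrite pw; field.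
  by rewrite /sum_u /e2; field; rewrite w0n w1n w2n.
have D_neq0 : den_D w0 w1 w2 m != 0.
  rewrite /den_D uE (_ : _ - _ = (e2 - 3%:R * m ^+ 2) / m); last by field.
  by rewrite mulf_neq0 ?invr_neq0.
split=> //.
  rewrite /den_n uE (_ : _ - _ = (e2 ^+ 2 - 9%:R * m ^+ 2) / m ^+ 2); last by field.
  by rewrite mulf_neq0 ?invr_neq0 ?expf_neq0.
rewrite /quad_zeta uE divfK // !mulf_neq0 ?invr_neq0 //.
Qed.

Lemma qnorm_fixed : let N := qnorm x1 x2 x3 x4 in
  [/\ l1 N = N, l2 N = N, sg N = N, l3 N = N & l4 N = N].
Proof.
move=> N; rewrite /N !rmorph_qnorm.
have [-> -> -> ->] := acts_lambda1 l1A; have [-> -> -> ->] := acts_lambda2 l2A.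
have [-> -> -> ->] := acts_sigma sgA; have [-> -> -> ->] := acts_lambda3 l3A.
have [-> -> -> ->] := acts_lambda4 l4A.
by rewrite /qnorm; split; field.
Qed.

(** The ratios x_i / x_j together with N = |q|^2 generate x2^2, so that all of
    k(x_1, ..., x_4) arises from them by the square root x2, whose sign is
    changed by lambda1^2 = -1. *)
Lemma even_functions f : adjoin iota (fun z => exists i, z = x i) f -> l1 f = f ->
  ratio_field (fun z => z = qnorm x1 x2 x3 x4) f.
Proof.
move=> xf l1f; set F := ratio_field _; have fF : subfield F := adjoin_subfield iota _.
have [e1 e2 e3 e4] := acts_lambda1 l1A.
have l1l1 i : l1 (l1 (x i)) = - x i.
  have [j ->|->] := unliftP ord0 i; last by rewrite e1 e2.
  have [l ->|->] := unliftP ord0 j; last by rewrite e2 rmorphN e1.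
  have [p ->|->] := unliftP ord0 l; last by rewrite e3 rmorphN e4.
  by rewrite (ord1 p) e4 e3.
pose g : {rmorphism K -> K} := l1 \o l1.
have gF u : F u -> g u = u.
  apply: adjoin_fixed => [c|z [->|[i [j ->]]]] /=; first by rewrite /g /= !l1k.
    by have [l1N _ _ _ _] := qnorm_fixed; rewrite !l1N.
  by rewrite !fmorph_div /= !l1l1 invrN mulrNN.
have Fx i : F (x i / x2) by apply: adjoin_mem; right; exists i, o2.
have F2 : F (x2 ^+ 2).
  have FN : F (qnorm x1 x2 x3 x4) by apply: adjoin_mem; left.
  have F1 := Fx o1; have F3 := Fx o3; have F4 := Fx o4.
  rewrite (_ : x2 ^+ 2 = qnorm x1 x2 x3 x4 / ((x1 / x2) ^+ 2 + 1 + (x3 / x2) ^+ 2 + (x4 / x2) ^+ 2)).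
    by in_subfield.
  have E : (x1 / x2) ^+ 2 + 1 + (x3 / x2) ^+ 2 + (x4 / x2) ^+ 2 = qnorm x1 x2 x3 x4 / x2 ^+ 2.
    by rewrite /qnorm; field.
  by rewrite E invf_div mulrCA divff // mulr1.
have fQ := quadratic_ext_subfield fF F2.
apply: (quadratic_ext_fixed gF _ x2_neq0 two_neq0); first exact: l1l1.
  apply: adjoin_least xf => // [c|_ [i ->]].
    by apply: quadratic_ext_base => //; apply: adjoin_base.
  rewrite -(divfK x2_neq0 (x i)); apply: subfieldM => //; last exact: quadratic_ext_gen.
  exact: quadratic_ext_base.
by rewrite /g /= !l1f.
Qed.

Section GeneralCharacteristic.
Hypothesis gen : general_position w0 w1 w2 m.

Let grD := gr_klein (general_position_three gen).

Notation A := (quad_alpha w0 w1 w2 h0 h1 h2 m).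
Notation B := (quad_beta w0 w1 w2 h0 h1 h2 m).
Notation Z := (quad_zeta w0 w1 w2 m).
Notation P := (quad_pi w0 w1 w2 m).
Notation A' := (cube_alpha A B).
Notation B' := (cube_beta A B).

Let quad_ratio : let R := ratio_field (fun=> False) in
  [/\ R A, R B, R Z & R P] /\ (R A' /\ R B').
Proof.
move=> R; have fR : subfield R := adjoin_subfield iota _.
have [[Rw0 Rw1 Rw2] [[Rh0 Rh1 Rh2] Rm]] := klein_ratio (fun=> False).
have RA : R A by rewrite /quad_alpha /trace_A /den_n /den_D /sum_u /sum_f /sum_g /delta_u; in_subfield.
have RB : R B by rewrite /quad_beta /trace_A /den_n /den_D /sum_u /sum_f /sum_g /delta_u; in_subfield.
have RZ : R Z by rewrite /quad_zeta /den_D /sum_u; in_subfield.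
have RP : R P by rewrite /quad_pi /den_D /sum_u /delta_u; in_subfield.
split; first by [].
by split; [rewrite /cube_alpha|rewrite /cube_beta]; in_subfield.
Qed.

Theorem generating_triple_33_3 : generating_triple A4_fix.
Proof.
have [[RA RB RZ RP] _] := quad_ratio; have fR := adjoin_subfield iota.
have [fa fp fs _] := generators_fixed l1_klein l2_klein sg_klein.
apply: (generating_tripleI A4_fix_subfield A4_fix_iota
  (a := A / (B - 2%:R)) (b := P / (B - 2%:R)) (c := slope B Z)) => [| |T F].
- by split; rewrite /slope; have := fR (fun z => False \/ exists i j, z = x i / x j) => fR0; in_subfield.
- by [].
move=> fF bF Ffix Fa Fb Fc.
exact: (invariants_33_3 tri erefl erefl (@ratio_field_least T) l1V0 l2V0 l1V2
  l1_klein l2_klein sg_klein gen l3_klein grD fF bF Ffix Fa Fb Fc).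
Qed.

Theorem generating_triple_33_6 : generating_triple (fun z => A4_fix z /\ l4 z = z).
Proof.
have [[RA RB RZ RP] _] := quad_ratio; have fR := adjoin_subfield iota.
have [fa fp fs fq] := generators_fixed l1_klein l2_klein sg_klein.
have [ls lq lp] := generators_l4 l4_klein.
apply: (generating_tripleI (fixed_meet_subfield l4 A4_fix_subfield) _
  (a := A / P) (b := (P / (B - 2%:R)) ^+ 2) (c := slope B Z)) => [//| | |T F].
- by split; rewrite /slope; have := fR (fun z => False \/ exists i j, z = x i / x j) => fR0; in_subfield.
- by split; split=> //; apply: subfieldX.
move=> fF bF Ffix Fa Fb Fc z topz [fz l4z].
exact: (invariants_33_6 tri erefl erefl (@ratio_field_least T) l1V0 l2V0 l1V2
  l1_klein l2_klein sg_klein gen l3_klein grD l4_klein fF bF Ffix Fa Fb Fc topz fz l4z).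
Qed.

Theorem generating_triple_33_7 : generating_triple (fun z => A4_fix z /\ l3 z = z).
Proof.
have [[RA RB RZ RP] [RA' RB']] := quad_ratio; have fR := adjoin_subfield iota.
have [[fa fp fs _] [[la lp ls _] _]] := cube_generators_fixed tri l1_klein l2_klein sg_klein gen l3_klein l4_klein.
apply: (generating_tripleI (fixed_meet_subfield l3 A4_fix_subfield) _
  (a := A' / (B' - 2%:R)) (b := P / (B' - 2%:R)) (c := slope B' Z)) => [//| | |T F].
- by split; rewrite /slope; have := fR (fun z => False \/ exists i j, z = x i / x j) => fR0; in_subfield.
- by [].
move=> fF bF Ffix Fa Fb Fc z topz [fz l3z].
exact: (invariants_33_7 tri erefl erefl (@ratio_field_least T) l1V0 l2V0 l1V2
  l1_klein l2_klein sg_klein gen l3_klein grD fF bF Ffix Fa Fb Fc topz fz l3z).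
Qed.

Theorem generating_triple_33_11 : generating_triple (fun z => [/\ A4_fix z, l3 z = z & l4 z = z]).
Proof.
have [[RA RB RZ RP] [RA' RB']] := quad_ratio; have fR := adjoin_subfield iota.
have [[fa fp fs fq] [[la lp ls lq] [ms mq mp]]] :=
  cube_generators_fixed tri l1_klein l2_klein sg_klein gen l3_klein l4_klein.
have f3 := fixed_by_subfield l3; have f4 := fixed_by_subfield l4.
have ffix : subfield (fun z => [/\ A4_fix z, l3 z = z & l4 z = z]).
  split=> [|u v [Pu gu ku] [Pv gv kv]|u v [Pu gu ku] [Pv gv kv]|u [Pu gu ku]].
  - by split; [apply: subfield1|apply: (subfield1 f3)|apply: (subfield1 f4)].
  - by split; [apply: subfieldB|apply: (subfieldB f3)|apply: (subfieldB f4)].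
  - by split; [apply: subfieldM|apply: (subfieldM f3)|apply: (subfieldM f4)].
  - by split; [apply: subfieldV|apply: (subfieldV f3)|apply: (subfieldV f4)].
apply: (generating_tripleI ffix _
  (a := A' / P) (b := (P / (B' - 2%:R)) ^+ 2) (c := slope B' Z)) => [//| | |T F].
- by split; rewrite /slope; have := fR (fun z => False \/ exists i j, z = x i / x j) => fR0; in_subfield.
- by split; split=> //; [apply: subfieldX|apply: (subfieldX f3 2 lp)].
move=> fF bF Ffix Fa Fb Fc z topz [fz l3z l4z].
exact: (invariants_33_11 tri erefl erefl (@ratio_field_least T) l1V0 l2V0 l1V2
  l1_klein l2_klein sg_klein gen l3_klein grD l4_klein fF bF Ffix Fa Fb Fc topz fz l3z l4z).
Qed.

End GeneralCharacteristic.

Section CharacteristicThree.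
Hypothesis three_eq0 : 3%:R = 0 :> K.

Notation d := (width w0 w1).
Notation S := (moment w0 w1 w2 h0 h1 h2 m).

Let moment_ratio : let R := ratio_field (fun=> False) in [/\ R d, R m & R S].
Proof.
move=> R; have fR : subfield R := adjoin_subfield iota _.
have [[Rw0 Rw1 Rw2] [[Rh0 Rh1 Rh2] Rm]] := klein_ratio (fun=> False).
by split=> //; [rewrite /width|rewrite /moment]; in_subfield.
Qed.

Theorem generating_triple_33_3_char3 : generating_triple A4_fix.
Proof.
have fix3 := width_moment_fixed tri l1_klein l2_klein sg_klein three_eq0.
apply: (generating_tripleI A4_fix_subfield A4_fix_iota moment_ratio fix3) => T F fF bF Ffix Fa Fb Fc.
exact: (A4_invariants_char3 tri erefl erefl (@ratio_field_least T) l1V0 l2V0 l1V2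
  l1_klein l2_klein sg_klein three_eq0 fF bF Ffix Fa Fb Fc).
Qed.

Theorem generating_triple_33_6_char3 : generating_triple (fun z => A4_fix z /\ l4 z = z).
Proof.
have [fd fm fS] := width_moment_fixed tri l1_klein l2_klein sg_klein three_eq0.
have [lS ld] := width_moment_generators_l4 l4_klein.
have [Rd Rm RS] := moment_ratio; have fR := adjoin_subfield iota.
apply: (generating_tripleI (fixed_meet_subfield l4 A4_fix_subfield) _
  (a := m) (b := S / d) (c := d ^+ 2)) => [//| | |T F].
- by split; have := fR (fun z => False \/ exists i j, z = x i / x j) => fR0; in_subfield.
- have fA := A4_fix_subfield; have [_ [_ lm]] := l4_klein.
  by split; split=> //; in_subfield.
move=> fF bF Ffix Fa Fb Fc z topz [fz l4z].
exact: (invariants_33_6_char3 tri erefl erefl (@ratio_field_least T) l1V0 l2V0 l1V2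
  l1_klein l2_klein sg_klein three_eq0 l4_klein fF bF Ffix Fa Fb Fc topz fz l4z).
Qed.

End CharacteristicThree.

End Assembly.

(** * Specialization and rationality *)

Section Specialization.
Variables (k : fieldType) (n : nat) (pt : 'I_n -> k).
Implicit Types (f g : ratfun k n) (c d : k).

Definition value_at f c : Prop := exists p q : {mpoly k[n]},
  [/\ meval pt q != 0, f = tofrac p / tofrac q & c = meval pt p / meval pt q].

Lemma value_neq0 f c : value_at f c -> c != 0 -> f != 0.
Proof.
move=> [p [q [q0 -> ->]]]; rewrite !mulf_eq0 !negb_or !invr_eq0 !tofrac_eq0 => /andP [p0 _].
by rewrite (contraNneq _ p0) ?(contraNneq _ q0) // => ->; rewrite meval0.
Qed.

Let tofrac_neq0 (q : {mpoly k[n]}) : meval pt q != 0 -> tofrac q != 0 :> ratfun k n.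
Proof. by rewrite tofrac_eq0; apply: contraNneq => ->; rewrite meval0. Qed.

Lemma value_var i : value_at (ratvar k i) (pt i).
Proof. by exists 'X_i, 1; rewrite meval1 mevalXU tofrac1 !divr1 oner_neq0. Qed.

Lemma value_add f g c d : value_at f c -> value_at g d -> value_at (f + g) (c + d).
Proof.
move=> [p [q [q0 -> ->]]] [r [s [s0 -> ->]]].
exists (p * s + r * q), (q * s); rewrite addf_div ?tofrac_neq0 // addf_div //.
by rewrite tofracD !tofracM mevalD !mevalM mulf_neq0.
Qed.

Lemma value_opp f c : value_at f c -> value_at (- f) (- c).
Proof.
by move=> [p [q [q0 -> ->]]]; exists (- p), q; rewrite q0 tofracN mevalN !mulNr.
Qed.

Lemma value_mul f g c d : value_at f c -> value_at g d -> value_at (f * g) (c * d).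
Proof.
move=> [p [q [q0 -> ->]]] [r [s [s0 -> ->]]].
exists (p * r), (q * s); rewrite !mulf_div.
by rewrite !tofracM !mevalM mulf_neq0.
Qed.

Lemma value_inv f c : value_at f c -> c != 0 -> value_at f^-1 c^-1.
Proof.
move=> [p [q [q0 -> ->]]]; rewrite mulf_eq0 negb_or => /andP [p0 _].
by exists q, p; rewrite p0 !invf_div.
Qed.

Lemma value_natmul f c m : value_at f c -> value_at (f *+ m) (c *+ m).
Proof.
move=> fc; elim: m => [|m IHm]; last by rewrite !mulrS; apply: value_add.
by exists 0, 1; rewrite meval1 meval0 tofrac0 !mul0r oner_neq0.
Qed.

Lemma value_one : value_at 1 1.
Proof. by exists 1, 1; rewrite meval1 tofrac1 !divr1 oner_neq0. Qed.

Lemma value_exp f c m : value_at f c -> value_at (f ^+ m) (c ^+ m).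
Proof.
move=> fc; elim: m => [|m IHm]; first exact: value_one.
by rewrite !exprS; apply: value_mul.
Qed.

End Specialization.

Ltac value_tac := repeat first [assumption | exact: value_one | exact: value_var
  | apply: value_add | apply: value_opp | apply: value_mul | apply: value_natmul | apply: value_exp].

Section AxisValues.
Variables (k : fieldType) (pt : 'I_4 -> k).
Notation o1 := (ord0 : 'I_4).
Notation o2 := (lift ord0 ord0 : 'I_4).
Notation o3 := (lift ord0 (lift ord0 ord0) : 'I_4).
Notation o4 := (lift ord0 (lift ord0 (lift ord0 ord0)) : 'I_4).
Let at_var {T} (f : ratfun k 4 -> ratfun k 4 -> ratfun k 4 -> ratfun k 4 -> T) :=
  f (ratvar k o1) (ratvar k o2) (ratvar k o3) (ratvar k o4).
Let at_pt {T} (f : k -> k -> k -> k -> T) := f (pt o1) (pt o2) (pt o3) (pt o4).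

Lemma value_qnorm : value_at pt (at_var (@qnorm _)) (at_pt (@qnorm _)).
Proof. by rewrite /at_var /at_pt /qnorm; value_tac. Qed.

Lemma value_axes : at_pt (@qnorm _) != 0 ->
  [/\ value_at pt (at_var (@axis0 _)) (at_pt (@axis0 _)),
      value_at pt (at_var (@axis1 _)) (at_pt (@axis1 _))
    & value_at pt (at_var (@axis2 _)) (at_pt (@axis2 _))].
Proof.
move=> q0; have vq := value_inv value_qnorm q0; rewrite /at_var /at_pt in vq *.
by rewrite /axis0 /axis1 /axis2; split; value_tac.
Qed.

End AxisValues.

Section NonVanishing.
Variable k : fieldType.
Hypothesis two_neq0 : 2%:R != 0 :> k.
Notation x := (ratvar k (n := 4)).
Notation o1 := (ord0 : 'I_4).
Notation o2 := (lift ord0 ord0 : 'I_4).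
Notation o3 := (lift ord0 (lift ord0 ord0) : 'I_4).
Notation o4 := (lift ord0 (lift ord0 (lift ord0 ord0)) : 'I_4).

Definition point (a b c d : k) (i : 'I_4) : k := nth 0 [:: a; b; c; d] i.

Lemma generic_qnorm_neq0 : qnorm (x o1) (x o2) (x o3) (x o4) != 0.
Proof.
apply: (value_neq0 (value_qnorm (point 0 1 0 0))); rewrite /qnorm /point /=.
by rewrite !expr0n expr1n add0r !addr0 oner_neq0.
Qed.

Lemma generic_axis1_neq0 : axis1 (x o1) (x o2) (x o3) (x o4) != 0.
Proof.
have q1 : qnorm (0 : k) 1 0 0 = 1 by rewrite /qnorm; ring.
have [|_ v1 _] := @value_axes k (point 0 1 0 0); first by rewrite /point /= q1 oner_neq0.
apply: (value_neq0 v1); rewrite /point /=.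
have -> : axis1 0 1 0 0 = 1 :> k by rewrite /axis1 q1; field; rewrite oner_neq0.
exact: oner_neq0.
Qed.

Lemma generic_w_distinct : klein_w0 x != klein_w1 x.
Proof.
rewrite /klein_w0 /klein_w1 -subr_eq0 subr_sqr.
have q1 : qnorm (0 : k) 1 0 0 = 1 by rewrite /qnorm; ring.
have q2 : qnorm (1 : k) 0 0 0 = 1 by rewrite /qnorm; ring.
apply: mulf_neq0.
  have [|v0 v1 _] := @value_axes k (point 1 0 0 0); first by rewrite /point /= q2 oner_neq0.
  apply: (value_neq0 (value_add v0 (value_opp v1))); rewrite /point /=.
  have -> : axis0 1 0 0 0 = 1 :> k by rewrite /axis0 q2; field; rewrite oner_neq0.
  have -> : axis1 1 0 0 0 = - 1 :> k by rewrite /axis1 q2; field; rewrite oner_neq0.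
  by rewrite opprK.
have [|v0 v1 _] := @value_axes k (point 0 1 0 0); first by rewrite /point /= q1 oner_neq0.
apply: (value_neq0 (value_add v0 v1)); rewrite /point /=.
have -> : axis0 0 1 0 0 = 1 :> k by rewrite /axis0 q1; field; rewrite oner_neq0.
have -> : axis1 0 1 0 0 = 1 :> k by rewrite /axis1 q1; field; rewrite oner_neq0.
by [].
Qed.

(** At the quaternion 1 + i + j the w_i are 25/9, 1/9, 1/9, and the three
    expressions are 128/243, 64/729 and 64/27, whose numerators and denominators
    are powers of 2 and 3. *)
Lemma generic_symmetric_functions : 3%:R != 0 :> k ->
  let e2 := klein_w0 x * klein_w1 x + klein_w1 x * klein_w2 x + klein_w2 x * klein_w0 x in
  [/\ e2 - 3%:R * klein_m x ^+ 2 != 0, e2 ^+ 2 - 9%:R * klein_m x ^+ 2 != 0 & 3%:R - e2 != 0].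
Proof.
move=> three_neq0; rewrite /klein_w0 /klein_w1 /klein_w2 /klein_m.
have n27 : 27%:R != 0 :> k by rewrite (natrX k 3 3) expf_neq0.
have n243 : 243%:R != 0 :> k by rewrite (natrX k 3 5) expf_neq0.
have n729 : 729%:R != 0 :> k by rewrite (natrX k 3 6) expf_neq0.
have q3 : qnorm (1 : k) 1 1 0 = 3%:R by rewrite /qnorm; ring.
have [|] := @value_axes k (point 1 1 1 0); first by rewrite /point /= q3.
rewrite /point /=.
have -> : axis0 1 1 1 0 = 5%:R / 3%:R :> k by rewrite /axis0 q3; field.
have -> : axis1 1 1 1 0 = 1 / 3%:R :> k by rewrite /axis1 q3; field.
have -> : axis2 1 1 1 0 = - (1 / 3%:R) :> k by rewrite /axis2 q3; field.
move: (axis0 _ _ _ _) (axis1 _ _ _ _) (axis2 _ _ _ _) => a0 a1 a2 v0 v1 v2.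
pose c0 : k := 5%:R / 3%:R; pose c1 : k := 1 / 3%:R; pose c2 : k := - (1 / 3%:R).
pose d2 := c0 ^+ 2 * c1 ^+ 2 + c1 ^+ 2 * c2 ^+ 2 + c2 ^+ 2 * c0 ^+ 2.
split.
- apply: (@value_neq0 _ _ (point 1 1 1 0) _ (d2 - 3%:R * (c0 * c1 * c2) ^+ 2)); first by rewrite /d2; value_tac.
  rewrite /d2 /c0 /c1 /c2 [X in X != 0](_ : _ = 2%:R ^+ 7 / 3%:R ^+ 5); last by field; rewrite ?three_neq0 ?n27 ?n243 ?n729.
  by rewrite mulf_neq0 ?invr_neq0 ?expf_neq0.
- apply: (@value_neq0 _ _ (point 1 1 1 0) _ (d2 ^+ 2 - 9%:R * (c0 * c1 * c2) ^+ 2)); first by rewrite /d2; value_tac.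
  rewrite /d2 /c0 /c1 /c2 [X in X != 0](_ : _ = 2%:R ^+ 6 / 3%:R ^+ 6); last by field; rewrite ?three_neq0 ?n27 ?n243 ?n729.
  by rewrite mulf_neq0 ?invr_neq0 ?expf_neq0.
- apply: (@value_neq0 _ _ (point 1 1 1 0) _ (3%:R - d2)); first by rewrite /d2; value_tac.
  rewrite /d2 /c0 /c1 /c2 [X in X != 0](_ : _ = 2%:R ^+ 6 / 3%:R ^+ 3); last by field; rewrite ?three_neq0 ?n27 ?n243 ?n729.
  by rewrite mulf_neq0 ?invr_neq0 ?expf_neq0.
Qed.

Lemma ratfun_natr_neq0 p : p%:R != 0 :> k -> p%:R != 0 :> ratfun k 4.
Proof. by move=> p0; rewrite -(rmorph_nat (ratfunC k 4)) fmorph_eq0. Qed.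

End NonVanishing.

Section GroupMatrices.
Variable k : fieldType.
Hypothesis two_neq0 : 2%:R != 0 :> k.
Implicit Types A B P : 'M[k]_4.

Ltac entries := apply/matrixP => -[[|[|[|[|//]]]] ?] [[|[|[|[|//]]]] ?];
  rewrite !mxE ?big_ord_recl ?big_ord0 ?mxE /=.

Lemma orthogonal_unit A c : c != 0 -> A *m A^T = c%:M -> A \in unitmx.
Proof.
move=> c0 AAT; have : A *m (c^-1 *: A^T) = 1%:M by rewrite -scalemxAr AAT scale_scalar_mx mulVf.
by move/mulmx1_unit => [].
Qed.

Lemma lambda1_unit : lambda1 k \in unitmx.
Proof. by apply: (orthogonal_unit (oner_neq0 _)); entries; ring. Qed.

Lemma lambda2_unit : lambda2 k \in unitmx.
Proof. by apply: (orthogonal_unit (oner_neq0 _)); entries; ring. Qed.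

Lemma lambda4_unit : lambda4 k \in unitmx.
Proof. by apply: (orthogonal_unit (oner_neq0 _)); entries; ring. Qed.

Lemma sigma_unit : sigma k \in unitmx.
Proof. by apply: (orthogonal_unit (oner_neq0 _)); entries; field. Qed.

Lemma lambda3_unit : lambda3 k \in unitmx.
Proof. by apply: (orthogonal_unit (oner_neq0 _)); entries; field. Qed.

Lemma half_turn_unit : 3%:R != 0 :> k -> half_turn k \in unitmx.
Proof. by move=> three_neq0; apply: (orthogonal_unit three_neq0); entries; ring. Qed.

(** Right multiplication by the quaternion j, hence commuting with the left
    multiplications lambda1, lambda2 and sigma. *)
Definition right_j : 'M[k]_4 := mx4_of_rows
  [:: [:: 0; 0; 0; 1];
      [:: 0; 0; 1; 0];
      [:: 0; -1; 0; 0];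
      [:: -1; 0; 0; 0] ].

Lemma right_j_unit : right_j \in unitmx.
Proof. by apply: (orthogonal_unit (oner_neq0 _)); entries; ring. Qed.

Lemma right_j_tau : right_j *m tau k = lambda4 k *m right_j.
Proof. by entries; ring. Qed.

Lemma right_j_comm : [/\ right_j *m lambda1 k = lambda1 k *m right_j,
  right_j *m lambda2 k = lambda2 k *m right_j & right_j *m sigma k = sigma k *m right_j].
Proof.
split; [by entries; ring | by entries; ring |].
by rewrite /sigma -scalemxAr -scalemxAl; congr (_ *: _); entries; ring.
Qed.

Lemma mxgenerated_conj (s t : seq 'M[k]_4) P : P \in unitmx ->
  (forall A, A \in s -> A \in unitmx) ->
  (forall A, A \in s -> P *m A *m invmx P \in t) ->
  forall A, mxgenerated s A -> mxgenerated t (P *m A *m invmx P).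
Proof.
move=> uP us st A sA; elim: sA => {A} [A As||A B sA IHA sB IHB|A sA IHA].
- exact/mxgen_mem/st.
- by rewrite mulmx1 mulmxV //; apply: mxgen1.
- rewrite (_ : _ *m _ *m _ = (P *m A *m invmx P) *m (P *m B *m invmx P)).
    exact: mxgenM.
  by rewrite !mulmxA mulmxKV.
rewrite (_ : _ *m _ *m _ = invmx (P *m A *m invmx P)); first exact: mxgenV.
have uA := mxgenerated_unit us sA.
have uC : P *m A *m invmx P \in unitmx by rewrite !unitmx_mul uP uA unitmx_inv.
apply: (can_inj (mulKmx uC)); rewrite mulmxV // !mulmxA mulmxKV //.
by rewrite mulmxK // mulmxV.
Qed.

(** Here tau becomes lambda4, so that (4,33,6) is treated inside (4,33,11). *)
Lemma group_4_33_6_conj A :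
  group_4_33_6 k A <->
  mxgenerated [:: lambda1 k; lambda2 k; sigma k; lambda4 k] (right_j *m A *m invmx right_j).
Proof.
have uJ := right_j_unit; have [c1 c2 c3] := right_j_comm; have ct := right_j_tau.
have us B : B \in [:: lambda1 k; lambda2 k; sigma k; tau k] -> B \in unitmx.
  rewrite !inE => /or4P [] /eqP ->;
    rewrite ?lambda1_unit ?lambda2_unit ?sigma_unit //.
  by rewrite -(mulKmx uJ (tau k)) ct !unitmx_mul unitmx_inv uJ lambda4_unit.
have ut B : B \in [:: lambda1 k; lambda2 k; sigma k; lambda4 k] -> B \in unitmx.
  by rewrite !inE => /or4P [] /eqP ->; rewrite ?lambda1_unit ?lambda2_unit ?sigma_unit ?lambda4_unit.
split.
  apply: mxgenerated_conj => // B; rewrite !inE => /or4P [] /eqP ->;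
    by rewrite ?c1 ?c2 ?c3 ?ct mulmxK // eqxx ?orbT.
have uJ' : invmx right_j \in unitmx by rewrite unitmx_inv.
move/(mxgenerated_conj uJ' ut (t := [:: lambda1 k; lambda2 k; sigma k; tau k])).
rewrite invmxK !mulmxA mulVmx // mul1mx mulmxKV //; apply => B.
by rewrite !inE => /or4P [] /eqP ->; rewrite -mulmxA -?c1 -?c2 -?c3 -?ct mulmxA mulVmx // mul1mx eqxx ?orbT.
Qed.

End GroupMatrices.

Section Rationality.
Variable k : fieldType.
Hypothesis two_neq0 : 2%:R != 0 :> k.
Notation K := (ratfun k 4).
Notation iota := (ratfunC k 4).
Notation x := (ratvar k (n := 4)).

Let two_neq0K : 2%:R != 0 :> K := ratfun_natr_neq0 two_neq0.

Let l1 : {rmorphism K -> K} := ratfun_aut (lambda1_unit k).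
Let l2 : {rmorphism K -> K} := ratfun_aut (lambda2_unit k).
Let sg : {rmorphism K -> K} := ratfun_aut (sigma_unit two_neq0).
Let l3 : {rmorphism K -> K} := ratfun_aut (lambda3_unit two_neq0).
Let l4 : {rmorphism K -> K} := ratfun_aut (lambda4_unit k).

Let acts_aut A (uA : A \in unitmx) : acts iota x (ratfun_aut uA) A.
Proof. by move=> j; apply: ratfun_aut_var. Qed.

Let l1A : acts iota x l1 (lambda1 k) := acts_aut _.
Let l2A : acts iota x l2 (lambda2 k) := acts_aut _.
Let sgA : acts iota x sg (sigma k) := acts_aut _.
Let l3A : acts iota x l3 (lambda3 k) := acts_aut _.
Let l4A : acts iota x l4 (lambda4 k) := acts_aut _.

Let norm : K := qnorm (x ord0) (x (lift ord0 ord0)) (x (lift ord0 (lift ord0 ord0)))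
  (x (lift ord0 (lift ord0 (lift ord0 ord0)))).

Lemma adjoin_vars (f : K) : adjoin iota (fun z => exists i, z = x i) f.
Proof.
set F := adjoin iota _; have fF : subfield F := adjoin_subfield iota _.
have Fp (p : {mpoly k[4]}) : F (tofrac p).
  rewrite (_ : tofrac p = mmap iota x p); first by apply: adjoin_mmap => i; exists i.
  apply: (@mpoly_rmorph_eq _ _ _ (@tofrac _) (mmap iota x)) => [c|i] /=; first by rewrite mmapC.
  by rewrite mmapX mmap1U.
by have [p [q [_ ->]]] := ratfunP f; apply: subfieldM => //; apply: subfieldV.
Qed.

Lemma rational_of_triple (G : 'M[k]_4 -> Prop) P s (fixed : K -> Prop) :
  is_GL_subgroup G -> finite_mxset G -> P \in unitmx ->
  (forall A, A \in s -> A \in unitmx) ->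
  (forall A, G A <-> mxgenerated s (P *m A *m invmx P)) ->
  (forall f, (forall A, A \in s -> ratfun_act A f = f) <-> fixed f) ->
  (forall f, fixed f -> l1 f = f) -> fixed norm ->
  generating_triple iota x fixed ->
  rational_over iota (fixed_field G (whole_field k 4)) /\
  rational_over iota (fixed_field G (degree0_field k 3)).
Proof.
move=> gG fG uP us GE sE fl1 fN [y [y0 yfix ygen]].
have y_deg0 i : degree0_field k 3 (y i).
  apply: adjoin_least (y0 i); first exact: adjoin_subfield.
    by move=> c; apply: adjoin_base.
  by move=> _ [[]|[a [b ->]]]; apply: degree0_ratio.
apply: (rational_from_generators gG fG uP us GE y_deg0) => [A sA|f /sE ff|f f0 /sE ff].
- by split; [apply: (sE norm).2|move=> i; apply: (sE (y i)).2].
- apply: (ygen (fun z => z = norm)) => [_ ->//||//].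
  exact: (even_functions two_neq0K (generic_qnorm_neq0 k) (ratvar_neq0 k _)
    l1A l2A sgA l3A l4A (ratfun_autC (lambda1_unit k)) (adjoin_vars f) (fl1 f ff)).
- have : adjoin iota (fun z => False \/ exists i, z = y i) f.
    apply: (ygen (fun=> False)) => //; apply: adjoin_mono f0 => _ [i ->].
    by right; exists (lift ord_max i), ord_max.
  by apply: adjoin_mono => z [].
Qed.
Let norm_fixed : [/\ l1 norm = norm, l2 norm = norm, sg norm = norm, l3 norm = norm & l4 norm = norm].
Proof. exact: (qnorm_fixed two_neq0K l1A l2A sgA l3A l4A). Qed.

Let q0 := generic_qnorm_neq0 k.
Let x2_neq0 : x (lift ord0 ord0) != 0 := ratvar_neq0 k _.
Let V1_neq0 := generic_axis1_neq0 k.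
Let w01 := generic_w_distinct two_neq0.
Let l1k := ratfun_autC (lambda1_unit k).
Let l2k := ratfun_autC (lambda2_unit k).
Let sgk := ratfun_autC (sigma_unit two_neq0).
Let l3k := ratfun_autC (lambda3_unit two_neq0).
Let l4k := ratfun_autC (lambda4_unit k).

Let generic_position : 3%:R != 0 :> k -> general_position (klein_w0 x) (klein_w1 x) (klein_w2 x) (klein_m x).
Proof.
move=> three_neq0; have [D0 n0 z0] := generic_symmetric_functions two_neq0 three_neq0.
exact: (general_positionI two_neq0K q0 V1_neq0 w01 sgA (ratfun_natr_neq0 three_neq0)).
Qed.

Let half_turn_aut : 3%:R != 0 :> k -> {gr : {rmorphism K -> K} | acts iota x gr (half_turn k)}.
Proof. by move=> three_neq0; exists (ratfun_aut (half_turn_unit three_neq0)); apply: acts_aut. Qed.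

Lemma triple_33_3 : generating_triple iota x (A4_fixed l1 l2 sg).
Proof.
have [three0|three_neq0] := eqVneq (3%:R : k) 0.
  apply: (generating_triple_33_3_char3 two_neq0K q0 x2_neq0 V1_neq0 w01 l1A l2A sgA l1k l2k sgk).
  by rewrite -(rmorph_nat iota) three0 rmorph0.
have [gr grA] := half_turn_aut three_neq0.
exact: (generating_triple_33_3 two_neq0K q0 x2_neq0 V1_neq0 w01 l1A l2A sgA l3A grA l1k l2k sgk
  (generic_position three_neq0)).
Qed.

Lemma triple_33_6 : generating_triple iota x (fun z => A4_fixed l1 l2 sg z /\ l4 z = z).
Proof.
have [three0|three_neq0] := eqVneq (3%:R : k) 0.
  apply: (generating_triple_33_6_char3 two_neq0K q0 x2_neq0 V1_neq0 w01 l1A l2A sgA l4A l1k l2k sgk l4k).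
  by rewrite -(rmorph_nat iota) three0 rmorph0.
have [gr grA] := half_turn_aut three_neq0.
exact: (generating_triple_33_6 two_neq0K q0 x2_neq0 V1_neq0 w01 l1A l2A sgA l3A l4A grA l1k l2k sgk l4k
  (generic_position three_neq0)).
Qed.

Let all_seq (s : seq 'M[k]_4) f : (forall A, A \in s -> ratfun_act A f = f) <->
  foldr (fun A Q => ratfun_act A f = f /\ Q) True s.
Proof.
elim: s => [|A s IHs] /=; first by split.
split=> [sf|[Af /IHs sf] B]; last by rewrite inE => /predU1P [->|/sf].
by split; [apply: sf; rewrite mem_head|apply/IHs => B Bs; apply: sf; rewrite inE Bs orbT].
Qed.

Section Groups.
Variable G : 'M[k]_4 -> Prop.
Hypotheses (gG : is_GL_subgroup G) (fG : finite_mxset G).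

Lemma rational_33_3 : GL_conjugate G (group_4_33_3 k) ->
  rational_over iota (fixed_field G (whole_field k 4)) /\
  rational_over iota (fixed_field G (degree0_field k 3)).
Proof.
move=> [P uP GE]; have [N1 N2 N3 _ _] := norm_fixed.
apply: (rational_of_triple gG fG uP _ GE _ _ _ triple_33_3) => //.
- by move=> A; rewrite !inE => /or3P [] /eqP ->; rewrite ?lambda1_unit ?lambda2_unit ?sigma_unit.
- by move=> f; rewrite all_seq; split=> [[e1 [e2 [e3 _]]]|[e1 e2 e3]];
  [exact: And3 e1 e2 e3 | exact: conj e1 (conj e2 (conj e3 I))].
- by move=> f [].
Qed.

Lemma rational_33_6 : GL_conjugate G (group_4_33_6 k) ->
  rational_over iota (fixed_field G (whole_field k 4)) /\
  rational_over iota (fixed_field G (degree0_field k 3)).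
Proof.
move=> [P uP GE]; have [N1 N2 N3 _ N4] := norm_fixed; have uJ := right_j_unit k.
have uJP : right_j k *m P \in unitmx by rewrite unitmx_mul uJ.
have GE' A : G A <-> mxgenerated [:: lambda1 k; lambda2 k; sigma k; lambda4 k]
    (right_j k *m P *m A *m invmx (right_j k *m P)).
  have -> : invmx (right_j k *m P) = invmx P *m invmx (right_j k).
    by apply: (can_inj (mulKmx uJP)); rewrite mulmxV // -!mulmxA (mulmxA P) mulmxV // mul1mx mulmxV.
  by rewrite GE (group_4_33_6_conj two_neq0) !mulmxA.
apply: (rational_of_triple gG fG uJP _ GE' _ _ _ triple_33_6) => //.
- by move=> A; rewrite !inE => /or4P [] /eqP ->; rewrite ?lambda1_unit ?lambda2_unit ?sigma_unit ?lambda4_unit.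
- by move=> f; rewrite all_seq; split=> [[e1 [e2 [e3 [e4 _]]]]|[[e1 e2 e3] e4]];
  [exact: conj (And3 e1 e2 e3) e4 | exact: conj e1 (conj e2 (conj e3 (conj e4 I)))].
- by move=> f [[]].
Qed.

Hypothesis three_neq0 : 3%:R != 0 :> k.

Let gr : {rmorphism K -> K} := ratfun_aut (half_turn_unit three_neq0).
Let grA : acts iota x gr (half_turn k) := acts_aut _.

Lemma rational_33_7 : GL_conjugate G (group_4_33_7 k) ->
  rational_over iota (fixed_field G (whole_field k 4)) /\
  rational_over iota (fixed_field G (degree0_field k 3)).
Proof.
move=> [P uP GE]; have [N1 N2 N3 N4 _] := norm_fixed.
have triple := generating_triple_33_7 two_neq0K q0 x2_neq0 V1_neq0 w01 l1A l2A sgA l3A l4A grA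
  l1k l2k sgk l3k (generic_position three_neq0).
apply: (rational_of_triple gG fG uP _ GE _ _ _ triple) => //.
- by move=> A; rewrite !inE => /or4P [] /eqP ->; rewrite ?lambda1_unit ?lambda2_unit ?sigma_unit ?lambda3_unit.
- by move=> f; rewrite all_seq; split=> [[e1 [e2 [e3 [e4 _]]]]|[[e1 e2 e3] e4]];
  [exact: conj (And3 e1 e2 e3) e4 | exact: conj e1 (conj e2 (conj e3 (conj e4 I)))].
- by move=> f [[]].
Qed.

Lemma rational_33_11 : GL_conjugate G (group_4_33_11 k) ->
  rational_over iota (fixed_field G (whole_field k 4)) /\
  rational_over iota (fixed_field G (degree0_field k 3)).
Proof.
move=> [P uP GE]; have [N1 N2 N3 N4 N5] := norm_fixed.
have triple := generating_triple_33_11 two_neq0K q0 x2_neq0 V1_neq0 w01 l1A l2A sgA l3A l4A grA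
  l1k l2k sgk l3k l4k (generic_position three_neq0).
apply: (rational_of_triple gG fG uP _ GE _ _ _ triple) => //.
- by move=> A; rewrite !inE => /or4P [| | |/orP []] /eqP ->;
    rewrite ?lambda1_unit ?lambda2_unit ?sigma_unit ?lambda3_unit ?lambda4_unit.
- by move=> f; rewrite all_seq; split=> [[e1 [e2 [e3 [e4 [e5 _]]]]]|[[e1 e2 e3] e4 e5]];
  [exact: And3 (And3 e1 e2 e3) e4 e5 | exact: conj e1 (conj e2 (conj e3 (conj e4 (conj e5 I))))].
- by move=> f [[]].
Qed.

End Groups.
End Rationality.

Theorem theorem1p3 :
  (forall (k : fieldType) (G : 'M[k]_4 -> Prop),
     2%N \notin [pchar k] ->
     is_GL_subgroup G -> finite_mxset G ->
     GL_conjugate G (group_4_33_3 k) \/ GL_conjugate G (group_4_33_6 k) ->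
     rational_over (ratfunC k 4) (fixed_field G (whole_field k 4)) /\
     rational_over (ratfunC k 4) (fixed_field G (degree0_field k 3)))
  /\
  (forall (k : fieldType) (G : 'M[k]_4 -> Prop),
     2%N \notin [pchar k] -> 3%N \notin [pchar k] ->
     is_GL_subgroup G -> finite_mxset G ->
     GL_conjugate G (group_4_33_7 k) \/ GL_conjugate G (group_4_33_11 k) ->
     rational_over (ratfunC k 4) (fixed_field G (whole_field k 4)) /\
     rational_over (ratfunC k 4) (fixed_field G (degree0_field k 3))).
Proof.
have natr_neq0 (k : fieldType) p : prime p -> p \notin [pchar k] -> p%:R != 0 :> k.
  by move=> pp; apply: contraNneq => p0; rewrite inE pp p0 eqxx.
split=> k G.
  move=> /(natr_neq0 k 2 isT) two_neq0 gG fG [cG|cG].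
    exact: (rational_33_3 two_neq0 gG fG cG).
  exact: (rational_33_6 two_neq0 gG fG cG).
move=> /(natr_neq0 k 2 isT) two_neq0 /(natr_neq0 k 3 isT) three_neq0 gG fG [cG|cG].
  exact: (rational_33_7 two_neq0 gG fG three_neq0 cG).
exact: (rational_33_11 two_neq0 gG fG three_neq0 cG).
Qed.
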